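(* Let $M$ be a smooth manifold of even dimension $n=2m\ge 2$ and let $\nabla$ be a torsion-free connection on $TM$. Let $J^\nabla$ be the almost complex structure defined by $\nabla$ on the bundle $J(M)$ of all endomorphisms $j$ of tangent spaces of $M$ with $j^2=-1$, and let $W^\nabla$ be the Weyl component of the curvature of $\nabla$. Then $J^\nabla$ is integrable if and only if $W^\nabla=0$.
   Context: Connections are smooth linear connections on the tangent bundle $TM$. $\nabla$ is torsion-free if $\nabla_XY-\nabla_YX-[X,Y]=0$. The curvature is $R^\nabla(X,Y)Z=\nabla_X\nabla_YZ-\nabla_Y\nabla_XZ-\nabla_{[X,Y]}Z$ and the Ricci curvature is $r^\nabla(X,Y)=\mathrm{Tr}\left(Z\mapsto R^\nabla(X,Z)Y\right)$ (not symmetric in general), with symmetric and skew parts $r^\nabla_+$ and $r^\nabla_-$. An almost complex structure is integrable if its Nijenhuis tensor vanishes (equivalently, it comes from a complex manifold structure). Weyl component: for a bilinear form $Q$ on tangent spaces, define the $\mathrm{End}(TM)$-valued $2$-form $[Q\wedge\mathrm{Id}]$ by $$[Q\wedge\mathrm{Id}](X,Y)Z=-Q(X,Y)Z-Q(X,Z)Y+Q(Y,X)Z+Q(Y,Z)X .$$ For torsion-free $\nabla$, the Weyl component $W^\nabla$ of the curvature is defined by $$R^\nabla=W^\nabla-\frac1{n-1}[r^\nabla_+\wedge\mathrm{Id}]-\frac1{n+1}[r^\nabla_-\wedge\mathrm{Id}];$$ it is the component of $R^\nabla$ in the kernel of the Ricci contraction. The almost complex structure $J^\nabla$: $J(M)$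 is the bundle over $M$ whose fibre at $x$ is $\{j\in\mathrm{End}(T_xM): j^2=-1\}$, with projection $\pi:J(M)\to M$. Let $E=\pi^*TM$, so $d\pi$ is a surjective bundle map $TJ(M)\to E$, with kernel the vertical bundle $\mathcal V$; at $j\in J(M)$ the space $\mathcal V_j$ is identified with the endomorphisms of $E_j=T_{\pi(j)}M$ which anticommute with $j$. The bundle $\mathrm{End}(E)$ has the canonical section $\mathcal J$ given by $\mathcal J_j=j$. A connection $\nabla$ on $TM$ induces the pull-back connection $\pi^*\nabla$ on $E$ (and on $\mathrm{End}(E)$), and $\pi^*\nabla\mathcal J$ is an $\mathrm{End}(E)$-valued $1$-form on $J(M)$ with values anticommuting with $\mathcal J$; as a map $TJ(M)\to\mathcal V$ it is surjective, and its kernel is mapped isomorphically onto $E$ by $d\pi$. $J^\nabla$ is the unique almost complex structure on $J(M)$ such that for all tangent vectors $X$ to $J(M)$ $$d\pi(J^\nabla X)=\mathcal J\,d\pi(X),\qquad (\pi^*\nabla)_{J^\nabla X}\mathcal J=\mathcal J\,(\pi^*\nabla)_X\mathcal J .$$ *)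

(* Defs.v *)
From mathcomp Require Import all_boot all_order all_algebra.
From mathcomp Require Import all_classical all_reals all_analysis.
Set Implicit Arguments.
Unset Strict Implicit.
Unset Printing Implicit Defensive.
Import Order.TTheory GRing.Theory Num.Theory.
Import numFieldNormedType.Exports.
Local Open Scope classical_set_scope.
Local Open Scope ring_scope.

Definition smooth_on (R : realType) (V W : normedModType R) (O : set V)
    (f : V -> W) : Prop :=
  forall (s : seq V) (p : V), O p ->
    differentiable (foldr (fun v (g : V -> W) => 'D_v g) f s) p.

(* The matrix of an endomorphism; vectors are columns. *)
Definition endo_mx (R : realType) (n : nat) (f : 'cV[R]_n -> 'cV[R]_n) :
    'M[R]_n :=
  \matrix_(i, k) f (delta_mx k ord0) i ord0.

(* An atlas is only data; the axioms are in [smooth_manifold]. The tangent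
   space at [x] is the model space [V] itself: a tangent vector is given by its
   components in the chart [chart_at x], so the components in any other chart
   come from the derivative of the transition map, see [tcoord]. *)
Record atlas (R : realType) (V : normedModType R) (M : Type) := Atlas {
  chart_ix : Type ;
  chart_dom : chart_ix -> set M ;
  chart : chart_ix -> M -> V ;
  chart_inv : chart_ix -> V -> M ;
  chart_at : M -> chart_ix }.

Section Calculus.
Variables (R : realType) (V : normedModType R) (M : Type) (A : atlas V M).
Local Notation ix := (chart_ix A).

Definition chart_img (i : ix) (U : set M) : set V :=
  chart i @` (U `&` chart_dom i).

Definition atlas_open (U : set M) : Prop :=
  forall i : ix, open (chart_img i U).

Definition tderiv (W : normedModType R) (f : M -> W) (x : M) (v : V) : W :=
  'D_v (f \o chart_inv (chart_at A x)) (chart (chart_at A x) x).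

Definition tcoord (i : ix) (x : M) (v : V) : V := tderiv (chart i) x v.

(* The vector at [y] with components [v] in the chart [i]; for fixed [i] and
   [v] this is a coordinate vector field with constant components. *)
Definition of_tcoord (i : ix) (v : V) (y : M) : V :=
  'D_v (chart (chart_at A y) \o chart_inv i) (chart i y).

Definition smooth_fun (W : normedModType R) (U : set M) (f : M -> W) : Prop :=
  forall i : ix, smooth_on (chart_img i U) (f \o chart_inv i).

Definition field_coord (i : ix) (X : M -> V) (y : V) : V :=
  tcoord i (chart_inv i y) (X (chart_inv i y)).

Definition smooth_field (U : set M) (X : M -> V) : Prop :=
  forall i : ix, smooth_on (chart_img i U) (field_coord i X).

Definition lie_bracket (X Y : M -> V) (x : M) : V :=
  let i := chart_at A x in
  'D_(X x) (field_coord i Y) (chart i x)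
  - 'D_(Y x) (field_coord i X) (chart i x).

(* Below, [S] is an embedded submanifold of [M] with tangent spaces
   [TS x]; a smooth vector field on an open subset of [S] is locally the
   restriction of a smooth vector field of [M] which is tangent to [S] along
   [S], and the bracket of the restrictions is the restriction of the bracket. *)
Variables (S : set M) (TS : M -> set V).

Definition tangent_field (U : set M) (X : M -> V) : Prop :=
  smooth_field U X /\ forall x, U x -> S x -> TS x (X x).

Definition almost_complex (J : M -> V -> V) : Prop :=
  (forall x, S x ->
     [/\ forall v, TS x v -> TS x (J x v),
         forall a u v, TS x u -> TS x v ->
           J x (a *: u + v) = a *: J x u + J x v
       & forall v, TS x v -> J x (J x v) = - v]) /\
  (forall U X x, atlas_open U -> tangent_field U X -> U x -> S x ->
     exists U' X', [/\ atlas_open U', U' x, tangent_field U' X'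
       & forall y, U y -> U' y -> S y -> X' y = J y (X y)]).

(* [JX] and [JY] are arbitrary local extensions of the fields [J X] and [J Y],
   which are only defined along [S]. *)
Definition nijenhuis_eq0 (J : M -> V -> V) : Prop :=
  forall (U : set M) (X Y JX JY : M -> V), atlas_open U ->
    tangent_field U X -> tangent_field U Y ->
    tangent_field U JX -> tangent_field U JY ->
    (forall x, U x -> S x -> JX x = J x (X x) /\ JY x = J x (Y x)) ->
  forall x, U x -> S x ->
    lie_bracket JX JY x - J x (lie_bracket JX Y x) - J x (lie_bracket X JY x)
    - lie_bracket X Y x = 0.

Definition integrable_acs (J : M -> V -> V) : Prop :=
  almost_complex J /\ nijenhuis_eq0 J.

End Calculus.

Definition tmap (R : realType) (V W : normedModType R) (M N : Type)
    (A : atlas V M) (B : atlas W N) (f : M -> N) (x : M) (v : V) : W :=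
  tderiv A (chart (chart_at B (f x)) \o f) x v.

Definition smooth_manifold (R : realType) (V : normedModType R)
    (M : topologicalType) (A : atlas V M) : Prop :=
  [/\ hausdorff_space M, @second_countable M,
      (forall x, chart_dom (chart_at A x) x),
      (forall i : chart_ix A,
        [/\ open (chart_dom i), open (chart i @` chart_dom i),
            forall x, chart_dom i x ->
              chart_inv i (chart i x) = x /\ {for x, continuous (chart i)}
          & forall y, (chart i @` chart_dom i) y ->
              {for y, continuous (chart_inv i)}])
    & (forall i j : chart_ix A,
        smooth_on (chart_img i (chart_dom j)) (chart j \o chart_inv i))].

Section Connection.
Variables (R : realType) (n : nat) (M : topologicalType).
Local Notation V := 'cV[R]_n.
Variable (A : atlas V M).

(* [nabla Y x v] is the covariant derivative at [x] of the vector field [Y] in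
   the direction [v]. It is meaningful only if [Y] is smooth near [x]. *)
Variable (nabla : (M -> V) -> M -> V -> V).

Record is_connection : Prop := IsConnection {
  nabla_linear : forall U Y x, open U -> smooth_field A U Y -> U x ->
    forall a u v, nabla Y x (a *: u + v) = a *: nabla Y x u + nabla Y x v ;
  nabla_add : forall U Y Z x, open U ->
    smooth_field A U Y -> smooth_field A U Z -> U x ->
    forall v, nabla (fun y => Y y + Z y) x v = nabla Y x v + nabla Z x v ;
  nabla_leibniz : forall U (f : M -> R^o) Y x, open U ->
    smooth_fun A U f -> smooth_field A U Y -> U x ->
    forall v, nabla (fun y => f y *: Y y) x v
      = f x *: nabla Y x v + tderiv A f x v *: Y x ;
  nabla_local : forall U Y Z x, open U ->
    smooth_field A U Y -> smooth_field A U Z -> U x ->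
    (forall y, U y -> Y y = Z y) ->
    forall v, nabla Y x v = nabla Z x v ;
  nabla_smooth : forall U X Y, open U ->
    smooth_field A U X -> smooth_field A U Y ->
    smooth_field A U (fun x => nabla Y x (X x)) }.

Definition torsion_free : Prop :=
  forall U X Y x, open U -> smooth_field A U X -> smooth_field A U Y -> U x ->
    nabla Y x (X x) - nabla X x (Y x) - lie_bracket A X Y x = 0.

Definition curvature_field (X Y Z : M -> V) (x : M) : V :=
  nabla (fun y => nabla Z y (Y y)) x (X x)
  - nabla (fun y => nabla Z y (X y)) x (Y x)
  - nabla Z x (lie_bracket A X Y x).

(* Smooth near [x], with value [v] at [x]. *)
Definition extend (x : M) (v : V) : M -> V := of_tcoord (chart_at A x) v.

(* The curvature is a tensor, so its value on tangent vectors may be computed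
   with any local extensions. *)
Definition curvature (x : M) (u v w : V) : V :=
  curvature_field (extend x u) (extend x v) (extend x w) x.

Definition ricci (x : M) (u v : V) : R :=
  \tr (endo_mx (fun w => curvature x u w v)).

Definition ricci_sym (x : M) (u v : V) : R :=
  2^-1 * (ricci x u v + ricci x v u).

Definition ricci_skew (x : M) (u v : V) : R :=
  2^-1 * (ricci x u v - ricci x v u).

Definition wedge_id (Q : V -> V -> R) (u v w : V) : V :=
  - (Q u v *: w) - Q u w *: v + Q v u *: w + Q v w *: u.

Definition weyl (x : M) (u v w : V) : V :=
  curvature x u v w
  + (n%:R - 1)^-1 *: wedge_id (ricci_sym x) u v w
  + (n%:R + 1)^-1 *: wedge_id (ricci_skew x) u v w.

(* The total space of End(TM): the pair [(x, a)] is the endomorphism of the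
   tangent space at [x] with matrix [a] in the chart [chart_at x]. Its topology
   is the one given by the atlas below (see [atlas_open]), not the product
   topology, since [chart_at] need not be locally constant. *)
Definition endT : Type := (M * 'M[R]_n)%type.
Local Notation E := ('cV[R]_n * 'M[R]_n)%type.

Definition jacobian (i : chart_ix A) (x : M) : 'M[R]_n := endo_mx (tcoord i x).

Definition endT_atlas : atlas E endT := {|
  chart_ix := chart_ix A ;
  chart_dom := fun i p => chart_dom i p.1 ;
  chart := fun i p =>
    (chart i p.1, jacobian i p.1 *m p.2 *m invmx (jacobian i p.1)) ;
  chart_inv := fun i q =>
    let x := chart_inv i q.1 in
    (x, invmx (jacobian i x) *m q.2 *m jacobian i x) ;
  chart_at := fun p => chart_at A p.1 |}.

Definition JM : set endT := [set p | p.2 *m p.2 = - 1%:M].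

(* The linearisation of [j ^ 2 = - 1] in the chart [chart_at p]. *)
Definition TJM (p : endT) : set E :=
  [set xi | xi.2 *m p.2 + p.2 *m xi.2 = 0].

Definition dproj (p : endT) (xi : E) : V := tmap endT_atlas A fst p xi.

(* The pull-back of [nabla] to the pull-back of TM to the total space. The
   components [s^k] of a section [s] in the frame [e_k] of the chart [i] give
   [D_xi s = xi(s^k) e_k + s^k (nabla_(dproj xi) e_k)]. *)
Definition pullback_cov (s : endT -> V) (p : endT) (xi : E) : V :=
  let i := chart_at A p.1 in
  tderiv endT_atlas (fun q : endT => tcoord i q.1 (s q)) p xi
  + nabla (extend p.1 (s p)) p.1 (dproj p xi).

(* The induced connection on endomorphisms: [(D_xi a) w = D_xi (a w) - a (D_xi w)]. *)
Definition pullback_cov_end (a : endT -> 'M[R]_n) (p : endT) (xi : E) :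
    'M[R]_n :=
  endo_mx (fun w : V =>
    pullback_cov (fun q : endT => a q *m extend p.1 w q.1) p xi
    - a p *m pullback_cov (fun q : endT => extend p.1 w q.1) p xi).

Definition tautological (p : endT) : 'M[R]_n := p.2.

(* Along [JM] there is exactly one such vector, because a vector tangent to
   [JM] is determined by its projection and by the covariant derivative of the
   tautological section along it. *)
Definition Jnabla (p : endT) (xi : E) : E :=
  xget 0 [set eta | [/\ TJM p eta,
    dproj p eta = tautological p *m dproj p xi
  & pullback_cov_end tautological p eta
    = tautological p *m pullback_cov_end tautological p xi]].

End Connection.

(* Main.v *)
(** In a chart, let [Gam] be the Christoffel matrices of the connection and put
    [vert (v, beta) = beta + [Gam v, b]] at the point [b] of the fibre.  Then
    [J^nabla] multiplies both [v] and [vert] by [b] on the left.  As the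
    connection is torsion-free, the horizontal part of the Nijenhuis tensor
    vanishes, and its vertical part at horizontal components [v], [w] is
      [- [R(bv,bw),b] + b[R(bv,w),b] + b[R(v,bw),b] + [R(v,w),b]],
    so integrability means that this expression is zero for all [b] with
    [b^2 = -1].  If [R] is of the form [- [Q /\ Id]] it is zero identically.
    Conversely, if [A^2 = B^2 = 0] and [AB + BA = -1] then [b = t A + t^-1 B] has
    square [-1] for every [t <> 0]; the leading term in [t] gives
    [A R(x, y) z = 0] for [x], [y], [z] in the image of [A].  Every complementary
    pair of coordinate subspaces of dimension [m] arises as the images of such
    [A], [B], also after a shear of the basis; comparing the resulting relations
    between the components of [R] and using the Bianchi identity one finds
    [R = - [Q /\ Id]], and taking Ricci traces [W = 0]. *)

From HB Require Import structures.
Require Import Defs.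
From mathcomp Require Import all_boot all_order all_algebra ring lra zify.
From mathcomp Require Import fingroup perm.
From mathcomp Require Import all_classical all_reals all_analysis.
Set Implicit Arguments.
Unset Strict Implicit.
Unset Printing Implicit Defensive.
Import Order.TTheory GRing.Theory Num.Theory.
Import numFieldNormedType.Exports.
Local Open Scope classical_set_scope.
Local Open Scope ring_scope.

(** * Smooth maps between finite-dimensional spaces *)

(** Vector fields on [J(M)] come with arbitrary extensions off the submanifold, and [J^nabla] fixes
    [JX] and [JY] only along it. A relation such as [vert (JX) = b vert X] may thus be
    differentiated only in directions tangent to [b^2 = -1]; [derive_eq_acs] justifies this, and it
    is the reason why tangency of the fields and brackets is carried along. As [chart_at] may jump
    from point to point, the equations defining [J^nabla] are known at first only in the preferred
    chart of each point. That [vert] transforms by conjugation under a change of chart carries them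
    to a fixed chart on a neighbourhood. In the algebra, a coordinate subspace of dimension [m]
    contains three distinct given basis vectors only if [m >= 3]. Hence only two indices are placed
    in it and the shears supply the third by polarisation, which covers [m = 2] as well; for [m = 1]
    the form [Q] is written down directly. *)

Section Frames.
Variable R : realType.
Implicit Types U V W Z : normedModType R.

(** Finite dimensionality in a usable form: a finite family of vectors with continuous linear
    coordinates. It makes linear and bilinear maps continuous, and turns a derivative in a varying
    direction into a finite sum of derivatives in fixed directions. *)
Definition framed W := exists (N : nat) (b : 'I_N -> W) (c : 'I_N -> W -> R),
  [/\ forall k, linear (c k : W -> R^o), forall k, continuous (c k)
    & forall w, w = \sum_k c k w *: b k].

Lemma framed_mx m n : framed 'M[R]_(m, n).
Proof.
exists #|{: 'I_m * 'I_n}|, (fun k => delta_mx (enum_val k).1 (enum_val k).2),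
  (fun k (A : 'M[R]_(m, n)) => A (enum_val k).1 (enum_val k).2); split=> [k a A B|k|A].
- by rewrite !mxE.
- exact: coord_continuous.
rewrite {1}(matrix_sum_delta A) pair_bigA /=.
by rewrite (reindex _ (onW_bij _ (@enum_val_bij ('I_m * 'I_n)%type))).
Qed.

Lemma framed_real : framed R^o.
Proof.
exists 1%N, (fun=> 1 : R^o), (fun _ x => x); split=> [k a A B|k x|x] //.
by rewrite big_ord1 [RHS]mulr1.
Qed.

Lemma framed_prod V W : framed V -> framed W -> framed (V * W)%type.
Proof.
move=> [N1 [b1 [c1 [l1 k1 e1]]]] [N2 [b2 [c2 [l2 k2 e2]]]].
exists (N1 + N2)%N,
  (fun k : 'I_(N1 + N2) =>
     match fintype.split k with inl i => (b1 i, 0) | inr i => (0, b2 i) end),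
  (fun (k : 'I_(N1 + N2)) p =>
     match fintype.split k with inl i => c1 i p.1 | inr i => c2 i p.2 end); split.
- by move=> k a u v; case: fintype.split => i /=; [exact: l1|exact: l2].
- move=> k; case: fintype.split => i p.
    apply: (@continuous_comp _ _ _ (@fst V W) (c1 i)); last exact: k1.
    exact: cvg_fst.
  apply: (@continuous_comp _ _ _ (@snd V W) (c2 i)); last exact: k2.
  exact: cvg_snd.
- move=> p; rewrite big_split_ord /=.
  under eq_bigr do rewrite (unsplitK (inl _)).
  under [X in _ + X]eq_bigr do rewrite (unsplitK (inr _)).
  rewrite [LHS]surjective_pairing [RHS]surjective_pairing /=.
  have f1 N (F : 'I_N -> V * W) : (\sum_i F i).1 = \sum_i (F i).1.
    by apply: (big_morph (@fst V W)).
  have f2 N (F : 'I_N -> V * W) : (\sum_i F i).2 = \sum_i (F i).2.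
    by apply: (big_morph (@snd V W)).
  rewrite !f1 !f2 /= -e1 -e2.
  by rewrite !big1 ?addr0 ?add0r // => i _; rewrite scaler0.
Qed.

Lemma framed_linear_continuous W Z (L : {linear W -> Z}) :
  framed W -> continuous L.
Proof.
move=> [N [b [c [lc kc e]]]] w.
have -> : (L : W -> Z) = fun w => \sum_k c k w *: L (b k).
  by apply/funext => u; rewrite {1}(e u) linear_sum; apply: eq_bigr => k _; rewrite linearZ.
by apply: cvg_big => [|k _]; [exact: add_continuous|apply: cvgZr_tmp; exact: kc].
Qed.

Section Pointwise.
Variables V W Z : normedModType R.
Hypothesis fW : framed W.

Lemma is_diff_linear_comp (L : {linear W -> Z}) (f : V -> W) x :
  differentiable f x -> is_diff x (L \o f) (L \o 'd f x).
Proof.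
move=> df; have kL : continuous L by exact: framed_linear_continuous.
have dL : is_diff (f x) L L.
  by apply: DiffDef; [exact: linear_differentiable|rewrite diff_lin].
exact: (is_diff_comp (differentiableP df) dL).
Qed.

Lemma differentiable_linear_comp (L : {linear W -> Z}) (f : V -> W) x :
  differentiable f x -> differentiable (L \o f) x.
Proof. by move=> /(is_diff_linear_comp L) []. Qed.

Lemma derive_linear_comp (L : {linear W -> Z}) (f : V -> W) x v :
  differentiable f x -> 'D_v (L \o f) x = L ('D_v f x).
Proof.
move=> df; have [dLf e] := is_diff_linear_comp L df.
by rewrite (deriveE _ dLf) (deriveE _ df) e.
Qed.
End Pointwise.

Lemma derive_comp U V W (f : U -> V) (g : V -> W) x v :
  differentiable f x -> differentiable g (f x) ->
  'D_v (g \o f) x = 'D_('D_v f x) g (f x).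
Proof.
move=> df dg; rewrite (deriveE _ df) (deriveE _ dg).
by rewrite (deriveE _ (differentiable_comp df dg)) diff_comp.
Qed.

Lemma derive_linear V W (f : V -> W) x a u v : differentiable f x ->
  'D_(a *: u + v) f x = a *: 'D_u f x + 'D_v f x.
Proof. by move=> df; rewrite !(deriveE _ df) linearP. Qed.

Section Bilinear.
Variables V W1 W2 Z : normedModType R.
Hypotheses (fW1 : framed W1) (fW2 : framed W2).
Variable B : {bilinear W1 -> W2 -> Z}.

Lemma framed_bilinear_continuous : continuous (fun p : W1 * W2 => B p.1 p.2).
Proof.
have [N1 [b1 [c1 [l1 k1 e1]]]] := fW1.
have [N2 [b2 [c2 [l2 k2 e2]]]] := fW2.
have -> : (fun p : W1 * W2 => B p.1 p.2) =
    fun p => \sum_k \sum_l (c1 k p.1 * c2 l p.2) *: B (b1 k) (b2 l).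
  apply/funext => p; rewrite {1}(e1 p.1) linear_sumlz; apply: eq_bigr => k _.
  rewrite linearZl_LR {1}(e2 p.2) linear_sumr scaler_sumr.
  by apply: eq_bigr => l _; rewrite linearZr_LR scalerA.
move=> p; apply: cvg_big => [|k _]; first exact: add_continuous.
  apply: cvg_big => [|l _]; first exact: add_continuous.
  apply: cvgZr_tmp.
apply: cvgM.
  by apply: (@continuous_comp _ _ _ (@fst W1 W2) (c1 k)); [exact: cvg_fst|exact: k1].
by apply: (@continuous_comp _ _ _ (@snd W1 W2) (c2 l)); [exact: cvg_snd|exact: k2].
Qed.

Lemma is_diff_bilinear_comp f g (x : V) :
  differentiable f x -> differentiable g x ->
  is_diff x (fun x => B (f x) (g x)) (fun v => B ('d f x v) (g x) + B (f x) ('d g x v)).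
Proof.
move=> df dg; have kB := framed_bilinear_continuous.
have dB : is_diff (f x, g x) (fun p => B p.1 p.2)
    (fun q => B (f x) q.2 + B q.1 (g x)).
  by apply: DiffDef; [exact: differentiable_bilin|rewrite diff_bilin].
have dfg : is_diff x (fun y => (f y, g y)) (fun v => ('d f x v, 'd g x v)).
  by apply: is_diff_pair; exact: differentiableP.
apply: is_diff_eq (is_diff_comp dfg dB) _.
by apply/funext => v /=; rewrite addrC.
Qed.

Lemma differentiable_bilinear_comp f g (x : V) :
  differentiable f x -> differentiable g x ->
  differentiable (fun x => B (f x) (g x)) x.
Proof. by move=> df /(is_diff_bilinear_comp df) []. Qed.

Lemma derive_bilinear_comp f g (x v : V) :
  differentiable f x -> differentiable g x ->
  'D_v (fun x => B (f x) (g x)) x = B ('D_v f x) (g x) + B (f x) ('D_v g x).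
Proof.
move=> df dg; have [dB e] := is_diff_bilinear_comp df dg.
by rewrite (deriveE _ df) (deriveE _ dg) (deriveE _ dB) e.
Qed.
End Bilinear.

Section Smooth.
Implicit Types k : nat.

(** [smooth_on] restated order by order, so that the product and chain rules can be proved by
    induction with the functions varying. [Cn 0] already means differentiable on [O]: the iterated
    derivatives up to order [k] are all differentiable. *)
Fixpoint Cn k V W (O : set V) (f : V -> W) : Prop :=
  (forall p, O p -> differentiable f p) /\
  if k is k'.+1 then forall v, Cn k' O ('D_v f) else True.

Lemma Cn_differentiable k V W (O : set V) (f : V -> W) p :
  Cn k O f -> O p -> differentiable f p.
Proof. by case: k => [|k] [df _]; exact: df. Qed.

Lemma smooth_onP V W (O : set V) (f : V -> W) : smooth_on O f <-> forall k, Cn k O f.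
Proof.
split=> [sf k|cf s].
  elim: k f sf => [|k ih] f sf; split=> //.
  - exact: (sf [::]).
  - exact: (sf [::]).
  - by move=> v; apply: ih => s; have := sf (rcons s v); rewrite foldr_rcons.
elim/last_ind: s f cf => [|s v ih] f cf p Op; first exact: Cn_differentiable (cf 0%N) Op.
by rewrite foldr_rcons; apply: ih => // k; have [_] := cf k.+1; exact.
Qed.

Lemma smooth_on_differentiable V W (O : set V) (f : V -> W) p :
  smooth_on O f -> O p -> differentiable f p.
Proof. by move=> sf; exact: (sf [::]). Qed.

Lemma smooth_on_derive V W (O : set V) (f : V -> W) v :
  smooth_on O f -> smooth_on O ('D_v f).
Proof. by move=> sf s; have := sf (rcons s v); rewrite foldr_rcons. Qed.

Lemma smooth_onS V W (O O' : set V) (f : V -> W) :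
  O' `<=` O -> smooth_on O f -> smooth_on O' f.
Proof. by move=> sO sf s p /sO; exact: sf. Qed.

Lemma derive_congr V W (O : set V) (f g : V -> W) p v : open O -> O p ->
  {in O, f =1 g} -> 'D_v f p = 'D_v g p.
Proof.
move=> oO Op fg; apply: near_eq_derive.
by apply: filterS (open_nbhs_nbhs (conj oO Op)) => q Oq; apply: fg; rewrite inE.
Qed.

(** The first-order expansion of [f] at [p] is also one of [g], as the two agree near [p];
    uniqueness then identifies its linear part with ['d g p]. *)
Lemma differentiable_congr V W (O : set V) (f g : V -> W) p : open O -> O p ->
  {in O, f =1 g} -> differentiable f p -> differentiable g p.
Proof.
move=> oO Op fg df.
have nO : \forall h \near (0 : V), O (h + p).
  have kp : (h + p) @[h --> (0 : V)] --> 0 + p.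
    by apply: cvgD; [exact: cvg_id|exact: cvg_cst].
  by apply: kp; rewrite add0r; exact: open_nbhs_nbhs.
have [kd ed] := (diff_locallyP p f).1 df.
have eg : g \o shift p = cst (g p) + 'd f p +o_ 0 id.
  apply/eqaddoP => e e0; have /(_ e e0) := (eqaddoP _ _ _ _).1 ed.
  apply: filterS2 nO => h Oh; congr (`|_| <= _).
  by rewrite !fctE /= -!fg ?inE.
by apply/diff_locallyP; rewrite (diff_unique kd eg).
Qed.

Lemma Cn_congr k V W (O : set V) (f g : V -> W) : open O ->
  {in O, f =1 g} -> Cn k O f -> Cn k O g.
Proof.
move=> oO; elim: k f g => [|k ih] f g fg [df cf]; split=> //.
- by move=> p Op; exact: (differentiable_congr oO Op fg (df p Op)).
- by move=> p Op; exact: (differentiable_congr oO Op fg (df p Op)).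
- move=> v; apply: ih (cf v) => p; rewrite inE => Op.
  exact: (derive_congr _ oO Op fg).
Qed.

Lemma Cn_cst k V W (O : set V) (a : W) : Cn k O (fun _ : V => a).
Proof.
elim: k a => [|k ih] a; split=> // v.
rewrite (_ : 'D_v _ = fun=> 0) //.
by apply/funext => x; exact: derive_cst.
Qed.

Lemma Cn_add k V W (O : set V) (f g : V -> W) : open O ->
  Cn k O f -> Cn k O g -> Cn k O (fun x => f x + g x).
Proof.
move=> oO; elim: k f g => [|k ih] f g [df cf] [dg cg]; split=> //.
- by move=> p Op; apply: differentiableD; [exact: df|exact: dg].
- by move=> p Op; apply: differentiableD; [exact: df|exact: dg].
move=> v; apply: Cn_congr oO _ (ih _ _ (cf v) (cg v)) => p; rewrite inE => Op.
by rewrite [RHS]deriveD //; apply: diff_derivable; [exact: df|exact: dg].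
Qed.

Lemma Cn_linear_comp k V W Z (O : set V) (L : {linear W -> Z}) (f : V -> W) :
  open O -> framed W -> Cn k O f -> Cn k O (fun x => L (f x)).
Proof.
move=> oO fW; elim: k f => [|k ih] f [df cf]; split=> //.
- by move=> p Op; apply: differentiable_linear_comp => //; exact: df.
- by move=> p Op; apply: differentiable_linear_comp => //; exact: df.
move=> v; apply: Cn_congr oO _ (ih _ (cf v)) => p; rewrite inE => Op.
by rewrite [RHS](derive_linear_comp fW) //; exact: df.
Qed.

Lemma Cn_S k V W (O : set V) (f : V -> W) : Cn k.+1 O f -> Cn k O f.
Proof. by elim: k f => [|k ih] f [df cf]; split=> // v; apply: ih. Qed.

Lemma Cn_bilinear_comp k V W1 W2 Z (O : set V) (B : {bilinear W1 -> W2 -> Z}) f g :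
  open O -> framed W1 -> framed W2 -> Cn k O f -> Cn k O g ->
  Cn k O (fun x => B (f x) (g x)).
Proof.
move=> oO fW1 fW2; elim: k f g => [|k ih] f g cf cg; split=> //.
- by move=> p Op; apply: differentiable_bilinear_comp => //;
    [case: cf|case: cg] => d _; exact: d.
- by move=> p Op; apply: differentiable_bilinear_comp => //;
    [case: cf|case: cg] => d _; exact: d.
move=> v.
have h1 := ih _ _ (cf.2 v) (Cn_S cg); have h2 := ih _ _ (Cn_S cf) (cg.2 v).
apply: Cn_congr oO _ (Cn_add oO h1 h2) => p; rewrite inE => Op.
by rewrite derive_bilinear_comp //; [case: cf|case: cg] => d _; exact: d.
Qed.

(** Scaling with its first argument in [R^o], so that the Leibniz rule for bilinear maps also covers
    a scalar function times a vector-valued one. *)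
Definition regular_scale W (a : R^o) (w : W) : W := a *: w.

Lemma regular_scale_is_bilinear W : bilinear_for
  (GRing.Scale.Law.clone _ _ *:%R _) (GRing.Scale.Law.clone _ _ *:%R _)
  (@regular_scale W).
Proof.
rewrite /regular_scale; split=> [u'|u] a x y /=; first by rewrite scalerDl scalerA.
by rewrite scalerDr !scalerA mulrC.
Qed.
HB.instance Definition _ W := bilinear_isBilinear.Build R R^o W W _ _
  (@regular_scale W) (@regular_scale_is_bilinear W).

Lemma Cn_sum k V W (O : set V) N (f : 'I_N -> V -> W) : open O ->
  (forall i, Cn k O (f i)) -> Cn k O (fun x => \sum_i f i x).
Proof.
move=> oO cf.
elim: (index_enum _) => [|i s ih].
  apply: Cn_congr oO _ (Cn_cst k O 0) => p _; by rewrite big_nil.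
by apply: Cn_congr oO _ (Cn_add oO (cf i) ih) => p _; rewrite big_cons.
Qed.

Lemma Cn_comp k V W Z (O : set V) (O' : set W) (f : V -> W) (g : W -> Z) :
  open O -> framed W -> framed Z -> (forall x, O x -> O' (f x)) ->
  Cn k O f -> Cn k O' g -> Cn k O (g \o f).
Proof.
move=> oO fW fZ fO.
have fR := framed_real.
have [N [b [c [lc kc e]]]] := fW.
elim: k f g fO => [|k ih] f g fO cf cg; split=> //.
- by move=> p Op; apply: differentiable_comp; [case: cf|case: cg] => d _; apply: d; auto.
- by move=> p Op; apply: differentiable_comp; [case: cf|case: cg] => d _; apply: d; auto.
move=> v.
pose L i : {linear W -> R^o} := HB.pack (c i : W ->
  R^o) (GRing.isLinear.Build _ _ _ _ (c i : W -> R^o) (lc i)).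
pose S : {bilinear R^o -> Z -> Z} := @regular_scale Z.
(* In the frame of [W] the chain rule gives a sum of coordinates of ['D_v f] times the composites
   ['D_(b i) g \o f]. The directions [b i] being fixed, the induction hypothesis applies to each
   composite. *)
apply: (@Cn_congr k _ _ _ (fun x => \sum_i S (L i ('D_v f x)) ('D_(b i) g (f x)))) => //.
  move=> p; rewrite inE => Op.
  have dg : differentiable g (f p) by case: cg => d _; apply: d; exact: fO.
  rewrite derive_comp //; last by case: cf => d _; apply: d.
  rewrite (deriveE _ dg) [in RHS](e ('D_v f p)) linear_sum.
  by apply: eq_bigr => i _; rewrite linearZ (deriveE _ dg).
apply: Cn_sum => // i; apply: Cn_bilinear_comp => //.
  by apply: Cn_linear_comp => //; exact: cf.2.
apply: (ih f ('D_(b i) g)) => //; [exact: Cn_S|exact: cg.2].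
Qed.

Lemma derive_pair V W Z (f : V -> W) (g : V -> Z) x v :
  differentiable f x -> differentiable g x ->
  'D_v (fun y => (f y, g y)) x = ('D_v f x, 'D_v g x).
Proof.
move=> df dg; rewrite (deriveE _ (differentiable_pair df dg)) diff_pair //.
by rewrite (deriveE _ df) (deriveE _ dg).
Qed.

Lemma Cn_pair k V W Z (O : set V) (f : V -> W) (g : V -> Z) : open O ->
  Cn k O f -> Cn k O g -> Cn k O (fun x => (f x, g x)).
Proof.
move=> oO; elim: k f g => [|k ih] f g [df cf] [dg cg]; split=> //.
- by move=> p Op; apply: differentiable_pair; [exact: df|exact: dg].
- by move=> p Op; apply: differentiable_pair; [exact: df|exact: dg].
move=> v; apply: Cn_congr oO _ (ih _ _ (cf v) (cg v)) => p; rewrite inE => Op.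
by rewrite [RHS]derive_pair //; [exact: df|exact: dg].
Qed.

Lemma Cn_id k V (O : set V) : Cn k O (fun x : V => x).
Proof.
case: k => [|k]; split=> // v.
rewrite (_ : 'D_v _ = fun=> v); first exact: Cn_cst.
by apply/funext => x; exact: derive_id.
Qed.

Section SmoothOn.
Variables (V : normedModType R) (O : set V).
Hypothesis oO : open O.

Lemma smooth_on_congr W (f g : V -> W) :
  {in O, f =1 g} -> smooth_on O f -> smooth_on O g.
Proof. by move=> fg /smooth_onP cf; apply/smooth_onP => k; exact: Cn_congr (cf k). Qed.

Lemma smooth_on_cst W (a : W) : smooth_on O (fun=> a).
Proof. by apply/smooth_onP => k; exact: Cn_cst. Qed.

Lemma smooth_on_id : smooth_on O (fun x => x).
Proof. by apply/smooth_onP => k; exact: Cn_id. Qed.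

Lemma smooth_on_add W (f g : V -> W) :
  smooth_on O f -> smooth_on O g -> smooth_on O (fun x => f x + g x).
Proof. by move=> /smooth_onP cf /smooth_onP cg; apply/smooth_onP => k; exact: Cn_add. Qed.

Lemma smooth_on_sum W N (f : 'I_N -> V -> W) :
  (forall i, smooth_on O (f i)) -> smooth_on O (fun x => \sum_i f i x).
Proof. by move=> cf; apply/smooth_onP => k; apply: Cn_sum => // i; have /smooth_onP := cf i;
  exact. Qed.

Lemma smooth_on_pair W Z (f : V -> W) (g : V -> Z) :
  smooth_on O f -> smooth_on O g -> smooth_on O (fun x => (f x, g x)).
Proof. by move=> /smooth_onP cf /smooth_onP cg; apply/smooth_onP => k; exact: Cn_pair. Qed.

Lemma smooth_on_linear_comp W Z (L : {linear W -> Z}) (f : V -> W) :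
  framed W -> smooth_on O f -> smooth_on O (fun x => L (f x)).
Proof. by move=> fW /smooth_onP cf; apply/smooth_onP => k; exact: Cn_linear_comp. Qed.

Lemma smooth_on_bilinear_comp W1 W2 Z (B : {bilinear W1 -> W2 -> Z}) f g :
  framed W1 -> framed W2 -> smooth_on O f -> smooth_on O g ->
  smooth_on O (fun x => B (f x) (g x)).
Proof.
move=> fW1 fW2 /smooth_onP cf /smooth_onP cg.
by apply/smooth_onP => k; exact: Cn_bilinear_comp.
Qed.

Lemma smooth_on_comp W Z (O' : set W) (f : V -> W) (g : W -> Z) :
  framed W -> framed Z -> (forall x, O x -> O' (f x)) ->
  smooth_on O f -> smooth_on O' g -> smooth_on O (g \o f).
Proof.
move=> fW fZ fO /smooth_onP cf /smooth_onP cg.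
by apply/smooth_onP => k; exact: Cn_comp fO _ (cg k).
Qed.

Lemma smooth_on_scale W (f : V -> R^o) (g : V -> W) : framed W ->
  smooth_on O f -> smooth_on O g -> smooth_on O (fun x => f x *: g x).
Proof.
move=> fW; exact: (@smooth_on_bilinear_comp _ _ _ (@regular_scale W) f g framed_real fW).
Qed.

Lemma smooth_on_opp W (f : V -> W) : framed W -> smooth_on O f ->
  smooth_on O (fun x => - f x).
Proof.
move=> fW cf; apply: smooth_on_congr (smooth_on_scale fW (smooth_on_cst (-1 : R^o)) cf).
by move=> x _; rewrite scaleN1r.
Qed.

Lemma smooth_on_mulmx p q r (f : V -> 'M[R]_(p, q)) (g : V -> 'M[R]_(q, r)) :
  smooth_on O f -> smooth_on O g -> smooth_on O (fun x => f x *m g x).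
Proof.
apply: (@smooth_on_bilinear_comp _ _ _ (@mulmx R p q r)); exact: framed_mx.
Qed.

Lemma smooth_on_fst W Z (f : V -> W * Z) : framed W -> framed Z ->
  smooth_on O f -> smooth_on O (fun x => (f x).1).
Proof.
move=> fW fZ; apply: (@smooth_on_linear_comp _ _ (@fst W Z)).
exact: framed_prod.
Qed.

Lemma smooth_on_snd W Z (f : V -> W * Z) : framed W -> framed Z ->
  smooth_on O f -> smooth_on O (fun x => (f x).2).
Proof.
move=> fW fZ; apply: (@smooth_on_linear_comp _ _ (@snd W Z)).
exact: framed_prod.
Qed.

Lemma smooth_on_entry p q (f : V -> 'M[R]_(p, q)) i j :
  smooth_on O f -> smooth_on O (fun x => f x i j : R^o).
Proof.
have lc : linear (fun A : 'M[R]_(p, q) => A i j : R^o) by move=> a A B; rewrite !mxE.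
pose L : {linear 'M[R]_(p, q) -> R^o} := HB.pack (fun A : 'M[R]_(p, q) => A i j : R^o)
  (GRing.isLinear.Build _ _ _ _ _ lc).
by apply: (@smooth_on_linear_comp _ _ L); exact: framed_mx.
Qed.

Lemma smooth_on_mx p q (f : V -> 'M[R]_(p, q)) :
  (forall i j, smooth_on O (fun x => f x i j : R^o)) -> smooth_on O f.
Proof.
move=> cf; apply: (@smooth_on_congr _ (fun x => \sum_i \sum_j f x i j *: delta_mx i j)).
  by move=> x _; rewrite -matrix_sum_delta.
apply: smooth_on_sum => i; apply: smooth_on_sum => j.
apply: smooth_on_scale; [exact: framed_mx|exact: cf|exact: smooth_on_cst].
Qed.

(** The direction [F x] varies with the point, as when the components of a vector field are changed
    from one chart to another. *)
Lemma smooth_on_derive_comp W Z (O' : set W) (F f : V -> W) (g : W -> Z) :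
  framed W -> framed Z -> (forall x, O x -> O' (f x)) ->
  smooth_on O F -> smooth_on O f -> smooth_on O' g ->
  smooth_on O (fun x => 'D_(F x) g (f x)).
Proof.
move=> fW fZ fO sF sf sg.
have [N [b [c [lc kc e]]]] := fW.
pose L i : {linear W -> R^o} :=
  HB.pack (c i : W -> R^o) (GRing.isLinear.Build _ _ _ _ (c i : W -> R^o) (lc i)).
apply: (@smooth_on_congr _ (fun x => \sum_i L i (F x) *: 'D_(b i) g (f x))).
  move=> x; rewrite inE => Ox; have dg := smooth_on_differentiable sg (fO _ Ox).
  rewrite (deriveE _ dg) [in RHS](e (F x)) linear_sum.
  by apply: eq_bigr => i _; rewrite linearZ (deriveE _ dg).
apply: smooth_on_sum => i; apply: smooth_on_scale => //.
  exact: smooth_on_linear_comp.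
exact: (smooth_on_comp (g := 'D_(b i) g) fW fZ fO sf (smooth_on_derive _ sg)).
Qed.
End SmoothOn.

End Smooth.
End Frames.

(** * Fields in charts *)

Section GoodAtlas.
Variables (R : realType) (V : normedModType R) (M : Type) (A : atlas V M).
Local Notation ix := (chart_ix A).

(** The properties of an atlas that the calculus uses, stated without a topology on [M]. They hold
    for the base and for the total space of [End(TM)], whose topology is only given through its
    charts, so the same lemmas serve both. *)
Record good_atlas : Prop := GoodAtlas {
  good_framed : framed V ;
  good_at : forall x, chart_dom (chart_at A x) x ;
  good_inv : forall (i : ix) x, chart_dom i x -> chart_inv i (chart i x) = x ;
  good_open : forall i k : ix, open (chart_img i (chart_dom k)) ;
  good_smooth : forall i k : ix,
    smooth_on (chart_img i (chart_dom k)) (chart k \o chart_inv i) }.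

Arguments good_smooth : clear implicits.
Arguments good_open : clear implicits.
Arguments good_inv : clear implicits.
Arguments good_at : clear implicits.

Definition transition (i k : ix) : V -> V := chart k \o chart_inv i.

Hypothesis gA : good_atlas.
Implicit Types (i k l : ix) (x : M) (U : set M).
Let inv := good_inv gA.

Lemma chart_img_chart i U x : U x -> chart_dom i x -> chart_img i U (chart i x).
Proof. by move=> Ux ix; exists x. Qed.

Lemma chart_imgP i U y : chart_img i U y ->
  [/\ U (chart_inv i y), chart_dom i (chart_inv i y)
    & chart i (chart_inv i y) = y].
Proof. by move=> [x [Ux ix] <-]; rewrite inv. Qed.

Lemma chart_imgI i U U' : chart_img i (U `&` U') = chart_img i U `&` chart_img i U'.
Proof.
apply/seteqP; split=> [_ [x [[Ux U'x] ix] <-]|y [/chart_imgP [Uy iy e] /chart_imgP [U'y _ _]]].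
  by split; exact: chart_img_chart.
by rewrite -e; exact: chart_img_chart.
Qed.

Lemma atlas_openI U U' : atlas_open A U -> atlas_open A U' -> atlas_open A (U `&` U').
Proof. by move=> oU oU' i; rewrite chart_imgI; apply: openI. Qed.

Lemma atlas_open_dom i : atlas_open A (chart_dom i).
Proof. by move=> k; exact: good_open. Qed.

Lemma transition_chart i k x : chart_dom i x -> transition i k (chart i x) = chart k x.
Proof. by move=> ix; rewrite /transition /= inv. Qed.

Lemma differentiable_transition i k x : chart_dom i x -> chart_dom k x ->
  differentiable (transition i k) (chart i x).
Proof.
move=> ix kx.
exact: (smooth_on_differentiable (good_smooth gA i k) (chart_img_chart kx ix)).
Qed.

Lemma tderiv_chart (W : normedModType R) (f : M -> W) i x v : chart_dom i x ->
  differentiable (f \o chart_inv i) (chart i x) ->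
  tderiv A f x v = 'D_(tcoord i x v) (f \o chart_inv i) (chart i x).
Proof.
move=> ix df; rewrite /tcoord /tderiv; set c := chart_at A x.
have cx : chart_dom c x := good_at gA x.
rewrite -[chart i x](transition_chart i cx) -derive_comp; last first.
- by rewrite transition_chart.
- exact: differentiable_transition.
apply: (derive_congr _ (good_open gA c i) (chart_img_chart ix cx)) => y.
by rewrite inE => /chart_imgP [iy cy e] /=; rewrite inv.
Qed.

Lemma derive_transition i k l x v : chart_dom i x -> chart_dom k x -> chart_dom l x ->
  'D_('D_v (transition i k) (chart i x)) (transition k l) (chart k x)
  = 'D_v (transition i l) (chart i x).
Proof.
move=> ix kx lx; rewrite -(transition_chart k ix) -derive_comp; last first.
- by rewrite transition_chart //; exact: differentiable_transition.
- exact: differentiable_transition.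
apply: (derive_congr _ (good_open gA i k) (chart_img_chart kx ix)) => y.
by rewrite inE => /chart_imgP [ky iy e]; rewrite /transition /= inv.
Qed.

Lemma derive_transition_id i x v : chart_dom i x ->
  'D_v (transition i i) (chart i x) = v.
Proof.
move=> ix; rewrite -[RHS](derive_id (chart i x)).
apply: (derive_congr _ (good_open gA i i) (chart_img_chart ix ix)) => y.
by rewrite inE => /chart_imgP [ky iy e].
Qed.

Lemma tcoordE i x v :
  tcoord i x v = 'D_v (transition (chart_at A x) i) (chart (chart_at A x) x).
Proof. by []. Qed.

Lemma of_tcoordE i x v :
  of_tcoord i v x = 'D_v (transition i (chart_at A x)) (chart i x).
Proof. by []. Qed.

Lemma tcoord_transition i k x v : chart_dom i x -> chart_dom k x ->
  tcoord k x v = 'D_(tcoord i x v) (transition i k) (chart i x).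
Proof. by move=> ix kx; rewrite !tcoordE derive_transition //; exact: good_at. Qed.

Lemma tcoord_of_tcoord i k x v : chart_dom i x -> chart_dom k x ->
  tcoord k x (of_tcoord i v x) = 'D_v (transition i k) (chart i x).
Proof. by move=> ix kx; rewrite tcoordE of_tcoordE derive_transition //; exact: good_at. Qed.

Lemma of_tcoordK i x v : chart_dom i x -> tcoord i x (of_tcoord i v x) = v.
Proof. by move=> ix; rewrite tcoord_of_tcoord // derive_transition_id. Qed.

Lemma tcoordK i x v : chart_dom i x -> of_tcoord i (tcoord i x v) x = v.
Proof.
move=> ix; have cx := good_at gA x.
by rewrite tcoordE of_tcoordE derive_transition // derive_transition_id.
Qed.

Lemma tcoord_at x v : tcoord (chart_at A x) x v = v.
Proof. by rewrite tcoordE derive_transition_id //; exact: good_at. Qed.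

Lemma tcoord_linear i x : chart_dom i x -> linear (tcoord i x).
Proof.
move=> ix a u v; rewrite !tcoordE derive_linear //.
by apply: differentiable_transition => //; exact: good_at.
Qed.

Lemma of_tcoord_linear i x : chart_dom i x -> linear (fun v => of_tcoord i v x).
Proof.
move=> ix a u v; rewrite !of_tcoordE derive_linear //.
by apply: differentiable_transition => //; exact: good_at.
Qed.

Lemma tcoordZ i x a v : chart_dom i x -> tcoord i x (a *: v) = a *: tcoord i x v.
Proof.
move=> ix; pose L : {linear V -> V} :=
  HB.pack (tcoord i x) (GRing.isLinear.Build _ _ _ _ _ (tcoord_linear ix)).
exact: (linearZ_LR L).
Qed.

Lemma tcoordD i x u v : chart_dom i x ->
  tcoord i x (u + v) = tcoord i x u + tcoord i x v.
Proof.
move=> ix; pose L : {linear V -> V} :=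
  HB.pack (tcoord i x) (GRing.isLinear.Build _ _ _ _ _ (tcoord_linear ix)).
exact: (linearD L).
Qed.

Lemma of_tcoordZ i x a v : chart_dom i x ->
  of_tcoord i (a *: v) x = a *: of_tcoord i v x.
Proof.
move=> ix; pose L : {linear V -> V} := HB.pack (fun v => of_tcoord i v x)
  (GRing.isLinear.Build _ _ _ _ _ (of_tcoord_linear ix)).
exact: (linearZ_LR L).
Qed.

Lemma of_tcoordD i x u v : chart_dom i x ->
  of_tcoord i (u + v) x = of_tcoord i u x + of_tcoord i v x.
Proof.
move=> ix; pose L : {linear V -> V} := HB.pack (fun v => of_tcoord i v x)
  (GRing.isLinear.Build _ _ _ _ _ (of_tcoord_linear ix)).
exact: (linearD L).
Qed.

Lemma field_coord_chart i X x : chart_dom i x ->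
  field_coord i X (chart i x) = tcoord i x (X x).
Proof. by move=> ix; rewrite /field_coord inv. Qed.

Lemma field_coord_transition i k X x : chart_dom i x -> chart_dom k x ->
  field_coord k X (chart k x)
  = 'D_(field_coord i X (chart i x)) (transition i k) (chart i x).
Proof. by move=> ix kx; rewrite !field_coord_chart // -tcoord_transition. Qed.

(** In another chart the components are the derivative of the transition map applied to those in
    chart [i], so a single chart containing [U] decides smoothness. *)
Lemma smooth_field_chart i U X : atlas_open A U -> U `<=` chart_dom i ->
  smooth_on (chart_img i U) (field_coord i X) -> smooth_field A U X.
Proof.
move=> oU Ui sX k.
apply: (@smooth_on_congr _ _ _ (oU k) _
  (fun y => 'D_(field_coord i X (transition k i y)) (transition i k) (transition k i y))).
  move=> _ /set_mem [x [Ux kx] <-]; have ix := Ui _ Ux.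
  by rewrite transition_chart // -field_coord_transition.
have kiy y : chart_img k U y -> chart_img i U (transition k i y).
  by move=> [x [Ux kx] <-]; rewrite transition_chart //; apply: chart_img_chart => //; exact: Ui.
have sub : chart_img k U `<=` chart_img k (chart_dom i).
  by move=> _ [x [Ux kx] <-]; apply: chart_img_chart => //; exact: Ui.
have sub' : chart_img i U `<=` chart_img i (chart_dom i).
  by move=> _ [x [Ux kx] <-]; apply: chart_img_chart => //; exact: Ui.
have st : smooth_on (chart_img k U) (transition k i) := smooth_onS sub (good_smooth gA k i).
have fV := good_framed gA.
apply: (@smooth_on_derive_comp _ _ _ (oU k) _ _ (chart_img i (chart_dom k)
   `&` chart_img i U)) => //.
- move=> _ [x [Ux kx] <-]; have ix := Ui _ Ux; rewrite transition_chart //.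
  by split; exact: chart_img_chart.
- exact: (smooth_on_comp (g := field_coord i X) (oU k) fV fV kiy st sX).
- exact: smooth_onS (@subIsetl _ _ _) (good_smooth gA i k).
Qed.

Lemma smooth_fun_chart (W : normedModType R) i U (f : M -> W) : framed W ->
  atlas_open A U -> U `<=` chart_dom i ->
  smooth_on (chart_img i U) (f \o chart_inv i) -> smooth_fun A U f.
Proof.
move=> fW oU Ui sf k.
apply: (@smooth_on_congr _ _ _ (oU k) _ ((f \o chart_inv i) \o transition k i)).
  move=> y; rewrite inE => /chart_imgP [Uy ky e]; have iy := Ui _ Uy.
  by rewrite /transition /= inv.
have sub : chart_img k U `<=` chart_img k (chart_dom i).
  by move=> _ [x [Ux kx] <-]; apply: chart_img_chart => //; exact: Ui.
apply: (smooth_on_comp (oU k) (good_framed gA) fW _ (smooth_onS sub (good_smooth gA k i)) sf).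
by move=> _ [x [Ux kx] <-]; rewrite -/(transition k i _) transition_chart //;
  apply: chart_img_chart => //; exact: Ui.
Qed.

Definition field_of i (F : V -> V) : M -> V := fun x => of_tcoord i (F (chart i x)) x.

Lemma field_ofE i F y : chart_img i setT y -> field_coord i (field_of i F) y = F y.
Proof.
by move=> /chart_imgP [_ iy e]; rewrite -{1}e field_coord_chart // of_tcoordK ?e.
Qed.

Lemma chart_imgT i U : chart_img i U `<=` chart_img i setT.
Proof. by move=> _ [x [Ux kx] <-]; exact: chart_img_chart. Qed.

Lemma smooth_field_of i U F : atlas_open A U -> U `<=` chart_dom i ->
  smooth_on (chart_img i U) F -> smooth_field A U (field_of i F).
Proof.
move=> oU Ui sF; apply: (smooth_field_chart oU Ui).
apply: (smooth_on_congr (oU i) _ sF).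
by move=> y; rewrite inE => yU; rewrite field_ofE //; exact: chart_imgT yU.
Qed.

End GoodAtlas.
Arguments good_smooth {R V M A} _ _ _.
Arguments good_open {R V M A} _ _ _.
Arguments good_inv {R V M A} _ _ _ _.
Arguments good_at {R V M A} _ _.

(** Inside the open image of the chart, the image of [U] is the preimage of [U] under the continuous
    [chart_inv]. *)
Lemma manifold_atlas_open (R : realType) n (M : topologicalType) (A : atlas 'cV[R]_n M) U :
  smooth_manifold A -> open U -> atlas_open A U.
Proof.
move=> [_ _ _ hc _] oU i; have [oD oI ci cvi] := hc i.
rewrite openE => y [x [Ux ix] <-]; rewrite /interior /=.
have Oy : (chart i @` chart_dom i) (chart i x) by exists x.
have [invx _] := ci x ix.
have nU : nbhs (chart_inv i (chart i x)) U.
  by rewrite invx; exact: open_nbhs_nbhs.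
have nV : nbhs (chart i x) (chart_inv i @^-1` U) := cvi _ Oy _ nU.
apply: filterS2 nV (open_nbhs_nbhs (conj oI Oy)) => y' /= + [z iz ezy].
rewrite -{y'}ezy => Uz.
by exists z => //; split=> //; have [<- _] := ci z iz.
Qed.

Lemma smooth_manifold_good (R : realType) n (M : topologicalType) (A : atlas 'cV[R]_n M) :
  smooth_manifold A -> good_atlas A.
Proof.
move=> hM; have [_ _ hat hc hs] := hM; split => //.
- exact: framed_mx.
- by move=> i x ix; have [_ _ /(_ x ix) []] := hc i.
- by move=> i k; apply: manifold_atlas_open => //; have [] := hc k.
Qed.

(** * Symmetry of second derivatives *)

Section Schwarz.
Variables (R : realType) (V : normedModType R).

Lemma is_derive_line (f : V -> R^o) (u w : V) (t : R) :
  differentiable f (t *: u + w) ->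
  is_derive t 1 (fun t : R => f (t *: u + w)) ('D_u f (t *: u + w)).
Proof.
move=> df.
have idl : is_diff t (fun s : R => s *: u + w) ( *:%R^~ u).
  apply: is_diff_eq (is_diffD (is_diff_scalel t u) (is_diff_cst w t)) _.
  by apply/funext => s; rewrite !fctE addr0.
have [dl ed] := idl.
have el : 'D_1 (fun s : R => s *: u + w) t = u.
  by rewrite (deriveE _ dl) ed scale1r.
apply: DeriveDef; first exact/diff_derivable/(differentiable_comp dl).
by rewrite (derive_comp (f := fun s : R => s *: u + w)) // el.
Qed.

Let second_diff (f : V -> R^o) x u v (h : R) :=
  f (h *: u + h *: v + x) - f (h *: u + x) - f (h *: v + x) + f x.

(** Mean value theorem for [phi t = f (t u + h v + x) - f (t u + x)], followed by the first-order
    expansion of ['D_u f] at [x]. As [second_diff] is symmetric in [u] and [v], comparing two such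
    estimates shows that second derivatives commute. *)
Lemma second_diff_estimate (f : V -> R^o) (O : set V) x u v : open O -> O x ->
  (forall y, O y -> differentiable f y) -> differentiable ('D_u f) x ->
  forall e : R, 0 < e -> \forall h \near 0^'+,
    `|second_diff f x u v h - h ^+ 2 * 'D_v ('D_u f) x| <= e * h ^+ 2.
Proof.
move=> oO Ox df ddf e e0.
(* [h * C] bounds the norm of [s u + t v] for [s], [t] in [[0, h]]; the summand [1] keeps [C]
   positive. *)
pose C : R := `|u| + `|v| + 1.
have C0 : 0 < C by rewrite ltr_wpDl // addr_ge0.
(* This leaves an error [e / 2 * h] for each of the two values of ['D_u f] subtracted in the
   derivative of [phi]. *)
have e'0 : 0 < e / (2 * C) by rewrite divr_gt0 // mulr_gt0.
have /eqaddoP /(_ _ e'0) := diff_locally ddf.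
move=> /nbhs_normP[r1 /= r1gt0 br1].
have /nbhs_normP[r2 /= r2gt0 br2] := open_nbhs_nbhs (conj oO Ox).
pose d := Num.min r1 r2 / C.
have d0 : 0 < d by rewrite divr_gt0 // lt_min r1gt0.
near=> h.
have h0 : 0 < h by near: h; exact: nbhs_right_gt.
have hd : h < d by near: h; exact: nbhs_right_lt.
have small s t : 0 <= s <= h -> 0 <= t <= h -> `|s *: u + t *: v| <= h * C.
  move=> /andP[s0 sh] /andP[t0 th]; rewrite (le_trans (ler_normD _ _)) //.
  rewrite !normrZ !ger0_norm // /C -addrA mulrDr lerD ?ler_wpM2r //.
  by rewrite (@le_trans _ _ (h * `|v|)) ?ler_wpM2r ?ler_wpM2l ?(ltW h0) // lerDl.
have hC : h * C < Num.min r1 r2 by rewrite -ltr_pdivlMr.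
have inO s t : 0 <= s <= h -> 0 <= t <= h -> O (s *: u + (t *: v + x)).
  move=> hs ht; apply: br2; rewrite /= addrA opprD addrCA subrr addr0 normrN.
  apply: le_lt_trans (small _ _ hs ht) _.
  by apply: lt_le_trans hC _; rewrite ge_min lexx orbT.
have est s t : 0 <= s <= h -> 0 <= t <= h ->
    `|'D_u f (s *: u + (t *: v + x)) - 'D_u f x - 'd ('D_u f) x (s *: u + t *: v)|
     <= e / 2 * h.
  move=> hs ht; have := br1 (s *: u + t *: v); rewrite /= sub0r normrN.
  have l1 := small _ _ hs ht.
  have l2 : h * C < r1 by apply: lt_le_trans hC _; rewrite ge_min lexx.
  move=> /(_ (le_lt_trans l1 l2)); rewrite !fctE /= opprD addrA addrA.
  move=> /le_trans; apply.
  rewrite -ler_pdivlMl // (le_trans l1) //.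
  rewrite (_ : (e / (2 * C))^-1 * (e / 2 * h) = h * C) //.
  by field; rewrite !gt_eqF.
pose phi (t : R) := f (t *: u + (h *: v + x)) - f (t *: u + x).
have h0h : 0 <= h <= h by rewrite (ltW h0) lexx.
have h00 : (0 : R) <= 0 <= h by rewrite lexx (ltW h0).
have Ox' t : 0 <= t <= h -> O (t *: u + x).
  by move=> ht; have := inO _ _ ht h00; rewrite scale0r add0r.
have dphi t : 0 <= t <= h ->
    is_derive t 1 phi ('D_u f (t *: u + (h *: v + x)) - 'D_u f (t *: u + x)).
  move=> ht; apply: is_deriveB; apply: is_derive_line; apply: df; first exact: inO.
  exact: Ox'.
have [||t tI e1] := @MVT R phi (fun t => 'D_u f (t *: u + (h *: v + x)) - 'D_u f (t *: u
  + x)) 0 h h0.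
- by move=> t /itvP tI; apply: dphi; rewrite !ltW ?tI.
- apply: derivable_within_continuous => t /itvP tI.
  by have [] : is_derive t 1 phi _ := dphi t _; rewrite ?tI.
have ht : 0 <= t <= h by move: tI => /itvP tI; rewrite !ltW ?tI.
have -> : second_diff f x u v h = phi h - phi 0.
  rewrite /second_diff /phi !scale0r !add0r addrA opprD opprK.
  by rewrite [- f (h *: v + x) + _]addrC !addrA [in RHS]addrAC.
rewrite e1 subr0.
have E1 := est _ _ ht h0h; have E2 := est _ _ ht h00.
rewrite scale0r add0r addr0 in E2.
rewrite (deriveE _ ddf).
have eL : 'd ('D_u f) x (t *: u + h *: v) = 'd ('D_u f) x (t *: u) + h *: 'd ('D_u f) x v.
  by rewrite linearD; congr (_ + _); rewrite linearZ.
rewrite eL in E1; move: E1 E2.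
set L1 := 'd _ x (t *: u); set L2 := 'd _ x v.
set a := 'D_u f _; set c := 'D_u f x; set b := 'D_u f _ => E1 E2.
have -> : (a - b) * h - h ^+ 2 * L2 = h * ((a - c - (L1 + h *: L2)) - (b - c - L1)).
  by rewrite -[h *: L2]/(h * L2); ring.
rewrite normrM gtr0_norm // expr2 mulrCA ler_pM2l //.
rewrite (le_trans (ler_normB _ _)) // (le_trans (lerD E1 E2)) //.
by rewrite -mulrDl -splitr.
Unshelve. all: by end_near. Qed.

Lemma second_diffC f x u v h : second_diff f x u v h = second_diff f x v u h.
Proof.
rewrite /second_diff [h *: u + h *: v]addrC; congr (_ + _).
by rewrite -!addrA; congr (_ + _); rewrite addrC.
Qed.

Lemma derive_derive_real (f : V -> R^o) (O : set V) x u v : open O -> O x ->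
  smooth_on O f -> 'D_v ('D_u f) x = 'D_u ('D_v f) x.
Proof.
move=> oO Ox sf.
have df y : O y -> differentiable f y by exact: smooth_on_differentiable sf.
have ddf w : differentiable ('D_w f) x.
  exact: smooth_on_differentiable (smooth_on_derive w sf) Ox.
apply/eqP; rewrite -subr_eq0 -normr_le0; apply/ler_addgt0Pr => e e0; rewrite add0r.
have e2 : 0 < e / 2 by rewrite divr_gt0.
have n1 := second_diff_estimate v oO Ox df (ddf u) e2.
have n2 := second_diff_estimate u oO Ox df (ddf v) e2.
have [h [h0 [E1 E2]]] := filter_ex (filterI (nbhs_right_gt 0) (filterI n1 n2)).
rewrite second_diffC in E2.
have hh : 0 < h ^+ 2 by rewrite exprn_gt0.
rewrite -(ler_pM2l hh) -{1}(gtr0_norm hh) -normrM mulrBr.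
have tri (s a b k : R) : `|s - a| <= k -> `|s - b| <= k -> `|a - b| <= 2 * k.
  move=> sa sb; rewrite (_ : a - b = (s - b) - (s - a)); last by ring.
  by rewrite (le_trans (ler_normB _ _)) // (le_trans (lerD sb sa)) // mulr2n mulrDl mul1r.
apply: le_trans (tri _ _ _ _ E1 E2) _.
by rewrite (_ : 2 * (e / 2 * h ^+ 2) = h ^+ 2 * e) //; field.
Qed.

Lemma derive_derive (W : normedModType R) (f : V -> W) (O : set V) x u v :
  framed W -> open O -> O x ->
  smooth_on O f -> 'D_v ('D_u f) x = 'D_u ('D_v f) x.
Proof.
move=> fW oO Ox sf; have [N [b [c [lc kc e]]]] := fW.
rewrite (e ('D_v _ x)) (e ('D_u ('D_v f) x)); apply: eq_bigr => i _; congr (_ *: _).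
pose L : {linear W -> R^o} :=
  HB.pack (c i : W -> R^o) (GRing.isLinear.Build _ _ _ _ (c i : W -> R^o) (lc i)).
have cD a b' : c i ('D_a ('D_b' f) x) = 'D_a ('D_b' (L \o f)) x.
  rewrite -[LHS]/(L _) -derive_linear_comp //; last first.
    exact: smooth_on_differentiable (smooth_on_derive b' sf) Ox.
  apply: (derive_congr _ oO Ox) => y; rewrite inE => Oy.
  by rewrite [RHS]derive_linear_comp //; exact: smooth_on_differentiable sf Oy.
by rewrite !cD; apply: (derive_derive_real _ _ oO Ox); exact: smooth_on_linear_comp.
Qed.
End Schwarz.

(** * Matrices of linear endomorphisms *)

Section EndoMx.
Variables (R : realType) (n : nat).
Local Notation V := 'cV[R]_n.

Lemma cV_sum_delta (w : V) : w = \sum_k w k ord0 *: delta_mx k ord0.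
Proof.
by rewrite {1}(matrix_sum_delta w); apply: eq_bigr => k _; rewrite big_ord1.
Qed.

Lemma endo_mxE (f : V -> V) w : linear f -> endo_mx f *m w = f w.
Proof.
move=> lf; pose L : {linear V -> V} := HB.pack f (GRing.isLinear.Build _ _ _ _ f lf).
rewrite -[f w]/(L w) [in RHS](cV_sum_delta w) linear_sum; apply/matrixP => i j;
  rewrite mxE summxE.
by apply: eq_bigr => k _; rewrite linearZ !mxE (ord1 j) mulrC.
Qed.

Lemma endo_mx_mul (a : 'M[R]_n) : endo_mx (fun w => a *m w) = a.
Proof.
apply/matrixP => i k; rewrite !mxE (bigD1 k) //= big1 ?addr0 => [|l lk].
  by rewrite mxE !eqxx mulr1.
by rewrite mxE (negPf lk) mulr0.
Qed.

Lemma eq_endo_mx (f g : V -> V) : f =1 g -> endo_mx f = endo_mx g.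
Proof. by move=> fg; congr endo_mx; apply/funext. Qed.

Lemma mulmx_cV_inj (a b : 'M[R]_n) : (forall w : V, a *m w = b *m w) -> a = b.
Proof. by move=> e; rewrite -[a]endo_mx_mul -[b]endo_mx_mul; exact: eq_endo_mx. Qed.

End EndoMx.

(** * Christoffel matrices and curvature *)

Section Christoffel.
Variables (R : realType) (n : nat) (M : topologicalType) (A : atlas 'cV[R]_n M).
Local Notation V := 'cV[R]_n.
Hypothesis hM : smooth_manifold A.
Let gA := smooth_manifold_good hM.
Let fV := good_framed gA.
Variable nabla : (M -> V) -> M -> V -> V.
Hypothesis hN : is_connection A nabla.
Implicit Types (i : chart_ix A) (x : M) (U : set M) (F : V -> V).

Lemma open_dom i : open (chart_dom i).
Proof. by have [_ _ _ /(_ i) []] := hM. Qed.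

(** In the preferred chart [c] the two fields are ['D_v] and ['D_w] of the transition map from [i],
    composed with the transition back. Their bracket is the difference of the mixed second
    derivatives of that map. *)
Lemma lie_bracket_of_tcoord i v w x : chart_dom i x ->
  lie_bracket A (of_tcoord i v) (of_tcoord i w) x = 0.
Proof.
move=> ix; rewrite /lie_bracket; set c := chart_at A x.
have cx : chart_dom c x := good_at gA x.
have D u u' : 'D_(of_tcoord i u x) (field_coord c (of_tcoord i u')) (chart c x)
    = 'D_u ('D_u' (transition i c)) (chart i x).
  have Oc := good_open gA c i.
  have cxi := chart_img_chart ix cx; have cix := chart_img_chart cx ix.
  have e : {in chart_img c (chart_dom i), field_coord c (of_tcoord i u') =1
     'D_u' (transition i c) \o transition c i}.
    move=> _ /set_mem [y [iy cy] <-] /=.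
    rewrite (field_coord_chart gA _ cy).
    rewrite (tcoord_of_tcoord gA _ iy cy).
    by rewrite (transition_chart gA _ cy).
  apply: etrans (derive_congr _ Oc cxi e) _.
  have tx : transition c i (chart c x) = chart i x := transition_chart gA i cx.
  apply: etrans (derive_comp (f := transition c i) (g := 'D_u' (transition i c)) _ _ _) _.
  - exact: (differentiable_transition gA cx ix).
  - rewrite tx; exact: (smooth_on_differentiable (smooth_on_derive u' (good_smooth gA i c)) cix).
  - rewrite of_tcoordE (derive_transition gA _ ix cx ix) (derive_transition_id gA _ ix).
    by rewrite tx.
apply/eqP; rewrite subr_eq0; apply/eqP.
apply: etrans (D v w) _; apply: etrans _ (esym (D w v)).
exact: (derive_derive _ _ fV (good_open gA i c) (chart_img_chart cx ix) (good_smooth gA i c)).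
Qed.

Section Fixed.
Variables (i : chart_ix A) (x : M) (U : set M).
Hypotheses (oU : open U) (Ui : U `<=` chart_dom i) (Ux : U x).
Let ix : chart_dom i x := Ui Ux.
Let aU : atlas_open A U := manifold_atlas_open hM oU.
Variable u : V.

Let N F := tcoord i x (nabla (field_of i F) x u).
Local Notation smooth F := (smooth_on (chart_img i U) F).

Lemma field_ofD F G y : chart_dom i y -> 
  field_of i (fun z => F z + G z) y = field_of i F y + field_of i G y.
Proof.
by move=> iy; exact: (of_tcoordD gA _ _ iy).
Qed.

(** The field of a sum is known to be the sum of the fields only over the chart domain, hence the
    appeal to locality on [U] before additivity. *)
Lemma covD F G : smooth F -> smooth G -> N (fun z => F z + G z) = N F + N G.
Proof.
move=> sF sG; rewrite /N.
have sFG : smooth (fun z => F z + G z) by apply: smooth_on_add => //; exact: @aU.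
have sf H : smooth H -> smooth_field A U (field_of i H) by exact: smooth_field_of.
have e : nabla (field_of i (fun z => F z + G z)) x u
    = nabla (fun y => field_of i F y + field_of i G y) x u.
  apply: (nabla_local hN oU (sf _ sFG)) => //; last first.
    by move=> y Uy; rewrite field_ofD //; exact: Ui.
  apply: (smooth_field_chart gA aU Ui).
  apply: (smooth_on_congr (@aU i) _ sFG) => _ /set_mem [y [Uy iy] <-].
  rewrite field_coord_chart // -field_ofD // -field_coord_chart //.
  by rewrite field_ofE //; exact: chart_img_chart.
apply: etrans (congr1 (tcoord i x) e) _.
apply: etrans (congr1 (tcoord i x) (nabla_add hN oU (sf _ sF) (sf _ sG) Ux u)) _.
exact: (tcoordD gA _ _ ix).
Qed.

Lemma covZ (f : V -> R^o) F : smooth_on (chart_img i U) f -> smooth F ->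
  N (fun z => f z *: F z) = f (chart i x) *: N F
    + 'D_(tcoord i x u) f (chart i x) *: F (chart i x).
Proof.
move=> sf sF; rewrite /N.
have sfF : smooth (fun z => f z *: F z) by apply: smooth_on_scale => //; exact: @aU.
have sfl H : smooth H -> smooth_field A U (field_of i H) by exact: smooth_field_of.
have eZ y : chart_dom i y -> field_of i (fun z => f z *: F z) y = f (chart i y) *: field_of i F y.
  by move=> iy; exact: (of_tcoordZ gA _ _ iy).
have sff : smooth_fun A U (f \o chart i).
  apply: (smooth_fun_chart gA (framed_real R) aU Ui).
  apply: (smooth_on_congr (@aU i) _ sf) => _ /set_mem [y [Uy iy] <-].
  by rewrite /= good_inv.
have e : nabla (field_of i (fun z => f z *: F z)) x u
    = nabla (fun y => (f \o chart i) y *: field_of i F y) x u.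
  apply: (nabla_local hN oU (sfl _ sfF)) => //; last first.
    by move=> y Uy; rewrite eZ //; exact: Ui.
  apply: (smooth_field_chart gA aU Ui).
  apply: (smooth_on_congr (@aU i) _ sfF) => _ /set_mem [y [Uy iy] <-].
  rewrite field_coord_chart // -eZ // -field_coord_chart //.
  by rewrite field_ofE //; exact: chart_img_chart.
apply: etrans (congr1 (tcoord i x) e) _.
apply: etrans (congr1 (tcoord i x) (nabla_leibniz hN oU sff (sfl _ sF) Ux u)) _.
apply: etrans (tcoord_linear gA ix _ _ _) _; congr (_ + _).
have Oxi : chart_img i U (chart i x) by exact: chart_img_chart.
have eq : {in chart_img i U, (f \o chart i) \o chart_inv i =1 f}.
  by move=> _ /set_mem [y [Uy iy] <-]; rewrite /= good_inv.
have df : differentiable ((f \o chart i) \o chart_inv i) (chart i x).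
  apply: (differentiable_congr (@aU i) Oxi _ (smooth_on_differentiable sf Oxi)).
  by move=> z zU; rewrite eq.
have e2 : tderiv A (f \o chart i) x u = 'D_(tcoord i x u) f (chart i x).
  apply: etrans (tderiv_chart gA u ix df) _.
  exact: (derive_congr (tcoord i x u) (@aU i) Oxi eq).
apply: etrans (tcoordZ gA _ _ ix) _.
by rewrite e2 /field_of (of_tcoordK gA _ ix).
Qed.

Let N_cst_linear : linear (fun w => N (fun=> w)).
Proof.
move=> a v w; apply: etrans (covD _ _) _.
- exact: smooth_on_cst.
- exact: smooth_on_cst.
congr (_ + _); apply: etrans (@covZ (fun=> a) (fun=> v) _ _) _.
- exact: smooth_on_cst.
- exact: smooth_on_cst.
have -> : 'D_(tcoord i x u) (fun=> a : R^o) (chart i x) = 0 by exact: derive_cst.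
by rewrite scale0r addr0.
Qed.

Lemma cov_sum (F : 'I_n -> V -> V) : (forall k, smooth (F k)) ->
  N (fun z => \sum_k F k z) = \sum_k N (F k).
Proof.
move=> sF; elim: (index_enum _) => [|k s ih].
  rewrite big_nil.
  have -> : (fun z => \sum_(k <- [::]) F k z) = fun=> 0 by apply/funext => z; rewrite big_nil.
  by have := N_cst_linear (-1) 0 0; rewrite scaleN1r addNr scaleN1r addNr.
rewrite big_cons -ih.
have -> : (fun z => \sum_(l <- k :: s) F l z) = fun z => F k z + \sum_(l <- s) F l z.
  by apply/funext => z; rewrite big_cons.
apply: covD; first exact: sF.
elim: s {ih} => [|l s ih].
  by apply: (smooth_on_congr (@aU i) _ (@smooth_on_cst _ _ (chart_img i U) _ (0 : V))) => z _;
    rewrite big_nil.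
by apply: (smooth_on_congr (@aU i) _ (smooth_on_add (@aU i) (sF l) ih)) => z _; rewrite big_cons.
Qed.

Definition christoffel_field (v w : V) : M -> V :=
  fun y => nabla (of_tcoord i w) y (of_tcoord i v y).

(** The connection form of the chart: on components, [nabla] in the direction [v] becomes ['D_v]
    plus multiplication by this matrix. *)
Definition christoffel (y v : V) : 'M[R]_n :=
  endo_mx (fun w => field_coord i (christoffel_field v w) y).

Lemma christoffelE w : christoffel (chart i x) (tcoord i x u) *m w = N (fun=> w).
Proof.
have e v : field_coord i (christoffel_field (tcoord i x u) v) (chart i x) = N (fun=> v).
  by rewrite (field_coord_chart gA _ ix) /christoffel_field (tcoordK gA _ ix).
rewrite /christoffel (eq_endo_mx e); exact: endo_mxE.
Qed.

(** Expanding [F] in constant fields, additivity and the Leibniz rule reduce to covariant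
    derivatives of constant fields, which [christoffel] records. *)
Lemma cov_field_of F : smooth F -> N F = 'D_(tcoord i x u) F (chart i x)
  + christoffel (chart i x) (tcoord i x u) *m F (chart i x).
Proof.
move=> sF; have sk k := smooth_on_entry (@aU i) k ord0 sF.
have Oxi : chart_img i U (chart i x) by exact: chart_img_chart.
have eF : F = fun z => \sum_k F z k ord0 *: delta_mx k ord0.
  by apply/funext => z; exact: cV_sum_delta.
have sd k : smooth (fun z => F z k ord0 *: delta_mx k ord0 : V).
  by apply: (smooth_on_scale (@aU i) fV (sk k)); exact: smooth_on_cst.
apply: etrans (congr1 (fun G => N G) eF) _; rewrite cov_sum //.
have e k : N (fun z => F z k ord0 *: delta_mx k ord0)
    = F (chart i x) k ord0 *: N (fun=> delta_mx k ord0)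
      + ('D_(tcoord i x u) F (chart i x)) k ord0 *: delta_mx k ord0.
  rewrite covZ //; last exact: smooth_on_cst.
  congr (_ + _ *: _).
  have lc : linear (fun w : V => w k ord0 : R^o) by move=> a v w; rewrite !mxE.
  pose L : {linear V -> R^o} := HB.pack (fun w : V => w k ord0 : R^o)
    (GRing.isLinear.Build _ _ _ _ _ lc).
  exact: (@derive_linear_comp _ _ _ _ fV L F (chart i x) _ (smooth_on_differentiable sF Oxi)).
rewrite (eq_bigr _ (fun k _ => e k)) big_split /= addrC -cV_sum_delta; congr (_ + _).
rewrite [in RHS](cV_sum_delta (F (chart i x))) mulmx_sumr.
by apply: eq_bigr => k _; rewrite -scalemxAr christoffelE.
Qed.

Lemma tcoord_nabla Z : smooth_field A U Z -> tcoord i x (nabla Z x u)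
  = 'D_(tcoord i x u) (field_coord i Z) (chart i x)
    + christoffel (chart i x) (tcoord i x u) *m field_coord i Z (chart i x).
Proof.
move=> sZ; have sZi : smooth (field_coord i Z) := sZ i.
apply: etrans (cov_field_of sZi); congr (tcoord i x _).
apply: (nabla_local hN oU sZ _ Ux); first exact: smooth_field_of.
move=> y Uy; have iy := Ui Uy.
by rewrite /field_of (field_coord_chart gA _ iy) (tcoordK gA _ iy).
Qed.

End Fixed.

End Christoffel.

(** * Matrix identities for the curvature *)

Section CurvatureAlgebra.
Variables (R : comNzRingType) (n : nat).
Implicit Types (X Y : 'M[R]_n) (u v w : 'cV[R]_n).

(** Here [Y1], [Y2] stand for [Gam u], [Gam v], and [X1], [X2] for the derivatives of [Gam v] along
    [u] and of [Gam u] along [v]. *)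
Lemma curvature_expand X1 X2 Y1 Y2 w :
  (X1 *m w + Y1 *m (Y2 *m w)) - (X2 *m w + Y2 *m (Y1 *m w))
  = (X1 - X2 + (Y1 *m Y2 - Y2 *m Y1)) *m w.
Proof. by rewrite !mulmxDl !mulNmx -!mulmxA opprD addrACA. Qed.

Lemma curvature_linear_expand (a : R) X1 X2 X2' X X' Y1 Y2 Y2' Y :
  X1 = a *: X2 + X2' -> X = a *: X' + Y1 -> Y = a *: Y2 + Y2' ->
  forall Z, X1 - X + (Y *m Z - Z *m Y)
  = a *: (X2 - X' + (Y2 *m Z - Z *m Y2)) + (X2' - Y1 + (Y2' *m Z - Z *m Y2')).
Proof.
move=> -> -> -> Z; rewrite mulmxDl mulmxDr -scalemxAl -scalemxAr.
move: (_ *m _) (_ *m _) (_ *m _) (_ *m _) => Z1 Z2 Z3 Z4.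
by apply/matrixP => k l; rewrite !mxE; ring.
Qed.

(** [Y1], [Y2], [Y3] stand for [Gam u], [Gam v], [Gam w] and the [X] for their derivatives along the
    three vectors. The last three hypotheses are the symmetry of [Gam], the first three its
    derivatives. *)
Lemma bianchi_expand X1 X2 X3 X4 X5 X6 Y1 Y2 Y3 u v w :
  X4 *m u = X3 *m w -> X5 *m v = X6 *m u -> X1 *m w = X2 *m v ->
  Y1 *m w = Y3 *m u -> Y2 *m u = Y1 *m v -> Y3 *m v = Y2 *m w ->
  (X1 - X3 + (Y1 *m Y2 - Y2 *m Y1)) *m w + (X4 - X6 + (Y2 *m Y3 - Y3 *m Y2)) *m u
  + (X5 - X2 + (Y3 *m Y1 - Y1 *m Y3)) *m v = 0.
Proof.
move=> e1 e2 e3 e4 e5 e6.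
rewrite !mulmxDl !mulNmx -!mulmxA e1 e2 e3 e4 e5 e6.
move: (X3 *m _) (X6 *m _) (X2 *m _) (Y1 *m _) (Y2 *m _) (Y3 *m _) => Z1 Z2 Z3 Z4 Z5 Z6.
by apply/matrixP => k l; rewrite !mxE; ring.
Qed.
End CurvatureAlgebra.

Section ChristoffelTheory.
Variables (R : realType) (n : nat) (M : topologicalType) (A : atlas 'cV[R]_n M).
Local Notation V := 'cV[R]_n.
Hypothesis hM : smooth_manifold A.
Let gA := smooth_manifold_good hM.
Variable nabla : (M -> V) -> M -> V -> V.
Hypothesis hN : is_connection A nabla.
Variable i : chart_ix A.
Local Notation Gam := (christoffel nabla i).
Implicit Types (x : M) (u v w y : V).

Let oI := @open_dom _ _ _ _ hM i.
Let aI : atlas_open A (chart_dom i) := manifold_atlas_open hM oI.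

Lemma smooth_of_tcoord w : smooth_field A (chart_dom i) (of_tcoord i w).
Proof.
apply: (smooth_field_of gA (F := fun=> w) aI) => //; exact: smooth_on_cst.
Qed.

Lemma christoffel_mul x v w : chart_dom i x ->
  Gam (chart i x) v *m w = tcoord i x (nabla (of_tcoord i w) x (of_tcoord i v x)).
Proof.
move=> ix; rewrite -{1}(of_tcoordK gA v ix).
exact: (christoffelE hM hN oI (fun _ h => h) ix).
Qed.

(* Otherwise unification unfolds the Christoffel matrices down to limits. *)
#[local] Opaque christoffel.

Lemma christoffel_linear x : chart_dom i x -> linear (Gam (chart i x)).
Proof.
move=> ix a u v; apply: mulmx_cV_inj => w.
rewrite mulmxDl -scalemxAl.
apply: etrans (christoffel_mul _ w ix) _.
apply: etrans _ (esym (congr2 (fun y z => a *: y + z)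
  (christoffel_mul u w ix) (christoffel_mul v w ix))).
have e := of_tcoord_linear gA ix a u v.
apply: etrans (congr1 (fun z => tcoord i x (nabla (of_tcoord i w) x z)) e) _.
apply: etrans (congr1 (tcoord i x) (nabla_linear hN oI (smooth_of_tcoord w) ix a _ _)) _.
exact: (tcoord_linear gA ix).
Qed.

Lemma christoffel_sym x v w : torsion_free A nabla -> chart_dom i x ->
  Gam (chart i x) v *m w = Gam (chart i x) w *m v.
Proof.
move=> htf ix.
have e : nabla (of_tcoord i w) x (of_tcoord i v x) = nabla (of_tcoord i v) x (of_tcoord i w x).
  apply/subr0_eq; have := htf _ _ _ x oI (smooth_of_tcoord v) (smooth_of_tcoord w) ix.
  by rewrite (lie_bracket_of_tcoord hM _ _ ix) subr0.
exact: (etrans (christoffel_mul v w ix)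
  (etrans (congr1 (tcoord i x) e) (esym (christoffel_mul w v ix)))).
Qed.

Lemma smooth_christoffel_field v w :
  smooth_field A (chart_dom i) (christoffel_field nabla i v w).
Proof. exact: (nabla_smooth hN oI (smooth_of_tcoord v) (smooth_of_tcoord w)). Qed.

#[local] Transparent christoffel.
Lemma smooth_christoffel v : smooth_on (chart_img i (chart_dom i)) (Gam ^~ v).
Proof.
apply: smooth_on_mx => [|k l]; first exact: @aI.
apply: (@smooth_on_congr _ _ _ (@aI i) _
  (fun y => field_coord i (christoffel_field nabla i v (delta_mx l ord0)) y k ord0)).
  by move=> y _; rewrite [RHS]mxE.
apply: (smooth_on_entry (@aI i)); exact: smooth_christoffel_field.
Qed.

#[local] Opaque christoffel.

Lemma field_coord_christoffel_field v w y : chart_img i (chart_dom i) y ->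
  field_coord i (christoffel_field nabla i v w) y = Gam y v *m w.
Proof.
by move=> [x [_ ix] <-]; rewrite (field_coord_chart gA _ ix) christoffel_mul.
Qed.

Definition curvature_mx (y u v : V) : 'M[R]_n :=
  'D_u (Gam ^~ v) y - 'D_v (Gam ^~ u) y + (Gam y u *m Gam y v - Gam y v *m Gam y u).

Lemma derive_christoffel_mul x u v w : chart_dom i x ->
  'D_u (fun y => Gam y v *m w) (chart i x) = 'D_u (Gam ^~ v) (chart i x) *m w.
Proof.
move=> ix; have Ox : chart_img i (chart_dom i) (chart i x) by exact: chart_img_chart.
have lw : linear (mulmxr w : 'M[R]_n -> V).
  by move=> a b c; rewrite /= mulmxDl scalemxAl.
pose L : {linear 'M[R]_n -> V} := HB.pack (mulmxr w : 'M[R]_n -> V)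
  (GRing.isLinear.Build _ _ _ _ _ lw).
exact: (@derive_linear_comp _ _ _ _ (framed_mx R n n) L (Gam ^~ v) (chart i x) u
  (smooth_on_differentiable (@smooth_christoffel v) Ox)).
Qed.

Lemma nabla_christoffel_field x u v w : chart_dom i x ->
  tcoord i x (nabla (christoffel_field nabla i v w) x (of_tcoord i u x))
  = 'D_u (Gam ^~ v) (chart i x) *m w + Gam (chart i x) u *m (Gam (chart i x) v *m w).
Proof.
move=> ix; have Ox : chart_img i (chart_dom i) (chart i x) by exact: chart_img_chart.
apply: etrans (tcoord_nabla hM hN oI (fun _ h => h) ix _ (smooth_christoffel_field v w)) _.
rewrite (of_tcoordK gA _ ix) (field_coord_christoffel_field _ _ Ox); congr (_ + _).
apply: etrans _ (derive_christoffel_mul u v w ix).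
apply: (derive_congr _ (@aI i) Ox) => y; rewrite inE; exact: field_coord_christoffel_field.
Qed.

(** Coordinate fields commute, so the bracket term drops and two second covariant derivatives
    remain. *)
Lemma curvature_field_of_tcoord x u v w : chart_dom i x ->
  tcoord i x (curvature_field A nabla (of_tcoord i u) (of_tcoord i v) (of_tcoord i w) x)
  = curvature_mx (chart i x) u v *m w.
Proof.
move=> ix; rewrite /curvature_field (lie_bracket_of_tcoord hM _ _ ix).
have -> : nabla (of_tcoord i w) x 0 = 0.
  have := nabla_linear hN oI (smooth_of_tcoord w) ix (-1) 0 0.
  by rewrite scaleN1r addNr scaleN1r addNr.
rewrite subr0.
have tB a b : tcoord i x (a - b) = tcoord i x a - tcoord i x b.
  by rewrite (tcoordD gA _ _ ix) -scaleN1r (tcoordZ gA _ _ ix) scaleN1r.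
apply: etrans (etrans (tB _ _) (congr2 (fun p q => p - q)
  (nabla_christoffel_field u v w ix) (nabla_christoffel_field v u w ix))) _.
exact: curvature_expand.
Qed.

Lemma curvature_mxC y u v : curvature_mx y v u = - curvature_mx y u v.
Proof. by rewrite /curvature_mx opprD !opprB. Qed.

Lemma derive_christoffel_linear x u a v v' : chart_dom i x ->
  'D_u (Gam ^~ (a *: v + v')) (chart i x)
  = a *: 'D_u (Gam ^~ v) (chart i x) + 'D_u (Gam ^~ v') (chart i x).
Proof.
move=> ix; have Ox : chart_img i (chart_dom i) (chart i x) by exact: chart_img_chart.
have dG z : differentiable (Gam ^~ z) (chart i x).
  exact: smooth_on_differentiable (@smooth_christoffel z) Ox.
have e : {in chart_img i (chart_dom i), Gam ^~ (a *: v + v') =1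
    (a \*: Gam ^~ v) \+ Gam ^~ v'}.
  by move=> _ /set_mem [y [_ iy] <-] /=; rewrite christoffel_linear.
apply: etrans (derive_congr _ (@aI i) Ox e) _.
apply: etrans (deriveD _ _) _.
- exact/diff_derivable/differentiableZ.
- exact/diff_derivable.
by congr (_ + _); apply: deriveZ; exact/diff_derivable.
Qed.

Lemma curvature_mx_linear x v : chart_dom i x -> linear (curvature_mx (chart i x) ^~ v).
Proof.
move=> ix; have Ox : chart_img i (chart_dom i) (chart i x) by exact: chart_img_chart.
have dG z : differentiable (Gam ^~ z) (chart i x).
  exact: smooth_on_differentiable (@smooth_christoffel z) Ox.
move=> a u u'; rewrite /curvature_mx.
have e1 := derive_linear a u u' (dG v).
have e2 := derive_christoffel_linear v a u u' ix.
have e3 := christoffel_linear ix a u u'.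
exact: (curvature_linear_expand e1 e2 e3).
Qed.

Lemma curvature_mx_bianchi x u v w : torsion_free A nabla -> chart_dom i x ->
  curvature_mx (chart i x) u v *m w + curvature_mx (chart i x) v w *m u
  + curvature_mx (chart i x) w u *m v = 0.
Proof.
move=> htf ix; have Ox : chart_img i (chart_dom i) (chart i x) by exact: chart_img_chart.
(* The symmetry of [Gam] holds on the whole chart image, so it may be differentiated. *)
have DS a b c : 'D_a (Gam ^~ b) (chart i x) *m c = 'D_a (Gam ^~ c) (chart i x) *m b.
  have e : {in chart_img i (chart_dom i), (fun y => Gam y b *m c) =1 (fun y => Gam y c *m b)}.
    by move=> _ /set_mem [y [_ iy] <-]; exact: christoffel_sym.
  exact: (etrans (esym (derive_christoffel_mul a b c ix))
    (etrans (derive_congr a (@aI i) Ox e) (derive_christoffel_mul a c b ix))).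
have GS a b := christoffel_sym a b htf ix.
exact: (bianchi_expand (DS v w u) (DS w u v) (DS u v w) (GS u w) (GS v u) (GS w v)).
Qed.

End ChristoffelTheory.

(** * The algebra of the obstruction *)

Section CurvatureTensor.
Variables (R : realType) (n : nat).
Local Notation V := 'cV[R]_n.
Implicit Types (rm : V -> V -> 'M[R]_n) (u v w : V) (g : 'M[R]_n).

Definition twistor_obstruction rm (j : 'M[R]_n) v w : 'M[R]_n :=
  let br (a : 'M[R]_n) := a *m j - j *m a in
  - br (rm (j *m v) (j *m w)) + j *m br (rm (j *m v) w) + j *m br (rm v (j *m w))
  + br (rm v w).

(** The pointwise input of the algebra: the symmetries of a torsion-free curvature tensor and the
    vanishing of the obstruction. Demanding it for all [j] makes the notion invariant under change
    of basis. *)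
Record twistor_flat rm : Prop := TwistorFlat {
  flat_linear : forall v, linear (rm^~ v) ;
  flat_anti : forall u v, rm v u = - rm u v ;
  flat_bianchi : forall u v w, rm u v *m w + rm v w *m u + rm w u *m v = 0 ;
  flat_obstruction : forall (j : 'M[R]_n) v w, j *m j = - 1%:M ->
    twistor_obstruction rm j v w = 0 }.

Section Flat.
Variable rm : V -> V -> 'M[R]_n.
Hypothesis Fr : twistor_flat rm.

Lemma rmZl a u v : rm (a *: u) v = a *: rm u v.
Proof.
pose L : {linear V -> 'M[R]_n} := HB.pack (rm^~ v) (GRing.isLinear.Build _ _ _ _ _ (flat_linear
  Fr v)).
exact: (linearZ_LR L).
Qed.

Lemma rmDl u u' v : rm (u + u') v = rm u v + rm u' v.
Proof.
pose L : {linear V -> 'M[R]_n} := HB.pack (rm^~ v) (GRing.isLinear.Build _ _ _ _ _ (flat_linear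
  Fr v)).
exact: (linearD L).
Qed.

Lemma rmZr a u v : rm u (a *: v) = a *: rm u v.
Proof. by rewrite (flat_anti Fr) rmZl -scalerN -(flat_anti Fr). Qed.

(* For [j = t A + t^-1 B], the obstruction at [B a], [B b], [B c], multiplied by
   [t A], is a polynomial in [t] whose leading coefficient has to vanish. *)
Lemma flat_isotropic (A B : 'M[R]_n) (a b c : V) :
  A *m A = 0 -> B *m B = 0 -> A *m B + B *m A = - 1%:M ->
  A *m (rm (A *m (B *m a)) (A *m (B *m b)) *m (A *m (B *m c))) = 0.
Proof.
move=> AA BB AB.
set x' := B *m a; set y' := B *m b; set z' := B *m c.
set x := A *m x'; set y := A *m y'; set z := A *m z'.
have B0 (w : V) : B *m (B *m w) = 0 by rewrite mulmxA BB mul0mx.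
have A0 (w : V) : A *m (A *m w) = 0 by rewrite mulmxA AA mul0mx.
(* [j] multiplies [x'], [y'], [z'] by [t] up to the passage to [x], [y], [z], while [A j = t^-1 A B]
   because [A^2 = 0]. After multiplication by [t A] only the powers [t^4], [t^2] and [1] are
   left. *)
have E t : t != 0 ->
    t ^+ 4 *: (A *m (rm x y *m z))
    = t ^+ 2 *: (A *m (rm x y' *m z' + rm x' y *m z' + rm x' y' *m z)
        + A *m (B *m (rm x y *m z' + rm x y' *m z + rm x' y *m z)))
      - A *m (B *m (rm x' y' *m z')).
  move=> t0; pose j := t *: A + t^-1 *: B.
  have jj : j *m j = - 1%:M.
    rewrite /j mulmxDl !mulmxDr -!scalemxAl -!scalemxAr AA BB !scaler0 add0r addr0.
    by rewrite !scalerA mulfV // mulVf // !scale1r.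
  have jB (w : V) : j *m (B *m w) = t *: (A *m (B *m w)).
    by rewrite /j mulmxDl -!scalemxAl B0 scaler0 addr0.
  have jjw (w : V) : j *m (j *m w) = - w by rewrite mulmxA jj mulNmx mul1mx.
  have Aj (w : V) : A *m (j *m w) = t^-1 *: (A *m (B *m w)).
    by rewrite /j mulmxDl mulmxDr -!scalemxAl -!scalemxAr A0 scaler0 add0r.
  clearbody j.
  have := congr1 (fun X => t *: (A *m (X *m z'))) (flat_obstruction Fr x' y' jj).
  rewrite /twistor_obstruction /= mul0mx mulmx0 scaler0 => /esym.
  rewrite !(mulmxDl, mulmxDr, mulNmx, mulmxN) -!mulmxA.
  rewrite !(jB a : j *m x' = t *: x) !(jB b : j *m y' = t *: y) !(jB c : j *m z' = t *: z) !jjw.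
  rewrite !(rmZl, rmZr) -!scalemxAl -!scalemxAr !mulmxN -!scalemxAr.
  rewrite !Aj !(mulmxN, scalerDr, scalerN, scalerA).
  move: (A *m (rm x y *m z)) => X1.
  move: (A *m (B *m (rm x y *m z'))) => X2.
  move: (A *m (B *m (rm x y' *m z))) => X3.
  move: (A *m (rm x y' *m z')) => X4.
  move: (A *m (B *m (rm x' y *m z))) => X5.
  move: (A *m (rm x' y *m z')) => X6.
  move: (A *m (rm x' y' *m z)) => X7.
  move: (A *m (B *m (rm x' y' *m z'))) => X8.
  move=> e; apply/matrixP => i k; have := congr1 (fun X : V => X i k) e.
  rewrite !mxE => {}e.
  have t2 : t * (t * t) / t = t ^+ 2 by field.
  rewrite !t2 divff // in e; lra.
(* The squares of [1], [2], [3] are distinct, so three values of [t] separate the three coefficients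
   and the one of [t^4] vanishes. *)
have n2 : (2 : R) != 0 by rewrite pnatr_eq0.
have n3 : (3 : R) != 0 by rewrite pnatr_eq0.
move: (E 1 (oner_neq0 _)) (E 2 n2) (E 3 n3); move: (A *m (rm x y *m z)) (_ + _)
  (A *m (B *m (rm x' y' *m z'))) => a4 a2 a0 E1 E2 E3.
apply/matrixP => i k.
have e1 := congr1 (fun X : V => X i k) E1.
have e2 := congr1 (fun X : V => X i k) E2.
have e3 := congr1 (fun X : V => X i k) E3.
move: e1 e2 e3 => {E1 E2 E3}; rewrite !mxE; lra.
Qed.

Local Notation e_ i := (delta_mx i ord0 : V).

Definition tensor_coef i j k l : R := (rm (e_ i) (e_ j) *m e_ k) l ord0.

(** [D] selects half of the coordinates and [s] pairs them with the other half. This yields [A], [B]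
    as in [flat_isotropic] with images spanned by the basis vectors inside and outside [D]. *)
Lemma flat_lagrangian (D : pred 'I_n) (s : 'I_n -> 'I_n) i j k l :
  involutive s -> (forall r, D (s r) = ~~ D r) ->
  D i -> D j -> D k -> ~~ D l -> tensor_coef i j k l = 0.
Proof.
move=> sK Ds Di Dj Dk Dl.
(* [A = Mx D] sends [e_(s r)] to [e_r] and [e_r] to zero for [r] in [D]; [B] is minus the same
   matrix for the complement. The sign gives [A B + B A = -1], so [A B] maps [- e_r] to [e_r] for
   [r] in [D]. *)
pose Mx (P : pred 'I_n) : 'M[R]_n := \matrix_(p, q) (P p && (q == s p))%:R.
have MxM P Q : Mx P *m Mx Q = \matrix_(p, q) (P p && Q (s p) && (p == q))%:R.
  apply/matrixP => p q; rewrite !mxE (bigD1 (s p)) //= big1 ?addr0 => [|r rp].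
    by rewrite !mxE eqxx andbT sK -natrM mulnb andbA (eq_sym p).
  by rewrite !mxE (negPf rp) andbF mul0r.
have AA : Mx D *m Mx D = 0.
  by rewrite MxM; apply/matrixP => p q; rewrite !mxE Ds andbN.
have BB : - Mx (predC D) *m - Mx (predC D) = 0.
  by rewrite mulNmx mulmxN opprK MxM; apply/matrixP => p q; rewrite !mxE /= Ds negbK andNb.
have AB : Mx D *m - Mx (predC D) + - Mx (predC D) *m Mx D = - 1%:M.
  rewrite mulmxN mulNmx -opprD !MxM; congr (- _); apply/matrixP => p q;
    rewrite !mxE /= Ds negbK !andbb.
  by case: (D p); rewrite /= ?addr0 ?add0r.
have ABe r : D r -> Mx D *m (- Mx (predC D) *m - e_ r) = e_ r.
  move=> Dr; rewrite mulNmx !mulmxN opprK mulmxA MxM; apply/matrixP => p q;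
    rewrite !mxE (bigD1 r) //= big1 ?addr0.
    rewrite !mxE !eqxx /= Ds negbK andbb (ord1 q) eqxx andbT mulr1.
    by case: eqP => [->|]; rewrite ?Dr ?andbF.
  by move=> t tr; rewrite !mxE (negPf tr) mulr0.
have := flat_isotropic (- e_ i) (- e_ j) (- e_ k) AA BB AB.
(* As [l] lies outside [D], row [s l] of [A] extracts the component [l]. *)
rewrite !ABe // => /matrixP /(_ (s l) ord0).
rewrite /tensor_coef; move: (rm _ _ *m e_ k) => w.
rewrite !mxE (bigD1 l) //= big1 ?addr0; last first.
  by move=> t tl; rewrite !mxE sK (negPf tl) andbF mul0r.
by rewrite !mxE Ds Dl sK eqxx mul1r.
Qed.

End Flat.

(** Conjugation by [g] permutes the solutions of [j^2 = -1], and the obstruction is built naturally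
    from [rm] and [j]. *)
Lemma flat_conj rm (g g' : 'M[R]_n) : g *m g' = 1%:M -> g' *m g = 1%:M ->
  twistor_flat rm -> twistor_flat (fun u v => g' *m rm (g *m u) (g *m v) *m g).
Proof.
move=> gg' g'g Fr; split.
- move=> v a u u'; rewrite mulmxDr -scalemxAr (flat_linear Fr).
  by rewrite mulmxDr mulmxDl -scalemxAr -scalemxAl.
- by move=> u v; rewrite (flat_anti Fr) mulmxN mulNmx.
- move=> u v w; rewrite -!mulmxA -!mulmxDr (flat_bianchi Fr) mulmx0 //.
move=> j v w jj; pose j' := g *m j *m g'.
have jj' : j' *m j' = - 1%:M.
  rewrite /j' !mulmxA -(mulmxA (g *m j) g' g) g'g mulmx1 -(mulmxA g j j) jj.
  by rewrite mulmxN mulmx1 mulNmx gg'.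
have jg u : g *m (j *m u) = j' *m (g *m u).
  by rewrite /j' -!mulmxA (mulmxA g' g) g'g mul1mx.
have := congr1 (fun X => g' *m X *m g) (flat_obstruction Fr (g *m v) (g *m w) jj').
rewrite mulmx0 mul0mx => <-; rewrite /twistor_obstruction /= !jg.
have jl (X : 'M[R]_n) : j *m (g' *m X *m g) = g' *m (j' *m X) *m g.
  by rewrite /j' !mulmxA g'g mul1mx.
have jr (X : 'M[R]_n) : g' *m X *m g *m j = g' *m (X *m j') *m g.
  by rewrite /j' !mulmxA -(mulmxA _ g' g) g'g mulmx1.
have br (X : 'M[R]_n) : g' *m X *m g *m j - j *m (g' *m X *m g)
    = g' *m (X *m j' - j' *m X) *m g.
  by rewrite jl jr mulmxBr mulmxBl.
have gen (a b c d : 'M[R]_n) : g' *m (- a + b + c + d) *m g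
    = - (g' *m a *m g) + g' *m b *m g + g' *m c *m g + g' *m d *m g.
  by rewrite !mulmxDr !mulmxDl mulmxN mulNmx.
by rewrite !br !jl gen.
Qed.

Local Notation e_ i := (delta_mx i ord0 : V).

Lemma flat_exists_lagrangian m (i j l : 'I_n) : n = (2 * m)%N -> (1 < m)%N ->
  i != j -> l != i -> l != j -> exists (D : pred 'I_n) (s : 'I_n -> 'I_n),
    [/\ involutive s, forall r, D (s r) = ~~ D r, D i, D j & ~~ D l].
Proof.
move=> hn hm ij li lj.
have lt (r : 'I_n) : ((if r < m then r + m else r - m) < n)%N.
  by case: r => r /= rn; case: ifP; lia.
pose s0 (r : 'I_n) : 'I_n := Ordinal (lt r).
pose D0 (r : 'I_n) := (r < m)%N.
have s0K : involutive s0.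
  move=> r; apply: val_inj => /=; case: r => r /= rn.
  by case: (ltnP r m) => h; case: ifP; lia.
have D0s r : D0 (s0 r) = ~~ D0 r.
  by rewrite /D0 /=; case: r => r /= rn; case: (ltnP r m) => h; lia.
have n0 : (0 < n)%N by lia.
have n1 : (1 < n)%N by lia.
have nm : (m < n)%N by lia.
pose a := Ordinal n0; pose b := Ordinal n1; pose c := Ordinal nm.
have ab : a != b by [].
have ca : c != a by rewrite -val_eqE /=; lia.
have cb : c != b by rewrite -val_eqE /=; lia.
(* [p] carries [i], [j], [l] to [0], [1], [m]: each transposition places one index and fixes those
   already placed. The standard half [r < m], with [r] paired to [r + m], is then pulled back along
   [p]; it contains [1] because [m > 1]. *)
pose p1 := tperm i a; pose p2 := tperm (p1 j) b; pose p3 := tperm (p2 (p1 l)) c.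
pose p := (p1 * p2 * p3)%g.
have p1i : p1 i = a by rewrite tpermL.
have p1j : p1 j != a by rewrite -p1i (inj_eq perm_inj) eq_sym.
have p2a : p2 a = a by rewrite /p2 tpermD // eq_sym.
have p2j : p2 (p1 j) = b by rewrite tpermL.
have p2la : p2 (p1 l) != a by rewrite -p2a -p1i !(inj_eq perm_inj).
have p2lb : p2 (p1 l) != b by rewrite -p2j !(inj_eq perm_inj).
have pi : p i = a by rewrite !permM p1i p2a /p3 tpermD.
have pj : p j = b by rewrite !permM p2j /p3 tpermD.
have pl : p l = c by rewrite !permM tpermL.
exists (fun r => D0 (p r)), (fun r => (p^-1)%g (s0 (p r))); split.
- by move=> r; rewrite permKV s0K permK.
- by move=> r; rewrite permKV D0s.
- by rewrite pi /D0 /=; lia.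
- by rewrite pj.
- by rewrite pl /D0 /= ltnn.
Qed.

Definition transvection (i p : 'I_n) (t : R) : 'M[R]_n := 1%:M + t *: delta_mx p i.

Lemma transvectionK i p t : i != p ->
  transvection i p t *m transvection i p (- t) = 1%:M.
Proof.
move=> ip; rewrite /transvection mulmxDl mul1mx mulmxDr mulmx1 -scalemxAl -scalemxAr.
by rewrite mul_delta_mx_0 // !scaler0 addr0 scaleNr addrNK.
Qed.

Lemma transvection_e i p t : transvection i p t *m e_ i = e_ i + t *: e_ p.
Proof. by rewrite /transvection mulmxDl mul1mx -scalemxAl mul_delta_mx. Qed.

Lemma transvection_ne i p t a : a != i -> transvection i p t *m e_ a = e_ a.
Proof.
move=> ai; rewrite /transvection mulmxDl mul1mx -scalemxAl mul_delta_mx_0 ?scaler0 ?addr0 //.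
by rewrite eq_sym.
Qed.

Lemma transvection_entry i p t w l :
  (transvection i p t *m w) l ord0 = w l ord0 + t * (l == p)%:R * w i ord0.
Proof.
rewrite /transvection mulmxDl mul1mx -scalemxAl mxE [X in _ + X]mxE; congr (_ + _).
rewrite -mulrA; congr (_ * _); rewrite mxE (bigD1 i) //= big1 ?addr0.
  by rewrite mxE eqxx andbT.
by move=> r ri; rewrite mxE (negPf ri) andbF mul0r.
Qed.

Section Table.
Variable m : nat.
Hypotheses (hn : n = (2 * m)%N) (hm : (1 < m)%N).

(** A half of the coordinates containing [i] and [j] but not [l] settles distinct [i], [j]; for
    [i = j] antisymmetry suffices. *)
Lemma flat_comp_iji rm i j l : twistor_flat rm -> l != i -> l != j ->
  tensor_coef rm i j i l = 0.
Proof.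
move=> Fr li lj; have [ij|ij] := eqVneq i j.
  have := flat_anti Fr (e_ i) (e_ i); rewrite -ij => e.
  have e0 : rm (e_ i) (e_ i) = 0.
    by apply/matrixP => p q; have := congr1 (fun X : 'M[R]_n => X p q) e; rewrite !mxE; lra.
  by rewrite /tensor_coef e0 mul0mx mxE.
have [D [s [sK Ds Hi Hj Hl]]] := flat_exists_lagrangian hn hm ij li lj.
exact: (flat_lagrangian Fr sK Ds Hi Hj Hi Hl).
Qed.

Lemma comp_anti rm i j k l : twistor_flat rm -> tensor_coef rm j i k l = - tensor_coef rm i j k l.
Proof. by move=> Fr; rewrite /tensor_coef (flat_anti Fr) mulNmx mxE. Qed.

Lemma comp_bianchi rm i j k l : twistor_flat rm ->
  tensor_coef rm i j k l + tensor_coef rm j k i l + tensor_coef rm k i j l = 0.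
Proof.
move=> Fr; have := congr1 (fun X : V => X l ord0) (flat_bianchi Fr (e_ i) (e_ j) (e_ k)).
rewrite /tensor_coef; move: (_ *m _) (_ *m _) (_ *m _) => X1 X2 X3.
by rewrite !mxE.
Qed.

Lemma addmxE (X Y : V) l : (X + Y) l ord0 = X l ord0 + Y l ord0.
Proof. by rewrite mxE. Qed.

Lemma scalemxE a (X : V) l : (a *: X) l ord0 = a * X l ord0.
Proof. by rewrite mxE. Qed.

(** The tensor in the basis where [e_i] is replaced by [e_i + t e_p]. The inverse shear on the left
    subtracts [t] times component [i] from component [p]. *)
Let rmt rm i p t u v := transvection i p (- t) *m
  rm (transvection i p t *m u) (transvection i p t *m v) *m transvection i p t.

Let rmt_flat rm i p t : twistor_flat rm -> i != p -> twistor_flat (rmt rm i p t).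
Proof.
move=> Fr ip; apply: flat_conj => //; first exact: transvectionK.
by rewrite -{2}[t]opprK; exact: transvectionK.
Qed.

Let comp_rmt rm i p t a b c l : tensor_coef (rmt rm i p t) a b c l =
  (rm (transvection i p t *m e_ a) (transvection i p t *m e_ b)
    *m (transvection i p t *m e_ c)) l ord0
  - t * (l == p)%:R * (rm (transvection i p t *m e_ a) (transvection i p t *m e_ b)
    *m (transvection i p t *m e_ c)) i ord0.
Proof. by rewrite /tensor_coef /rmt -!mulmxA transvection_entry !mulNr. Qed.

(** Polarisation: [flat_comp_iji] is applied after the shear taking [e_i] to [e_i + e_k], which
    leaves component [l] alone because [l] differs from [k]. *)
Lemma flat_comp_polar rm i j k l : twistor_flat rm -> i != k -> j != i ->
  l != i -> l != j -> l != k -> tensor_coef rm i j k l + tensor_coef rm k j i l = 0.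
Proof.
move=> Fr ik ji li lj lk.
have := flat_comp_iji (rmt_flat 1 Fr ik) li lj.
rewrite comp_rmt transvection_e (transvection_ne _ _ ji) (negPf lk) mulr0 mul0r subr0.
rewrite scale1r (rmDl Fr) !mulmxDl !mulmxDr !addmxE.
have := flat_comp_iji Fr li lj; have := flat_comp_iji Fr lk lj.
by rewrite /tensor_coef => -> ->; rewrite add0r addr0.
Qed.

(** For fixed [l] the component changes sign under exchange of the first two indices, and by
    polarisation under exchange of the first and third. It is thus totally skew, and the Bianchi sum
    is three times it. *)
Lemma flat_comp_ijk rm i j k l : twistor_flat rm ->
  l != i -> l != j -> l != k -> tensor_coef rm i j k l = 0.
Proof.
move=> Fr.
have polar a b c : l != a -> l != b -> l != c ->
  tensor_coef rm a b c l + tensor_coef rm c b a l = 0.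
  move=> la lb lc; have [ac|ac] := eqVneq a c.
    by rewrite ac flat_comp_iji // addr0.
  have [ba|ba] := eqVneq b a; last exact: flat_comp_polar.
  rewrite ba [tensor_coef rm c _ _ _]comp_anti // (flat_comp_iji Fr la lc) subr0.
  by have := comp_anti a a c l Fr; lra.
move=> li lj lk; have := comp_bianchi i j k l Fr.
have := polar _ _ _ li lj lk; have := polar _ _ _ lj lk li; have := polar _ _ _ lk li lj.
rewrite (comp_anti j k) // (comp_anti i j) // (comp_anti k i) //.
by lra.
Qed.

(** Component [l] after the shear taking [e_i] to [e_i + e_l] is the difference of the two sides, up
    to components that vanish already. The common value becomes the entry of [Q] at [j], [k], up to
    sign. *)
Lemma flat_comp_ijki rm i l j k : twistor_flat rm ->
  i != j -> i != k -> l != j -> l != k -> tensor_coef rm i j k i = tensor_coef rm l j k l.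
Proof.
move=> Fr ij ik lj lk; have [->//|il] := eqVneq i l.
have li : l != i by rewrite eq_sym.
have := flat_comp_ijk (rmt_flat 1 Fr il) li lj lk.
rewrite comp_rmt transvection_e !transvection_ne ?[j == _]eq_sym ?[k == _]eq_sym //.
rewrite eqxx !mul1r scale1r (rmDl Fr) !mulmxDl !addmxE.
have := flat_comp_ijk Fr li lj lk; have := flat_comp_ijk Fr il ij ik.
rewrite /tensor_coef => -> ->; lra.
Qed.

Lemma flat_comp_ijii rm i p j : twistor_flat rm -> i != p -> i != j -> p != j ->
  tensor_coef rm i j i i = tensor_coef rm i j p p + tensor_coef rm p j i p.
Proof.
move=> Fr ip ij pj; have pi : p != i by rewrite eq_sym.
have ji : j != i by rewrite eq_sym.
have F t : t * (tensor_coef rm i j p p + tensor_coef rm p j i p - tensor_coef rm i j i i)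
   + t ^+ 2 * (tensor_coef rm p j p p - tensor_coef rm i j p i - tensor_coef rm p j i i) = 0.
  have := flat_comp_iji (rmt_flat t Fr ip) pi pj.
  rewrite comp_rmt transvection_e (transvection_ne _ _ ji) eqxx mulr1.
  rewrite (rmDl Fr) (rmZl Fr) !mulmxDl !mulmxDr -!scalemxAl -!scalemxAr.
  rewrite !(addmxE, scalemxE).
  have := flat_comp_iji Fr pi pj; have := flat_comp_iji Fr ip ij.
  by rewrite /tensor_coef => -> -> <-; ring.
(* The values at [1] and [-1] isolate the linear coefficient in [t]. *)
by have := F 1; have := F (-1); lra.
Qed.

End Table.

Lemma linear_cV_eq0 (f : V -> V) : linear f -> (forall k, f (e_ k) = 0) -> forall w, f w = 0.
Proof.
move=> lf f0 w; pose L : {linear V -> V} := HB.pack f (GRing.isLinear.Build _ _ _ _ f lf).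
have -> : w = \sum_k w k ord0 *: e_ k.
  by rewrite {1}(matrix_sum_delta w); apply: eq_bigr => k _; rewrite big_ord1.
rewrite -[f _]/(L _) linear_sum big1 // => k _.
by rewrite linearZ_LR (f0 k : L _ = 0) scaler0.
Qed.

Definition form_mx (q : 'M[R]_n) u v : R := (u^T *m q *m v) ord0 ord0.

Lemma form_mxDl q a u u' v : form_mx q (a *: u + u') v = a * form_mx q u v + form_mx q u' v.
Proof. by rewrite /form_mx linearP /= !mulmxDl -!scalemxAl mxE [X in X + _]mxE. Qed.

Lemma form_mxDr q a u v v' : form_mx q u (a *: v + v') = a * form_mx q u v + form_mx q u v'.
Proof. by rewrite /form_mx mulmxDr -!scalemxAr mxE [X in X + _]mxE. Qed.

Lemma form_mx_e q i j : form_mx q (e_ i) (e_ j) = q i j.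
Proof. by rewrite /form_mx trmx_delta -rowE -colE !mxE. Qed.

(** The last three hypotheses prescribe basis components of the minus wedge; antisymmetry and
    Bianchi determine the others, and trilinearity extends the equality to all vectors. *)
Lemma wedge_of_comp rm (q : 'M[R]_n) :
  (forall v, linear (rm^~ v)) -> (forall u v, rm v u = - rm u v) ->
  (forall u v w, rm u v *m w + rm v w *m u + rm w u *m v = 0) ->
  (forall i j k l, l != i -> l != j -> l != k -> tensor_coef rm i j k l = 0) ->
  (forall i j k, i != j -> i != k -> tensor_coef rm i j k i = - q j k) ->
  (forall i j, i != j -> tensor_coef rm i j i i = q i j - 2 * q j i) ->
  forall u v w, rm u v *m w = - wedge_id (form_mx q) u v w.
Proof.
move=> rl ra rb h1 h2 h5.
have canti i j k l : tensor_coef rm j i k l = - tensor_coef rm i j k l.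
  by rewrite /tensor_coef ra mulNmx mxE.
have ck i j k l : tensor_coef rm i j k l
    = - q j k * (l == i)%:R + q i k * (l == j)%:R + (q i j - q j i) * (l == k)%:R.
  have [ij|ij] := eqVneq i j.
    by rewrite -ij; have := canti i i k l; case: (l == i); case: (l == k);
      rewrite ?mulr1 ?mulr0; lra.
  have [li|li] := eqVneq l i.
    rewrite li (negPf ij) mulr1 mulr0 addr0.
    have [ik|ik] := eqVneq i k; last by rewrite h2 // mulr0 addr0.
    by rewrite -ik h5 // mulr1; ring.
  have [lj|lj] := eqVneq l j.
    have ji : j != i by rewrite eq_sym.
    rewrite lj canti mulr1 mulr0 add0r.
    have [jk|jk] := eqVneq j k; last by rewrite h2 // mulr0 addr0 opprK.
    by rewrite -jk h5 // mulr1; ring.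
  (* The remaining components have [l = k] different from [i] and [j]; Bianchi expresses them
     through components whose first and last indices agree. *)
  rewrite !mulr0 !add0r; have [lk|lk] := eqVneq l k; last by rewrite h1 // mulr0.
  rewrite -lk mulr1; have := congr1 (fun X : V => X l ord0) (rb (e_ i) (e_ j) (e_ l)).
  have := h2 l i j li lj; have := canti l j i l; have := h2 l j i lj li.
  rewrite /tensor_coef; move: (rm _ _ *m _) (rm _ _ *m _) (rm _ _ *m _) (rm _ _ *m _) => X1 X2 X3
    X4.
  by rewrite !mxE; lra.
pose F u v w := rm u v *m w + wedge_id (form_mx q) u v w.
suff F0 u v w : F u v w = 0.
  by move=> u v w; have /eqP := F0 u v w; rewrite /F addr_eq0 => /eqP.
have lin3 u' v' : linear (fun w => F u' v' w).
  move=> a x y; rewrite /F /wedge_id mulmxDr -scalemxAr !form_mxDr.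
  by apply/matrixP => i k; rewrite !mxE; ring.
have lin2 u' w' : linear (fun v => F u' v w').
  move=> a x y; rewrite /F /wedge_id !(ra _ u') rl mulNmx mulmxDl -scalemxAl !form_mxDr
    !form_mxDl !mulNmx.
  by apply/matrixP => i k; rewrite !mxE; ring.
have lin1 v' w' : linear (fun u => F u v' w').
  move=> a x y; rewrite /F /wedge_id rl mulmxDl -scalemxAl !form_mxDr !form_mxDl.
  by apply/matrixP => i k; rewrite !mxE; ring.
apply: (linear_cV_eq0 (lin1 v w)) => i; apply: (linear_cV_eq0 (lin2 (e_ i) w)) => j.
apply: (linear_cV_eq0 (lin3 (e_ i) (e_ j))) => k.
apply/matrixP => l z; rewrite (ord1 z) /F addmxE; have := ck i j k l; rewrite /tensor_coef => ->.
by rewrite /wedge_id !form_mx_e !mxE !eqxx !andbT; ring.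
Qed.

Theorem twistor_flat_wedge m rm : n = (2 * m)%N -> (0 < m)%N -> twistor_flat rm ->
  exists q, forall u v w, rm u v *m w = - wedge_id (form_mx q) u v w.
Proof.
move=> hn m0 Fr.
have W := wedge_of_comp (flat_linear Fr) (flat_anti Fr) (flat_bianchi Fr).
have [m1|m1] := eqVneq m 1%N.
  have n2 : n = 2 by rewrite hn m1.
  have two (i j k : 'I_n) : i != j -> k != j -> k = i.
    move: i j k => [i hi] [j hj] [k hk]; rewrite -!val_eqE /= => ij kj; apply: val_inj => /=; lia.
  pose X i j := tensor_coef rm i j i i.
  (* With two indices, the sum has one term and gives the diagonal entry. Off the diagonal,
     [X i j = q i j - 2 * q j i] and its transpose form a linear system whose solution explains the
     factor [1 / 3]. *)
  pose q := \matrix_(j, k) if j == k then - \sum_(i | i != j) tensor_coef rm i j j i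
    else - (X j k + 2 * X k j) / 3.
  exists q; apply: W.
  - move=> i j k l li lj lk; have [ij|ij] := eqVneq i j.
      rewrite -ij; have := comp_anti i i k l Fr; lra.
    by case/eqP: li; exact: two lj.
  - move=> i j k ij ik; have -> : k = j by apply: (two j i k); rewrite eq_sym.
    rewrite mxE eqxx opprK (bigD1 i) //= big1 ?addr0 // => p /andP[pj pi].
    by case/eqP: pi; exact: two pj.
  - move=> i j ij; rewrite !mxE [j == i]eq_sym (negPf ij) -/(X i j); lra.
have hm : (1 < m)%N by rewrite ltn_neqAle eq_sym m1.
have ex j k : exists i : 'I_n, (i != j) && (i != k).
  have [r [rn rj rk]] : exists r, [/\ (r < n)%N, r != j & r != k].
    have [/andP[h1 h2]|h] := boolP ((0%N != j) && (0%N != k)).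
      by exists 0%N; split=> //; lia.
    have [/andP[h1 h2]|h'] := boolP ((1%N != j) && (1%N != k)).
      by exists 1%N; split=> //; lia.
    by exists 2%N; move: h h'; rewrite !negb_and !negbK; split; lia.
  by exists (Ordinal rn); rewrite -!val_eqE /= rj rk.
(* An auxiliary index reading off the entry of [Q]; [flat_comp_ijki] makes the entry independent of
   this choice. *)
pose i0 j k := xchoose (ex j k).
have i0j j k : i0 j k != j by have /andP[] := xchooseP (ex j k).
have i0k j k : i0 j k != k by have /andP[] := xchooseP (ex j k).
exists (\matrix_(j, k) - tensor_coef rm (i0 j k) j k (i0 j k)).
have h2 i j k : i != j -> i != k -> tensor_coef rm i j k i = - (\matrix_(j,
  k) - tensor_coef rm (i0 j k) j k (i0 j k)) j k.
  by move=> ij ik; rewrite mxE opprK; exact: (flat_comp_ijki hn hm Fr).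
apply: W => //.
  by move=> i j k l li lj lk; exact: (flat_comp_ijk hn hm Fr).
move=> i j ij; set p := i0 i j.
have pi : p != i := i0j i j; have pj : p != j := i0k i j.
have ip : i != p by rewrite eq_sym.
have ji : j != i by rewrite eq_sym.
rewrite (flat_comp_ijii hn hm Fr ip ij pj).
have := comp_bianchi i j p p Fr; rewrite (comp_anti p j i p Fr) !h2 //; lra.
Qed.

(** The multiples of the identity commute with [j], and by [j^2 = -1] the other terms cancel in
    pairs. The cancellation is between equal values of [Q], so it applies to [Q] given merely as a
    function. *)
Lemma wedge_obstruction rm (Q : V -> V -> R) (j : 'M[R]_n) v w : j *m j = - 1%:M ->
  (forall u v w, rm u v *m w = - wedge_id Q u v w) -> twistor_obstruction rm j v w = 0.
Proof.
move=> jj h.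
have inj (X : 'M[R]_n) : (forall z : V, X *m z = 0) -> X = 0.
  move=> X0; apply/matrixP => p k; have := congr1 (fun Y : V => Y p ord0) (X0 (e_ k)).
  by rewrite -colE !mxE.
have jjw (u : V) : j *m (j *m u) = - u by rewrite mulmxA jj mulNmx mul1mx.
apply: inj => z; rewrite /twistor_obstruction !(mulmxDl, mulmxDr, mulNmx, mulmxN) -!mulmxA.
rewrite !h /wedge_id !(mulmxDr, mulmxN) -!scalemxAr !jjw !mulmxN.
move: (j *m v) (j *m w) (j *m z) => jv jw jz.
by apply/matrixP => p k; rewrite !mxE; ring.
Qed.

End CurvatureTensor.

Ltac generalize_products := repeat match goal with |- context [?A *m ?B] =>
  let X := fresh "X" in set X := A *m B; clearbody X end.

(** * The Nijenhuis tensor in coordinates *)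

Section Curves.
Variables (R : realType) (n : nat).
Local Notation V := 'cV[R]_n.
Local Notation E := ('cV[R]_n * 'M[R]_n)%type.

Let fE : framed E := framed_prod (framed_mx R n 1) (framed_mx R n n).

(** By the chain rule ['D_xi F z] is the derivative of [F] along any curve through [z] with velocity
    [xi]; agreement along one such curve is enough. *)
Lemma derive_eq_curve (W : normedModType R) (F H : E -> W) (z : E) (c : R -> E) (xi : E) :
  differentiable F z -> differentiable H z -> differentiable c 0 ->
  c 0 = z -> 'D_1 c 0 = xi -> (\forall t \near 0, F (c t) = H (c t)) ->
  'D_xi F z = 'D_xi H z.
Proof.
move=> dF dH dc c0 e nFH; rewrite -{}e.
rewrite -c0 in dF dH *.
apply: etrans (esym (derive_comp (1 : R) dc dF)) _.
apply: etrans _ (derive_comp (1 : R) dc dH).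
exact: near_eq_derive.
Qed.

Lemma derive_scale_cst (W : normedModType R) (f : R -> R^o) (w : W) t :
  differentiable f t -> differentiable (fun t => f t *: w) t /\
  'D_1 (fun t => f t *: w) t = 'D_1 f t *: w.
Proof.
move=> df.
have lw : linear (fun a : R^o => a *: w) by move=> a u v; rewrite scalerDl scalerA.
pose L : {linear R^o -> W} := HB.pack (fun a : R^o => a *: w) (GRing.isLinear.Build _ _ _ _ _ lw).
split; first exact: (differentiable_linear_comp (@framed_real R) L df).
exact: (derive_linear_comp (@framed_real R) L (1 : R) df).
Qed.

Lemma derive_homography (a : R) : differentiable (fun t : R => t / (1 + a * t) : R^o) 0 /\
  'D_1 (fun t : R => t / (1 + a * t) : R^o) 0 = 1.
Proof.
have dd : differentiable (fun t : R => 1 + a * t : R^o) (0 : R).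
  by apply: differentiableD => //; apply: differentiableZ.
have n0 : 1 + a * 0 != 0 by rewrite mulr0 addr0 oner_neq0.
have dv : differentiable (fun t : R => (1 + a * t)^-1 : R^o) (0 : R).
  exact: (differentiableV dd n0).
have did : differentiable (fun t : R => t : R^o) (0 : R) by exact: (@ex_diff _ _ _ _ _ _ _
  (is_diff_id _)).
split; first exact: (differentiableM did dv).
have e : 'D_1 ((fun t : R => t) * (fun t : R => (1 + a * t)^-1)) 0 =
  (0 : R) *: 'D_1 (fun t : R => (1 + a * t)^-1 : R^o) (0 : R)
  + (1 + a * 0)^-1 *: 'D_1 (fun t : R => t : R^o) 0.
  apply: deriveM; apply: diff_derivable => //.
rewrite -[LHS]/('D_1 ((fun t : R => t) * (fun t : R => (1 + a * t)^-1)) 0) e.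
by rewrite scale0r add0r mulr0 addr0 invr1 scale1r derive_id.
Qed.

Definition acs : set E := [set z | z.2 *m z.2 = - 1%:M].

Section Along.
Variables (W : normedModType R) (F H : E -> W) (O : set E) (y : V) (b : 'M[R]_n).
Hypotheses (oO : open O) (Oz : O (y, b)) (bb : b *m b = - 1%:M).
Hypotheses (dF : differentiable F (y, b)) (dH : differentiable H (y, b)).
Hypothesis FH : forall z, O z -> acs z -> F z = H z.

Let curve (c : R -> E) xi : differentiable c 0 -> c 0 = (y, b) -> 'D_1 c 0 = xi ->
  (\forall t \near 0, acs (c t)) -> 'D_xi F (y, b) = 'D_xi H (y, b).
Proof.
move=> dc c0 e nc; apply: (derive_eq_curve dF dH dc c0 e).
have nO : \forall t \near (0 : R), O (c t).
  by apply: (differentiable_continuous dc); rewrite c0; exact: open_nbhs_nbhs.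
by apply: filterS2 nO nc => t; exact: FH.
Qed.

Let derive_base v : 'D_((v, 0) : E) F (y, b) = 'D_((v, 0) : E) H (y, b).
Proof.
have did : differentiable (fun t : R => t : R^o) (0 : R) by exact: (@ex_diff _ _ _ _ _ _ _
  (is_diff_id _)).
have [d1 e1] := derive_scale_cst v did.
have d2 : differentiable (fun t : R => y + t *: v) (0 : R).
  by apply: differentiableD.
have e2 : 'D_1 (fun t : R => y + t *: v) (0 : R) = v.
  apply: etrans (@deriveD _ _ _ (cst y) _ (0 : R) 1 _ _) _.
  - exact: derivable_cst.
  - exact: diff_derivable.
  by rewrite derive_cst add0r e1 derive_id scale1r.
apply: (curve (c := fun t : R => (y + t *: v, b))).
- exact: differentiable_pair.
- by rewrite scale0r addr0.
- apply: etrans (derive_pair (1 : R) d2 (differentiable_cst b (0 : R))) _.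
  by rewrite e2 derive_cst.
- by near=> t; rewrite /acs /=.
Unshelve. all: by end_near. Qed.

Let derive_fiber i j : let e := delta_mx i j : 'M[R]_n in
  'D_((0, e *m b - b *m e) : E) F (y, b) = 'D_((0, e *m b - b *m e) : E) H (y, b).
Proof.
(* An elementary matrix satisfies [e^2 = a e] with [a] equal to [0] or [1]. Hence [1 + t e] has the
   inverse [1 - s t e] with [s t = t / (1 + a t)], and the conjugated curve [c] has explicit scalar
   coefficients. *)
move=> e; pose a : R := (j == i)%:R.
have ee : e *m e = a *: e.
  rewrite /e /a; have [->|ji] := eqVneq j i; first by rewrite mul_delta_mx scale1r.
  by rewrite mul_delta_mx_0 // scale0r.
pose s (t : R) : R^o := t / (1 + a * t).
have [ds es] := derive_homography a.
have did : differentiable (fun t : R => t : R^o) (0 : R) by exact: (@ex_diff _ _ _ _ _ _ _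
  (is_diff_id _)).
have dts : differentiable (fun t : R => t * s t : R^o) (0 : R) := differentiableM did ds.
have ets : 'D_1 (fun t : R => t * s t : R^o) (0 : R) = 0.
  apply: etrans (@deriveM _ _ (fun t : R => t) s (0 : R) 1 _ _) _.
  - exact: diff_derivable.
  - exact: diff_derivable.
  by rewrite /s mul0r !scale0r addr0.
have [d1 e1] := derive_scale_cst (e *m b) did.
have [d2 e2] := derive_scale_cst (b *m e) ds.
have [d3 e3] := derive_scale_cst (e *m b *m e) dts.
pose c (t : R) : 'M[R]_n := b + (t *: (e *m b) - s t *: (b *m e) - (t * s t) *: (e *m b *m e)).
have dc0 : differentiable (fun t : R => t *: (e *m b) - s t *: (b *m e)) (0 : R).
  exact: differentiableB.
have dc1 : differentiable (fun t : R => t *: (e *m b) - s t *: (b *m e) - (t * s t) *: (e *m b *m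
  e)) (0 : R).
  exact: differentiableB.
have dc : differentiable c (0 : R) by apply: differentiableD.
have ec : 'D_1 c 0 = e *m b - b *m e.
  apply: etrans (@deriveD _ _ _ (cst b) _ (0 : R) 1 _ _) _;
    [exact: derivable_cst|exact: diff_derivable|].
  apply: etrans (congr1 (fun X => 'D_1 (cst b) (0 : R)
    + X) (@deriveB _ _ _ _ _ (0 : R) 1 (diff_derivable dc0) (diff_derivable d3))) _.
  apply: etrans (congr1 (fun X => 'D_1 (cst b) (0 : R)
    + (X - _)) (@deriveB _ _ _ _ _ (0 : R) 1 (diff_derivable d1) (diff_derivable d2))) _.
  by rewrite derive_cst add0r e1 e2 e3 ets es derive_id scale0r subr0 !scale1r.
have ceq t : c t = (1%:M + t *: e) *m b *m (1%:M - s t *: e).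
  rewrite mulmxBr mulmx1 mulmxDl mul1mx mulmxDl -!scalemxAl -!scalemxAr scalemxAl.
  by rewrite /c opprD !addrA -!scalemxAl scalerA; congr (_ - _); rewrite addrAC.
apply: (curve (c := fun t : R => (y, c t))).
- exact: differentiable_pair.
- by congr pair; rewrite /c /s !mul0r !scale0r !subr0 addr0.
- apply: etrans (derive_pair (1 : R) (differentiable_cst y (0 : R)) dc) _.
  by rewrite ec derive_cst.
have : \forall t \near (0 : R), 1 + a * t != 0.
  have kc : (1 + a * t) @[t --> (0 : R)] --> 1 + a * 0.
    by apply: cvgD; [exact: cvg_cst|apply: cvgMl_tmp; exact: cvg_id].
  have nz : nbhs (1 + a * 0) [set x : R | x != 0].
    rewrite mulr0 addr0; apply: open_nbhs_nbhs; split; [exact: open_neq|exact: oner_neq0].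
  exact: (kc _ nz).
apply: filterS => t t0; rewrite /acs /= ceq.
have inv : (1%:M - s t *: e) *m (1%:M + t *: e) = 1%:M.
  rewrite mulmxBl !mulmxDr !mul1mx !mulmx1 -!scalemxAl -!scalemxAr ee !scalerA.
  have key : t - s t - s t * t * a = 0 by rewrite /s; field.
  transitivity (1%:M + (t - s t - s t * t * a) *: e); last by rewrite key scale0r addr0.
  by apply/matrixP => p q; rewrite !mxE; ring.
have inv' : (1%:M + t *: e) *m (1%:M - s t *: e) = 1%:M by exact: mulmx1C.
by rewrite !mulmxA -(mulmxA (_ *m b)) inv mulmx1 -(mulmxA _ b b) bb mulmxN mulmx1 mulNmx inv'.
Qed.

(* [(1 + tE) b (1 + tE)^-1] is a curve in [acs], with velocity [E b - b E] at
   [t = 0]; every tangent vector of the fibre is of this form. *)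
Lemma derive_eq_acs (xi : E) : xi.2 *m b + b *m xi.2 = 0 ->
  'D_xi F (y, b) = 'D_xi H (y, b).
Proof.
(* As [xi.2] anticommutes with [b] and [b^2 = -1], both [xi.2 b b] and [- b xi.2 b] equal [- xi.2];
   the factor [- 1 / 2] makes the commutator of [c] with [b] equal to [xi.2]. *)
move=> xib; pose c : 'M[R]_n := - 2^-1 *: (xi.2 *m b).
have exi : xi.2 = c *m b - b *m c.
  have xib' : b *m xi.2 = - (xi.2 *m b) by apply/eqP; rewrite -addr_eq0 addrC xib.
  have h1 : xi.2 *m b *m b = - xi.2 by rewrite -mulmxA bb mulmxN mulmx1.
  have h2 : b *m (xi.2 *m b) = xi.2 by rewrite mulmxA xib' mulNmx h1 opprK.
  rewrite /c -scalemxAl -scalemxAr h1 h2.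
  by apply/matrixP => p q; rewrite !mxE; field.
pose P (e : 'M[R]_n) : W := 'D_((0, e *m b - b *m e) : E) F (y, b)
  - 'D_((0, e *m b - b *m e) : E) H (y, b).
have lP : linear P.
  move=> t e e'; rewrite /P.
  have -> : ((0, (t *: e + e') *m b - b *m (t *: e + e')) : E)
      = t *: ((0, e *m b - b *m e) : E) + (0, e' *m b - b *m e').
    rewrite [RHS]surjective_pairing /=; congr pair; first by rewrite scaler0 addr0.
    by rewrite mulmxDl mulmxDr -scalemxAl -scalemxAr scalerBr opprD addrACA.
  have gen (p q r s : W) : t *: p + q - (t *: r + s) = t *: (p - r) + (q - s).
    by rewrite scalerBr opprD addrACA.
  apply: etrans (congr2 (fun p q => p - q) (derive_linear t _ _ dF) (derive_linear t _ _ dH)) _.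
  exact: gen.
pose L : {linear 'M[R]_n -> W} := HB.pack P (GRing.isLinear.Build _ _ _ _ _ lP).
have P0 e : P e = 0.
  rewrite -[P e]/(L e) (matrix_sum_delta e) !linear_sum big1 // => i _.
  rewrite linear_sum big1 // => j _; rewrite linearZ_LR.
  have -> : L (delta_mx i j) = 0 by apply/eqP; rewrite subr_eq0; apply/eqP; exact: derive_fiber.
  by rewrite scaler0.
have -> : xi = 1 *: ((xi.1, 0) : E) + ((0, xi.2) : E).
  by rewrite scale1r [LHS]surjective_pairing; congr pair; rewrite /= ?addr0 ?add0r.
rewrite (derive_linear _ _ _ dF) (derive_linear _ _ _ dH) derive_base; congr (_ + _).
by apply/subr0_eq; rewrite exi; exact: P0.
Qed.

End Along.

Section Nijenhuis.
Variables (Gam : V -> V -> 'M[R]_n) (O : set E) (y : V) (b : 'M[R]_n).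
Hypotheses (oO : open O) (Oz : O (y, b)) (bb : b *m b = - 1%:M).
Hypothesis Gam_lin : forall z, O z -> linear (Gam z.1).
Hypothesis Gam_diff : forall v, differentiable (Gam ^~ v) y.
Hypothesis Gam_sym : forall u v, Gam y u *m v = Gam y v *m u.

Definition vert (z xi : E) : 'M[R]_n := xi.2 + (Gam z.1 xi.1 *m z.2 - z.2 *m Gam z.1 xi.1).

Definition tangent_acs (z xi : E) := xi.2 *m z.2 + z.2 *m xi.2 = 0.

Definition bracket (F H : E -> E) : E := 'D_(F (y, b)) H (y, b) - 'D_(H (y, b)) F (y, b).

Local Notation z0 := ((y, b) : E).

Lemma derive_fst (F : E -> E) xi : differentiable F z0 ->
  differentiable (fun z => (F z).1) z0 /\
  'D_xi (fun z => (F z).1) z0 = ('D_xi F z0).1.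
Proof.
move=> dF; split; first exact: (@differentiable_linear_comp _ _ _ _ fE (@fst V 'M[R]_n)).
exact: (@derive_linear_comp _ _ _ _ fE (@fst V 'M[R]_n)).
Qed.

Lemma derive_snd (F : E -> E) xi : differentiable F z0 ->
  differentiable (fun z => (F z).2) z0 /\
  'D_xi (fun z => (F z).2) z0 = ('D_xi F z0).2.
Proof.
move=> dF; split; first exact: (@differentiable_linear_comp _ _ _ _ fE (@snd V 'M[R]_n)).
exact: (@derive_linear_comp _ _ _ _ fE (@snd V 'M[R]_n)).
Qed.

Lemma differentiable_idE : differentiable (fun z : E => z) z0.
Proof. exact: (@ex_diff _ _ _ _ _ _ _ (is_diff_id _)). Qed.

Lemma derive_mulmx p q r (F : E -> 'M[R]_(p, q)) (H : E -> 'M[R]_(q, r)) xi :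
  differentiable F z0 -> differentiable H z0 ->
  differentiable (fun z => F z *m H z) z0 /\
  'D_xi (fun z => F z *m H z) z0 = 'D_xi F z0 *m H z0 + F z0 *m 'D_xi H z0.
Proof.
move=> dF dH; split.
  exact: (differentiable_bilinear_comp (framed_mx R p q) (framed_mx R q r) (@mulmx R p q r) dF
    dH).
exact: (derive_bilinear_comp (framed_mx R p q) (framed_mx R q r) (@mulmx R p q r) xi dF dH).
Qed.

Lemma derive_sum_fun (W : normedModType R) (f : 'I_n -> E -> W) xi :
  (forall k, differentiable (f k) z0) ->
  differentiable (fun z => \sum_k f k z) z0 /\
  'D_xi (fun z => \sum_k f k z) z0 = \sum_k 'D_xi (f k) z0.
Proof.
move=> df; have -> : (fun z => \sum_k f k z) = \sum_k f k.
  by apply/funext => z; rewrite fct_sumE.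
split; first exact: differentiable_sum.
by apply: derive_sum => k; exact: diff_derivable.
Qed.

Local Notation e_ k := (delta_mx k ord0 : V).

Lemma linear_expand (W : lmodType R) (f : V -> W) v : linear f ->
  f v = \sum_k v k ord0 *: f (e_ k).
Proof.
move=> lf; pose L : {linear V -> W} := HB.pack f (GRing.isLinear.Build _ _ _ _ f lf).
rewrite -[f v]/(L v) {1}(matrix_sum_delta v) linear_sum; apply: eq_bigr => k _.
by rewrite big_ord1 linearZ_LR.
Qed.

Lemma derive_Gam_cst v xi : differentiable (fun z : E => Gam z.1 v) z0 /\
  'D_xi (fun z : E => Gam z.1 v) z0 = 'D_xi.1 (Gam ^~ v) y.
Proof.
have [d1 e1] := derive_fst xi differentiable_idE.
have e2 : 'D_xi (fun z : E => z) z0 = xi := derive_id _ _.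
rewrite e2 in e1; split.
  exact: (differentiable_comp d1 (Gam_diff v)).
apply: etrans (derive_comp xi d1 (Gam_diff v)) _.
by rewrite e1.
Qed.

(** The vector argument moves with [z]; linearity of [Gam] in it gives a finite sum of products, to
    which the Leibniz rule applies. *)
Lemma derive_Gam_sum (F : E -> E) xi : differentiable F z0 ->
  differentiable (fun z => Gam z.1 (F z).1) z0 /\
  'D_xi (fun z => Gam z.1 (F z).1) z0
  = \sum_k (('D_xi F z0).1 k ord0 *: Gam y (e_ k) + (F z0).1 k ord0 *: 'D_xi.1 (Gam ^~ (e_ k)) y).
Proof.
move=> dF; have [d1 e1] := derive_fst xi dF.
pose f k (z : E) : R^o := (F z).1 k ord0.
have lc k : linear (fun w : V => w k ord0 : R^o) by move=> a u v; rewrite !mxE.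
pose L k : {linear V -> R^o} := HB.pack (fun w : V => w k ord0 : R^o)
  (GRing.isLinear.Build _ _ _ _ _ (lc k)).
have df k : differentiable (f k) z0.
  exact: (@differentiable_linear_comp _ _ _ _ (framed_mx R n 1) (L k) _ _ d1).
have ef k : 'D_xi (f k) z0 = ('D_xi F z0).1 k ord0.
  apply: etrans (@derive_linear_comp _ _ _ _ (framed_mx R n 1) (L k) _ _ xi d1) _.
  by rewrite e1.
have fR := @framed_real R; have fM := framed_mx R n n.
pose S := @regular_scale R 'M[R]_n.
have dT k := @differentiable_bilinear_comp _ _ _ _ _ fR fM S _ _ _ (df k) (derive_Gam_cst (e_ k)
  xi).1.
have eT k := @derive_bilinear_comp _ _ _ _ _ fR fM S _ _ _ xi (df k) (derive_Gam_cst (e_ k) xi).1.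
have [dS eS] := derive_sum_fun xi dT.
have eG : {in O, (fun z => \sum_k S (f k z) (Gam z.1 (e_ k))) =1 (fun z => Gam z.1 (F z).1)}.
  by move=> z /set_mem Oz'; rewrite [RHS](linear_expand _ (Gam_lin Oz')).
split; first exact: (differentiable_congr oO Oz eG dS).
apply: etrans (esym (derive_congr xi oO Oz eG)) _.
apply: etrans eS _; apply: eq_bigr => k _; apply: etrans (eT k) _.
by rewrite ef (derive_Gam_cst (e_ k) xi).2.
Qed.

Lemma derive_Gam (F : E -> E) xi : differentiable F z0 ->
  differentiable (fun z => Gam z.1 (F z).1) z0 /\
  'D_xi (fun z => Gam z.1 (F z).1) z0
  = 'D_xi.1 (Gam ^~ (F z0).1) y + Gam y ('D_xi F z0).1.
Proof.
move=> dF; have [d e] := derive_Gam_sum xi dF; split=> //.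
(* The sum formula for the constant map with value [(F z0).1] identifies the part where only the
   base point of [Gam] is differentiated. *)
have dc : differentiable (fun _ : E => ((F z0).1, 0) : E) z0 by exact: differentiable_cst.
have [_ ec] := derive_Gam_sum xi dc.
have e0 : 'D_xi (fun _ : E => ((F z0).1, 0) : E) z0 = 0 by exact: derive_cst.
have e1 : 'D_xi.1 (Gam ^~ (F z0).1) y = \sum_k (F z0).1 k ord0 *: 'D_xi.1 (Gam ^~ (e_ k)) y.
  apply: etrans (esym (derive_Gam_cst (F z0).1 xi).2) _; apply: etrans ec _.
  by apply: eq_bigr => k _; rewrite e0 mxE scale0r add0r.
apply: etrans e _; rewrite big_split /= addrC; congr (_ + _); first exact: esym.
exact: (esym (linear_expand _ (Gam_lin Oz))).
Qed.

Definition brk (x : 'M[R]_n) : 'M[R]_n := x *m b - b *m x.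

Lemma vert_expand (X D G G' Z c : 'M[R]_n) :
  X + ((D + G') *m c + G *m Z - (Z *m G + c *m (D + G')))
  = X + (G' *m c - c *m G') + (D *m c - c *m D) + (G *m Z - Z *m G).
Proof.
rewrite !mulmxDl !mulmxDr.
move: (_ *m _) (_ *m _) (_ *m _) (_ *m _) (_ *m _) (_ *m _) => Y1 Y2 Y3 Y4 Y5 Y6.
by apply/matrixP => i j; rewrite !mxE; ring.
Qed.

Lemma vert_bracket_expand (D1 D2 dfh dhf Gf Gh F2 H2 : 'M[R]_n) :
  (D1 - (dfh *m b - b *m dfh) - (Gh *m F2 - F2 *m Gh))
  - (D2 - (dhf *m b - b *m dhf) - (Gf *m H2 - H2 *m Gf))
  = D1 - D2 + (Gf *m (H2 + (Gh *m b - b *m Gh)) - (H2 + (Gh *m b - b *m Gh)) *m Gf)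
    - (Gh *m (F2 + (Gf *m b - b *m Gf)) - (F2 + (Gf *m b - b *m Gf)) *m Gh)
    - ((dfh - dhf + (Gf *m Gh - Gh *m Gf)) *m b - b *m (dfh - dhf + (Gf *m Gh - Gh *m Gf))).
Proof.
rewrite !(mulmxDl, mulmxDr, mulNmx, mulmxN) -!mulmxA.
generalize_products.
by apply/matrixP => i j; rewrite !mxE; ring.
Qed.

(** [x], [w] are the vertical parts of [X], [Y]; [Gv], [Pv] are [Gam] at [v] and [b v], likewise for
    [w]; [d1] to [d4] are the derivatives of [vert Y] along [X], [vert X] along [Y], [vert Y] along
    [JX], [vert X] along [JY]. The [T] are the vertical parts of the four brackets; all but the
    curvatures cancels. *)
Lemma nijenhuis_vertical (x w Pv Pw Gv Gw d1 d2 d3 d4 R11 R10 R01 R00 : 'M[R]_n) :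
  let T11 := ((b *m x - brk Pv) *m w + b *m d3) - ((b *m w - brk Pw) *m x + b *m d4)
    + (Pv *m (b *m w) - (b *m w) *m Pv) - (Pw *m (b *m x) - (b *m x) *m Pw) - brk R11 in
  let T10 := d3 - ((w - brk Gw) *m x + b *m d2)
    + (Pv *m w - w *m Pv) - (Gw *m (b *m x) - (b *m x) *m Gw) - brk R10 in
  let T01 := ((x - brk Gv) *m w + b *m d1) - d4
    + (Gv *m (b *m w) - (b *m w) *m Gv) - (Pw *m x - x *m Pw) - brk R01 in
  let T00 := d1 - d2 + (Gv *m w - w *m Gv) - (Gw *m x - x *m Gw) - brk R00 in
  T11 - b *m T10 - b *m T01 - T00
  = - brk R11 + b *m brk R10 + b *m brk R01 + brk R00.
Proof.
have bbl (Z : 'M[R]_n) : b *m (b *m Z) = - Z by rewrite mulmxA bb mulNmx mul1mx.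
move=> T11 T10 T01 T00; rewrite /T11 /T10 /T01 /T00 {T11 T10 T01 T00} /brk.
rewrite !(mulmxDl, mulmxDr, mulNmx, mulmxN) -!mulmxA !bbl.
generalize_products.
by apply/matrixP => i j; rewrite !mxE; ring.
Qed.

(** The four hypotheses are instances of the symmetry of [Gam]: this is where torsion-freeness
    removes the horizontal part. *)
Lemma nijenhuis_horizontal (v w k1 k2 k3 k4 : V) (x y' Pv Pw Gv Gw : 'M[R]_n) :
  Pv *m w = Gw *m (b *m v) -> Pv *m (b *m w) = Pw *m (b *m v) ->
  Pw *m v = Gv *m (b *m w) -> Gv *m w = Gw *m v ->
  ((b *m x - brk Pv) *m w + b *m k3) - ((b *m y' - brk Pw) *m v + b *m k4)
  - b *m (k3 - ((y' - brk Gw) *m v + b *m k2))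
  - b *m (((x - brk Gv) *m w + b *m k1) - k4) - (k1 - k2) = 0.
Proof.
move=> e1 e2 e3 e4.
have bbl p (Z : 'M[R]_(n, p)) : b *m (b *m Z) = - Z by rewrite mulmxA bb mulNmx mul1mx.
rewrite /brk !(mulmxDl, mulmxDr, mulNmx, mulmxN) -!mulmxA !bbl e1 e2 e3 e4.
generalize_products.
by apply/matrixP => i j; rewrite !mxE; ring.
Qed.

Lemma derive_vert (F : E -> E) xi : differentiable F z0 ->
  differentiable (fun z => vert z (F z)) z0 /\
  'D_xi (fun z => vert z (F z)) z0
  = vert z0 ('D_xi F z0) + brk ('D_xi.1 (Gam ^~ (F z0).1) y)
    + (Gam y (F z0).1 *m xi.2 - xi.2 *m Gam y (F z0).1).
Proof.
move=> dF; have [dG eG] := derive_Gam xi dF.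
have [db eb] := derive_snd xi differentiable_idE.
have [d2 e2] := derive_snd xi dF.
have eI : 'D_xi (fun z : E => z) z0 = xi := derive_id _ _.
rewrite eI in eb.
have [dl el] := derive_mulmx xi dG db.
have [dr er] := derive_mulmx xi db dG.
have dB : differentiable (fun z : E => Gam z.1 (F z).1 *m z.2 - z.2 *m Gam z.1 (F z).1) z0.
  exact: (differentiableB dl dr).
split; first exact: (differentiableD d2 dB).
apply: etrans (@deriveD _ _ _ _ _ z0 xi (diff_derivable d2) (diff_derivable dB)) _.
apply: etrans (congr1 (fun X => _ + X) (@deriveB _ _ _ _ _ z0 xi (diff_derivable dl)
  (diff_derivable dr))) _.
apply: etrans (congr2 (fun X Y => X + Y) e2 (congr2 (fun X Y => X - Y) el er)) _.
rewrite eG eb; exact: vert_expand.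
Qed.

Definition curv (u v : V) : 'M[R]_n :=
  'D_u (Gam ^~ v) y - 'D_v (Gam ^~ u) y + (Gam y u *m Gam y v - Gam y v *m Gam y u).

Lemma vertB (F H : E) : vert z0 (F - H) = vert z0 F - vert z0 H.
Proof.
have lG := Gam_lin Oz.
have e : Gam y (F.1 - H.1) = Gam y F.1 - Gam y H.1.
  have := lG (-1) H.1 F.1; rewrite /= !scaleN1r => eN.
  by rewrite addrC eN addrC.
rewrite /vert /= e mulmxBl mulmxBr.
move: (_ *m _) (_ *m _) (_ *m _) (_ *m _) => Y1 Y2 Y3 Y4.
by apply/matrixP => i j; rewrite !mxE; ring.
Qed.

(** [vert] is the covariant derivative of the tautological section [b]. Commuting two covariant
    derivatives of [b] yields the curvature acting on it by commutator. *)
Lemma vert_bracket (F H : E -> E) : differentiable F z0 -> differentiable H z0 ->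
  let f := (F z0).1 in let h := (H z0).1 in
  let x := vert z0 (F z0) in let w := vert z0 (H z0) in
  vert z0 (bracket F H) = 'D_(F z0) (fun z => vert z (H z)) z0
    - 'D_(H z0) (fun z => vert z (F z)) z0
    + (Gam y f *m w - w *m Gam y f) - (Gam y h *m x - x *m Gam y h) - brk (curv f h).
Proof.
move=> dF dH f h x w; have [_ e1] := derive_vert (F z0) dH; have [_ e2] := derive_vert (H z0) dF.
have gen (p q r d : 'M[R]_n) : p = q + d + r -> q = p - d - r.
  by move=> ->; rewrite addrAC addrK addrK.
apply: etrans (vertB _ _) _.
apply: etrans (congr2 (fun p q => p - q) (gen _ _ _ _ e1) (gen _ _ _ _ e2)) _.
rewrite -/f -/h /curv /x /w /vert /brk /=.
exact: vert_bracket_expand.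
Qed.

Let derive_acs (W : normedModType R) (F H : E -> W) xi := fun dF dH FH =>
  @derive_eq_acs W F H O y b oO Oz bb dF dH FH xi.

(** The equation of tangency holds along [acs]; differentiating it in a direction tangent to [acs]
    gives cross terms that are symmetric in [F] and [H], and they cancel in the bracket. *)
Lemma bracket_tangent (F H : E -> E) : differentiable F z0 -> differentiable H z0 ->
  (forall z, O z -> acs z -> tangent_acs z (F z)) ->
  (forall z, O z -> acs z -> tangent_acs z (H z)) -> tangent_acs z0 (bracket F H).
Proof.
move=> dF dH tF tH; have Sz : acs z0 := bb.
have D (K : E -> E) xi : differentiable K z0 ->
    (forall z, O z -> acs z -> tangent_acs z (K z)) -> tangent_acs z0 xi ->
    ('D_xi K z0).2 *m b + b *m ('D_xi K z0).2 = - ((K z0).2 *m xi.2 + xi.2 *m (K z0).2).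
  move=> dK tK txi; have [d2 e2] := derive_snd xi dK.
  have [db eb] := derive_snd xi differentiable_idE.
  have eI : 'D_xi (fun z : E => z) z0 = xi := derive_id _ _.
  rewrite eI in eb.
  have [dl el] := derive_mulmx xi d2 db; have [dr er] := derive_mulmx xi db d2.
  have dlr : differentiable (fun z : E => (K z).2 *m z.2 + z.2 *m (K z).2) z0.
    exact: (differentiableD dl dr).
  have e0 : 'D_xi (fun z : E => (K z).2 *m z.2 + z.2 *m (K z).2) z0 = 0.
    apply: etrans (derive_acs dlr (differentiable_cst 0 z0) tK txi) _.
    exact: derive_cst.
  have e1 : 'D_xi (fun z : E => (K z).2 *m z.2 + z.2 *m (K z).2) z0
      = ('D_xi K z0).2 *m b + (K z0).2 *m xi.2 + (xi.2 *m (K z0).2 + b *m ('D_xi K z0).2).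
    apply: etrans (@deriveD _ _ _ _ _ z0 xi (diff_derivable dl) (diff_derivable dr)) _.
    apply: etrans (congr2 (fun p q => p + q) el er) _.
    by rewrite eb e2.
  rewrite e0 in e1; apply/eqP; rewrite -addr_eq0; apply/eqP.
  by rewrite [RHS]e1 -!addrA; congr (_ + _); rewrite addrC -addrA.
have eF := D _ _ dF tF (tH _ Oz Sz); have eH := D _ _ dH tH (tF _ Oz Sz).
rewrite /tangent_acs /bracket /=.
have gen (p q r s : 'M[R]_n) : p *m b + b *m p = - (r *m s + s *m r) ->
    q *m b + b *m q = - (s *m r + r *m s) -> (p - q) *m b + b *m (p - q) = 0.
  move=> ep eq; rewrite mulmxBl mulmxBr addrACA -opprD ep eq [s *m r + _]addrC.
  exact: subrr.
exact: gen eH eF.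
Qed.

Section Fields.
Variables X Y JX JY : E -> E.
Hypotheses (dX : differentiable X z0) (dY : differentiable Y z0)
  (dJX : differentiable JX z0) (dJY : differentiable JY z0).
Hypotheses (tX : tangent_acs z0 (X z0)) (tY : tangent_acs z0 (Y z0))
  (tJX : tangent_acs z0 (JX z0)) (tJY : tangent_acs z0 (JY z0)).
Hypothesis hX : forall z, O z -> acs z ->
  (JX z).1 = z.2 *m (X z).1 /\ vert z (JX z) = z.2 *m vert z (X z).
Hypothesis hY : forall z, O z -> acs z ->
  (JY z).1 = z.2 *m (Y z).1 /\ vert z (JY z) = z.2 *m vert z (Y z).

(** The relation between [JF] and [F] holds only on [acs], but [xi] is tangent to it, so both sides
    have the same derivative along [xi]. *)
Let derive_J1 (F JF : E -> E) xi : differentiable F z0 -> differentiable JF z0 ->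
  (forall z, O z -> acs z -> (JF z).1 = z.2 *m (F z).1) -> tangent_acs z0 xi ->
  ('D_xi JF z0).1 = xi.2 *m (F z0).1 + b *m ('D_xi F z0).1.
Proof.
move=> dF dJF h txi; have [d1 e1] := derive_fst xi dF; have [dJ eJ] := derive_fst xi dJF.
have [db eb] := derive_snd xi differentiable_idE.
have eI : 'D_xi (fun z : E => z) z0 = xi := derive_id _ _.
rewrite eI in eb; have [dr er] := derive_mulmx xi db d1.
apply: etrans (esym eJ) _; apply: etrans (derive_acs dJ dr h txi) _.
by apply: etrans er _; rewrite eb e1.
Qed.

Let derive_J2 (F JF : E -> E) xi : differentiable F z0 -> differentiable JF z0 ->
  (forall z, O z -> acs z -> vert z (JF z) = z.2 *m vert z (F z)) -> tangent_acs z0 xi ->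
  'D_xi (fun z => vert z (JF z)) z0
  = xi.2 *m vert z0 (F z0) + b *m 'D_xi (fun z => vert z (F z)) z0.
Proof.
move=> dF dJF h txi; have [d1 e1] := derive_vert xi dF; have [dJ eJ] := derive_vert xi dJF.
have [db eb] := derive_snd xi differentiable_idE.
have eI : 'D_xi (fun z : E => z) z0 = xi := derive_id _ _.
rewrite eI in eb; have [dr er] := derive_mulmx xi db d1.
apply: etrans (derive_acs dJ dr h txi) _.
by apply: etrans er _; rewrite eb.
Qed.

Let snd_vert (xi : E) : xi.2 = vert z0 xi - brk (Gam y xi.1).
Proof. by rewrite /vert /brk /= addrK. Qed.

(** [A1] and [A2] stand for [J [JX, Y]] and [J [X, JY]], known through the two equations that define
    [J]. Derivatives of [JX] and [JY] are only taken in tangent directions, where they reduce to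
    derivatives of [X] and [Y]. *)
Lemma nijenhuis_flat (A1 A2 : E) :
  A1.1 = b *m (bracket JX Y).1 -> vert z0 A1 = b *m vert z0 (bracket JX Y) ->
  A2.1 = b *m (bracket X JY).1 -> vert z0 A2 = b *m vert z0 (bracket X JY) ->
  let N := bracket JX JY - A1 - A2 - bracket X Y in
  N.1 = 0 /\ vert z0 N = twistor_obstruction curv b (X z0).1 (Y z0).1.
Proof.
move=> A11 A12 A21 A22 N; have Sz : acs z0 := bb.
have [jx1 jx2] := hX Oz Sz; have [jy1 jy2] := hY Oz Sz.
rewrite /= in jx1 jx2 jy1 jy2.
have sJX : (JX z0).2 = b *m vert z0 (X z0) - brk (Gam y (b *m (X z0).1)).
  by rewrite snd_vert jx1 jx2.
have sJY : (JY z0).2 = b *m vert z0 (Y z0) - brk (Gam y (b *m (Y z0).1)).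
  by rewrite snd_vert jy1 jy2.
have hX1 z Oz' Sz' := (hX (z := z) Oz' Sz').1; have hX2 z Oz' Sz' := (hX (z := z) Oz' Sz').2.
have hY1 z Oz' Sz' := (hY (z := z) Oz' Sz').1; have hY2 z Oz' Sz' := (hY (z := z) Oz' Sz').2.
split.
  have e11 := derive_J1 dY dJY hY1 tJX; have e12 := derive_J1 dX dJX hX1 tJY.
  have e10 := derive_J1 dX dJX hX1 tY; have e01 := derive_J1 dY dJY hY1 tX.
  rewrite sJX in e11; rewrite sJY in e12; rewrite snd_vert in e10; rewrite snd_vert in e01.
  have sub (p q p' q' : V) : p = p' -> q = q' -> p - q = p' - q' by move=> -> ->.
  have B11 : (bracket JX JY).1 = _ := sub _ _ _ _ e11 e12.
  have B10 : (bracket JX Y).1 = _ := sub _ _ _ _ erefl e10.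
  have B01 : (bracket X JY).1 = _ := sub _ _ _ _ e01 erefl.
  rewrite B10 in A11; rewrite B01 in A21.
  apply: etrans (sub _ _ _ _ (sub _ _ _ _ (sub _ _ _ _ B11 A11) A21) (erefl (bracket X Y).1)) _.
  by apply: nijenhuis_horizontal; exact: Gam_sym.
have e11 := derive_J2 dY dJY hY2 tJX; have e12 := derive_J2 dX dJX hX2 tJY.
have e10 := derive_J2 dX dJX hX2 tY; have e01 := derive_J2 dY dJY hY2 tX.
rewrite sJX in e11; rewrite sJY in e12; rewrite snd_vert in e10; rewrite snd_vert in e01.
have B11 := vert_bracket dJX dJY; have B10 := vert_bracket dJX dY.
have B01 := vert_bracket dX dJY; have B00 := vert_bracket dX dY.
have sub (p q p' q' : 'M[R]_n) : p = p' -> q = q' -> p - q = p' - q' by move=> -> ->.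
have vb (B D1 D2 D1' D2' x x' w w' : 'M[R]_n) (f f' h h' : V) :
    B = D1 - D2 + (Gam y f *m w - w *m Gam y f) - (Gam y h *m x - x *m Gam y h) - brk (curv f h)
      ->
    D1 = D1' -> D2 = D2' -> f = f' -> h = h' -> x = x' -> w = w' ->
    B = D1' - D2' + (Gam y f' *m w' - w' *m Gam y f') - (Gam y h' *m x' - x' *m Gam y h')
      - brk (curv f' h').
  move=> -> -> -> -> -> -> ->; exact: erefl.
have {}B11 := vb _ _ _ _ _ _ _ _ _ _ _ _ _ B11 e11 e12 jx1 jy1 jx2 jy2.
have {}B10 := vb _ _ _ _ _ _ _ _ _ _ _ _ _ B10 erefl e10 jx1 erefl jx2 erefl.
have {}B01 := vb _ _ _ _ _ _ _ _ _ _ _ _ _ B01 e01 erefl erefl jy1 erefl jy2.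
rewrite B10 in A12; rewrite B01 in A22.
apply: etrans (vertB _ _) _.
apply: etrans (sub _ _ _ _ (etrans (vertB _ _) (sub _ _ _ _ (etrans (vertB _ _)
  (sub _ _ _ _ B11 A12)) A22)) B00) _.
exact: nijenhuis_vertical.
Qed.

End Fields.
End Nijenhuis.
End Curves.

(* Otherwise unification unfolds products of Jacobians down to limits. *)
#[local] Opaque mulmx.

(** * The total space of the endomorphism bundle *)

Section EndTAtlas.
Variables (R : realType) (n : nat) (M : topologicalType) (A : atlas 'cV[R]_n M).
Local Notation V := 'cV[R]_n.
Local Notation E := ('cV[R]_n * 'M[R]_n)%type.
Hypothesis hM : smooth_manifold A.
Let gA := smooth_manifold_good hM.
Let fV := good_framed gA.
Let B := endT_atlas A.
Implicit Types (i k : chart_ix A) (x : M) (p : endT R n M).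

Definition inv_jacobian i x : 'M[R]_n := endo_mx (fun v => of_tcoord i v x).

Definition transition_mx i k (y : V) : 'M[R]_n := endo_mx (fun v => 'D_v (transition i k) y).

Lemma jacobian_mul i x v : chart_dom i x -> Defs.jacobian i x *m v = tcoord i x v.
Proof. by move=> ix; apply: endo_mxE; exact: (tcoord_linear gA ix). Qed.

Lemma inv_jacobian_mul i x v : chart_dom i x -> inv_jacobian i x *m v = of_tcoord i v x.
Proof. by move=> ix; apply: (@endo_mxE _ _ (fun v => of_tcoord i v x));
  exact: (of_tcoord_linear gA ix). Qed.

Lemma jacobianK i x : chart_dom i x -> inv_jacobian i x *m Defs.jacobian i x = 1%:M.
Proof.
move=> ix; apply: mulmx_cV_inj => w.
rewrite -mulmxA mul1mx; apply: etrans (congr1 (mulmx _) (jacobian_mul w ix)) _.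
exact: (etrans (inv_jacobian_mul (tcoord i x w) ix) (tcoordK gA w ix)).
Qed.

Lemma inv_jacobianK i x : chart_dom i x -> Defs.jacobian i x *m inv_jacobian i x = 1%:M.
Proof. by move=> ix; apply: mulmx1C; exact: jacobianK. Qed.

Lemma invmx_jacobian i x : chart_dom i x -> invmx (Defs.jacobian i x) = inv_jacobian i x.
Proof.
move=> ix; have [u _] := mulmx1_unit (inv_jacobianK ix).
by rewrite -[invmx _]mulmx1 -(inv_jacobianK ix) mulmxA mulVmx // mul1mx.
Qed.

Lemma jacobian_at x : Defs.jacobian (chart_at A x) x = 1%:M.
Proof.
have cx := good_at gA x.
by apply: mulmx_cV_inj => w; rewrite (jacobian_mul _ cx) (tcoord_at gA) mul1mx.
Qed.

Lemma inv_jacobian_at x : inv_jacobian (chart_at A x) x = 1%:M.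
Proof. by have := jacobianK (good_at gA x); rewrite jacobian_at mulmx1. Qed.

Lemma transition_mx_mul i k x v : chart_dom i x -> chart_dom k x ->
  transition_mx i k (chart i x) *m v = 'D_v (transition i k) (chart i x).
Proof.
move=> ix kx; apply: (@endo_mxE _ _ (fun v => 'D_v (transition i k) (chart i x))) => a u w.
exact: (derive_linear _ _ _ (differentiable_transition gA ix kx)).
Qed.

Lemma transition_mxE i k x : chart_dom i x -> chart_dom k x ->
  transition_mx i k (chart i x) = Defs.jacobian k x *m inv_jacobian i x.
Proof.
move=> ix kx; apply: mulmx_cV_inj => w.
rewrite -mulmxA; apply: etrans (transition_mx_mul w ix kx) _.
apply: etrans (esym (tcoord_of_tcoord gA w ix kx)) _.
apply: etrans (esym (jacobian_mul _ kx)) _.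
exact: (congr1 (mulmx _) (esym (inv_jacobian_mul w ix))).
Qed.

#[local] Opaque Defs.jacobian inv_jacobian.

Lemma smooth_transition_mx i k :
  smooth_on (chart_img i (chart_dom k)) (transition_mx i k).
Proof.
have oO := good_open gA i k; apply: smooth_on_mx => [|r s]; first exact: oO.
apply: (@smooth_on_congr _ _ _ oO _
  (fun y => 'D_(delta_mx s ord0) (transition i k) y r ord0)).
  by move=> y _; rewrite [RHS]mxE.
apply: (smooth_on_entry oO); apply: smooth_on_derive; exact: (good_smooth gA i k).
Qed.

#[local] Opaque transition_mx.

Lemma endT_chartE i p : chart_dom i p.1 ->
  chart (a := B) i p = (chart i p.1, Defs.jacobian i p.1 *m p.2 *m inv_jacobian i p.1).
Proof. by move=> ip; rewrite /= invmx_jacobian. Qed.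

Lemma endT_chart_invE i x b : chart_dom i x ->
  chart_inv (a := B) i (chart i x, b) = (x, inv_jacobian i x *m b *m Defs.jacobian i x).
Proof. by move=> ix; rewrite /= (good_inv gA) // invmx_jacobian. Qed.

Lemma endT_transitionE i k x b : chart_dom i x -> chart_dom k x ->
  transition (A := B) i k (chart i x, b)
  = (chart k x, transition_mx i k (chart i x) *m b *m transition_mx k i (chart k x)).
Proof.
move=> ix kx.
have e : transition (A := B) i k (chart i x, b)
  = chart (a := B) k (chart_inv (a := B) i (chart i x, b)) by [].
apply: etrans e _.
apply: etrans (congr1 (chart (a := B) k) (endT_chart_invE b ix)) _.
apply: etrans (@endT_chartE k (x, _) kx) _.
apply: (congr1 (pair _)); rewrite [in LHS]/=.
apply: etrans _ (esym (congr2 (fun X Y => X *m b *m Y) (transition_mxE ix kx) (transition_mxE kx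
  ix))).
have gen (J K J' K' : 'M[R]_n) : J *m (K *m b *m J') *m K' = J *m K *m b *m (J' *m K').
  by rewrite !mulmxA.
exact: gen.
Qed.

Lemma endT_chart_img i k (U : set (endT R n M)) z : U `<=` [set p | chart_dom k p.1] ->
  chart_img (A := B) i U z -> chart_img i (chart_dom k) z.1.
Proof. by move=> Uk [p [Up ip] <-] /=; apply: chart_img_chart => //; exact: Uk. Qed.

Lemma endT_chart_img_dom i k :
  chart_img (A := B) i (chart_dom (a := B) k) = [set z | chart_img i (chart_dom k) z.1].
Proof.
apply/seteqP; split=> [z|[y b] /= [x [kx ix] <-]].
  exact: endT_chart_img.
exists (chart_inv (a := B) i (chart i x, b)); rewrite (endT_chart_invE b ix) //=.
rewrite (invmx_jacobian ix) !mulmxA (inv_jacobianK ix) mul1mx.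
by rewrite -mulmxA (inv_jacobianK ix) mulmx1.
Qed.

(** The chart change is the transition map on the base and conjugation by its Jacobian on the fibre.
    The inverse Jacobian is taken as the Jacobian of the reverse transition, so its smoothness needs
    no differentiation of matrix inverses. *)
Lemma endT_good : good_atlas B.
Proof.
have oD i k : open (chart_img (A := B) i (chart_dom (a := B) k)).
  rewrite endT_chart_img_dom; apply: (@open_comp _ _ (@fst V 'M[R]_n)).
    by move=> z _; exact: cvg_fst.
  exact: (good_open gA i k).
suff sm i k : smooth_on (chart_img (A := B) i (chart_dom (a := B) k))
    (transition (A := B) i k).
  split=> //; [exact: (framed_prod (framed_mx R n 1) (framed_mx R n n))
    |by move=> p; exact: (good_at gA)|].
  move=> i [x a] /= ix; rewrite (good_inv gA) // invmx_jacobian //.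
  have gen (J K : 'M[R]_n) : K *m J = 1%:M -> K *m (J *m a *m K) *m J = a.
    by move=> KJ; rewrite !mulmxA KJ mul1mx -mulmxA KJ mulmx1.
  by apply: (congr1 (pair x)); apply: gen; exact: jacobianK.
have oO := oD i k.
have fst_in z : chart_img (A := B) i (chart_dom (a := B) k) z -> chart_img i (chart_dom k) z.1.
  by rewrite endT_chart_img_dom.
apply: (@smooth_on_congr _ _ _ oO _ (fun z : E => (transition i k z.1,
   transition_mx i k z.1 *m z.2 *m transition_mx k i (transition i k z.1)))).
  move=> [y b] /set_mem /fst_in [x [kx ix] /= <-].
  by rewrite (transition_chart gA _ ix) -(endT_transitionE b ix kx).
have s1 : smooth_on (chart_img (A := B) i (chart_dom (a := B) k)) (fun z : E => z.1).
  by apply: (smooth_on_fst oO (framed_mx R n 1) (framed_mx R n n)); exact: smooth_on_id.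
have s2 : smooth_on (chart_img (A := B) i (chart_dom (a := B) k)) (fun z : E => z.2).
  by apply: (smooth_on_snd oO (framed_mx R n 1) (framed_mx R n n)); exact: smooth_on_id.
have st := smooth_on_comp oO fV fV fst_in s1 (good_smooth gA i k).
have sq := smooth_on_comp oO fV (framed_mx R n n) fst_in s1 (@smooth_transition_mx i k).
have ti z : chart_img (A := B) i (chart_dom (a := B) k) z ->
  chart_img k (chart_dom i) (transition i k z.1).
  by move=> /fst_in [x [kx ix] <-]; rewrite (transition_chart gA _ ix); exact: chart_img_chart.
have sr := smooth_on_comp oO fV (framed_mx R n n) ti st (@smooth_transition_mx k i).
apply: (smooth_on_pair oO st); apply: (smooth_on_mulmx oO _ sr).
exact: (smooth_on_mulmx oO sq s2).
Qed.

End EndTAtlas.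

(** [J], [K] are a Jacobian and its inverse, [dQ], [dQ'] their derivatives, related by
    differentiating [K J = 1]. The derivatives of the Jacobians in the fibre component cancel those
    in the transformed connection form. *)
Lemma gauge_expand (R : comNzRingType) n (J K a be dQ dQ' G : 'M[R]_n) :
  K *m J = 1%:M -> J *m K = 1%:M -> dQ' *m J + K *m dQ = 0 ->
  (dQ *m a + J *m be) *m K + J *m a *m dQ'
  + ((J *m (dQ' + G *m K)) *m (J *m a *m K) - (J *m a *m K) *m (J *m (dQ' + G *m K)))
  = J *m (be + (G *m a - a *m G)) *m K.
Proof.
move=> KJ JK e.
have {e} eQ : dQ = - (J *m (dQ' *m J)).
  have eK : K *m dQ = - (dQ' *m J) by apply/eqP; rewrite -addr_eq0 addrC e.
  by rewrite -[dQ]mul1mx -JK -mulmxA eK mulmxN.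
have KJl (Z : 'M[R]_n) : K *m (J *m Z) = Z by rewrite mulmxA KJ mul1mx.
rewrite eQ !(mulmxDl, mulmxDr, mulNmx, mulmxN) -!mulmxA !KJl.
generalize_products.
by apply/matrixP => i j; rewrite !mxE; ring.
Qed.

(** * The connection form and [vert] under change of chart *)

Section Naturality.
Variables (R : realType) (n : nat) (M : topologicalType) (A : atlas 'cV[R]_n M).
Local Notation V := 'cV[R]_n.
Local Notation E := ('cV[R]_n * 'M[R]_n)%type.
Hypothesis hM : smooth_manifold A.
Let gA := smooth_manifold_good hM.
Let fV := good_framed gA.
Let fM := framed_mx R n n.
Let B := endT_atlas A.
Let gB : good_atlas B := endT_good hM.
Variable nabla : (M -> V) -> M -> V -> V.
Hypothesis hN : is_connection A nabla.
Implicit Types (i k : chart_ix A) (x : M) (p : endT R n M).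

Section Point.
Variables (i : chart_ix A) (x : M).
Hypothesis ix : chart_dom i x.
Let c := chart_at A x.
Let cx : chart_dom c x := good_at gA x.
Let O := chart_img c (chart_dom i).
Let oO : open O := good_open gA c i.
Let Ox : O (chart c x) := chart_img_chart ix cx.
Let back := transition_mx i c \o transition c i.

Let smooth_back : smooth_on O back.
Proof.
apply: (smooth_on_comp oO fV fM _ (good_smooth gA c i) (@smooth_transition_mx _ _ _ _ hM i c)).
move=> _ [y [iy cy] <-]; rewrite -/(transition c i _) (transition_chart gA _ cy).
exact: chart_img_chart.
Qed.

Let differentiable_back : differentiable back (chart c x).
Proof. exact: (smooth_on_differentiable smooth_back Ox). Qed.

Let backE y : O y -> back y = Defs.jacobian c (chart_inv c y) *m inv_jacobian i (chart_inv c y).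
Proof.
move=> [z [iz cz] <-]; rewrite /back /= -/(transition c i _) (transition_chart gA _ cz).
by rewrite (good_inv gA _ _ cz); exact: (transition_mxE hM iz cz).
Qed.

Let back_at : back (chart c x) = inv_jacobian i x.
Proof. by rewrite (backE Ox) (good_inv gA _ _ cx) (jacobian_at hM) mul1mx. Qed.

Let forth_at : transition_mx c i (chart c x) = Defs.jacobian i x.
Proof. by apply: etrans (transition_mxE hM cx ix) _; rewrite (inv_jacobian_at hM) mulmx1. Qed.

Let differentiable_forth : differentiable (transition_mx c i) (chart c x).
Proof. exact: (smooth_on_differentiable (@smooth_transition_mx _ _ _ _ hM c i) Ox). Qed.

Let derive_back_forth u : 'D_u back (chart c x) *m Defs.jacobian i x
  + inv_jacobian i x *m 'D_u (transition_mx c i) (chart c x) = 0.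
Proof.
have e : {in O, (fun y => back y *m transition_mx c i y) =1 (fun=> 1%:M)}.
  move=> y /set_mem Oy; rewrite (backE Oy); move: Oy => [z [iz cz] <-].
  rewrite (good_inv gA _ _ cz) (transition_mxE hM cz iz).
  have gen (J1 K1 J2 K2 : 'M[R]_n) : K2 *m J2 = 1%:M -> J1 *m K1 = 1%:M ->
      J1 *m K2 *m (J2 *m K1) = 1%:M.
    by move=> h1 h2; rewrite mulmxA -(mulmxA J1) h1 mulmx1.
  by apply: gen; [exact: jacobianK|exact: inv_jacobianK].
have := etrans (esym (derive_bilinear_comp fM fM (@mulmx R n n n) u differentiable_back
  differentiable_forth))
   (derive_congr u oO Ox e).
rewrite back_at forth_at => ->; exact: derive_cst.
Qed.

(** The transformation law of a connection form: a field with constant components in chart [i] has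
    components [back w] in chart [c], and its covariant derivative is computed there. *)
Lemma christoffel_gauge u : christoffel nabla i (chart i x) (tcoord i x u)
  = Defs.jacobian i x *m ('D_u back (chart c x)
    + christoffel nabla c (chart c x) u *m inv_jacobian i x).
Proof.
apply: mulmx_cV_inj => w; apply: etrans (christoffel_mul hM hN _ w ix) _.
rewrite (tcoordK gA _ ix) -mulmxA; apply: etrans (esym (jacobian_mul hM _ ix)) _.
congr (_ *m _).
have oU : open (chart_dom i `&` chart_dom c).
  by apply: openI; [exact: (open_dom hM)|exact: (open_dom hM)].
have sZ : smooth_field A (chart_dom i `&` chart_dom c) (of_tcoord i w).
  move=> k; apply: (smooth_onS _ (@smooth_of_tcoord _ _ _ _ hM i w k)).
  by rewrite (chart_imgI gA); exact: subIsetl.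
have Ux : (chart_dom i `&` chart_dom c) x by split.
have := tcoord_nabla hM hN oU (fun _ h => h.2) Ux u sZ.
rewrite !(tcoord_at gA) => ->.
have e : {in O, field_coord c (of_tcoord i w) =1 (fun y => back y *m w)}.
  move=> _ /set_mem [y [iy cy] <-]; apply: etrans (field_coord_chart gA _ cy) _.
  rewrite (backE (chart_img_chart iy cy)) (good_inv gA _ _ cy) -mulmxA.
  by rewrite (inv_jacobian_mul hM _ iy) (jacobian_mul hM _ cy).
rewrite mulmxDl; congr (_ + _).
  apply: etrans (derive_congr u oO Ox e) _.
  have dw := differentiable_cst w (chart c x).
  apply: etrans (derive_bilinear_comp fM (framed_mx R n 1) (@mulmx R n n 1) u differentiable_back
    dw) _.
  apply: etrans (congr1 (fun Y : V => 'D_u back (chart c x) *m w + back (chart c x) *m Y)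
    (derive_cst w (chart c x) u)) _.
  by rewrite mulmx0 addr0.
by rewrite (e _ (mem_set Ox)) back_at mulmxA.
Qed.

Let fst_in z : chart_img (A := B) c (chart_dom (a := B) i) z -> O z.1.
Proof. by rewrite (endT_chart_img_dom hM). Qed.

Lemma endT_chart_own (a : 'M[R]_n) : chart (a := B) c (x, a) = (chart c x, a).
Proof.
apply: etrans (@endT_chartE _ _ _ _ hM c (x, a) cx) _.
by rewrite /= (jacobian_at hM) (inv_jacobian_at hM) mul1mx mulmx1.
Qed.

Lemma endT_tcoordE (a : 'M[R]_n) (xi : E) : tcoord (A := B) i (x, a) xi
  = (tcoord i x xi.1, ('D_xi.1 (transition_mx c i) (chart c x) *m a + Defs.jacobian i x *m xi.2)
      *m inv_jacobian i x + Defs.jacobian i x *m a *m 'D_xi.1 back (chart c x)).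
Proof.
have e0 : tcoord (A := B) i (x, a) xi = 'D_xi (transition (A := B) c i) (chart (a := B) c (x,
  a)) by [].
rewrite {}e0 endT_chart_own.
have oB := good_open gB c i.
have Oz : chart_img (A := B) c (chart_dom (a := B) i) (chart c x, a).
  by rewrite (endT_chart_img_dom hM).
pose F (z : E) : E := (transition c i z.1, transition_mx c i z.1 *m z.2 *m back z.1).
have e : {in chart_img (A := B) c (chart_dom (a := B) i), transition (A := B) c i =1 F}.
  move=> [y b] /set_mem /fst_in [y' [iy cy] /= <-].
  apply: etrans (endT_transitionE hM b cy iy) _.
  have et := transition_chart gA i cy.
  by rewrite /F /back [(_, b).1]/= [(_, b).2]/= [(_ \o _) _]/= -/(transition c i _) et.
apply: etrans (derive_congr xi oB Oz e) _.
have [d1 e1] := derive_fst xi (differentiable_idE (chart c x) a).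
have [d2 e2] := derive_snd xi (differentiable_idE (chart c x) a).
have eI : 'D_xi (fun z : E => z) (chart c x, a) = xi := derive_id _ _.
rewrite eI in e1 e2.
have comp (W : normedModType R) (g : V -> W) : differentiable g (chart c x) ->
    differentiable (fun z : E => g z.1) (chart c x, a) /\
    'D_xi (fun z : E => g z.1) (chart c x, a) = 'D_xi.1 g (chart c x).
  move=> dg; split; first exact: (differentiable_comp d1 dg).
  by apply: etrans (derive_comp xi d1 dg) _; rewrite e1.
have [dt et] := comp _ _ (differentiable_transition gA cx ix).
have [dq eq] := comp _ _ differentiable_forth.
have [db eb] := comp _ _ differentiable_back.
have [dm em] := derive_mulmx xi dq d2; have [dn en] := derive_mulmx xi dm db.
apply: etrans (derive_pair xi dt dn) _.
apply: (congr2 pair et); apply: etrans en _.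
apply: etrans (congr2 (fun X Y => X *m back (chart c x)
  + transition_mx c i (chart c x) *m a *m Y) em eb) _.
by rewrite eq e2 back_at forth_at.
Qed.

(** Neither the fibre component nor the Christoffel term is tensorial, but their sum transforms as
    an endomorphism. This makes the equations of [Jnabla] available in every chart. *)
Lemma vert_tcoord (a : 'M[R]_n) (xi : E) :
  vert (christoffel nabla i) (chart (a := B) i (x, a)) (tcoord (A := B) i (x, a) xi)
  = Defs.jacobian i x *m vert (christoffel nabla c) (chart c x, a) xi *m inv_jacobian i x.
Proof.
have e1 := @endT_chartE _ _ _ _ hM i (x, a) ix.
rewrite e1 endT_tcoordE /vert /= christoffel_gauge.
apply: gauge_expand; [exact: jacobianK|exact: inv_jacobianK|exact: derive_back_forth].
Qed.

End Point.
End Naturality.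

(** * The almost complex structure in a chart *)

Section JnablaTheory.
Variables (R : realType) (n : nat) (M : topologicalType) (A : atlas 'cV[R]_n M).
Local Notation V := 'cV[R]_n.
Local Notation E := ('cV[R]_n * 'M[R]_n)%type.
Hypothesis hM : smooth_manifold A.
Let gA := smooth_manifold_good hM.
Let B := endT_atlas A.
Let gB : good_atlas B := endT_good hM.
Variable nabla : (M -> V) -> M -> V -> V.
Hypothesis hN : is_connection A nabla.
Implicit Types (x : M) (xi eta : E).

(** The commutator of any matrix with [z.2] anticommutes with [z.2] once [z.2] has square [-1], so
    the correction in [vert] preserves tangency. *)
Lemma tangent_vert (Gam : V -> V -> 'M[R]_n) (z xi : E) : acs z ->
  tangent_acs z xi <-> vert Gam z xi *m z.2 + z.2 *m vert Gam z xi = 0.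
Proof.
rewrite /acs /= => zz; rewrite /tangent_acs /vert.
have -> (X G c : 'M[R]_n) : c *m c = - 1%:M ->
    (X + (G *m c - c *m G)) *m c + c *m (X + (G *m c - c *m G)) = X *m c + c *m X => //.
move=> cc; have cc' (Y : 'M[R]_n) : c *m (c *m Y) = - Y by rewrite mulmxA cc mulNmx mul1mx.
rewrite !(mulmxDl, mulmxDr, mulNmx, mulmxN) -!mulmxA cc cc' mulmxN mulmx1.
generalize_products.
by apply/matrixP => i j; rewrite !mxE; ring.
Qed.

Lemma vert_inj (Gam : V -> V -> 'M[R]_n) (z xi eta : E) :
  xi.1 = eta.1 -> vert Gam z xi = vert Gam z eta -> xi = eta.
Proof.
by case: xi eta => [v a] [w b] /= <-; rewrite /vert /= => /addIr ->.
Qed.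

Section Point.
Variables (x : M) (a : 'M[R]_n).
Let c := chart_at A x.
Let cx : chart_dom c x := good_at gA x.
Local Notation p := ((x, a) : endT R n M).
Let Oz : chart_img (A := B) c (chart_dom (a := B) c) (chart c x, a).
Proof. by rewrite (endT_chart_img_dom hM); exact: chart_img_chart. Qed.
Let oB := good_open gB c c.

Lemma dprojE xi : dproj A p xi = xi.1.
Proof.
have e : {in chart_img (A := B) c (chart_dom (a := B) c),
    (chart c \o (@fst M 'M[R]_n)) \o chart_inv (a := B) c =1 (fun z : E => z.1)}.
  move=> z /set_mem; rewrite (endT_chart_img_dom hM) /=.
  by case: z => [y b] /= [y' [_ cy] <-]; rewrite (good_inv gA _ _ cy).
have e0 : dproj A p xi = 'D_xi ((chart c \o (@fst M 'M[R]_n)) \o chart_inv (a := B) c) (chart (a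
  := B) c p) by [].
rewrite {}e0 (endT_chart_own hM).
apply: etrans (derive_congr xi oB Oz e) _.
have [_ e1] := derive_fst xi (differentiable_idE (chart c x) a).
apply: etrans e1 _; congr fst; exact: derive_id.
Qed.

Lemma extend_at w : extend A x w x = w.
Proof. by rewrite /extend -[RHS](tcoordK gA _ cx) (tcoord_at gA). Qed.

Lemma nabla_extend w v : nabla (extend A x w) x v = christoffel nabla c (chart c x) v *m w.
Proof.
have e : nabla (of_tcoord c w) x (of_tcoord c v x) = nabla (extend A x w) x v.
  by congr (nabla _ x _); exact: (extend_at v).
have e1 := christoffel_mul hM hN v w cx; rewrite e (tcoord_at gA) in e1.
exact: (esym e1).
Qed.

(** [f] gives the components of the section [s] as a function of the base and fibre coordinates of
    the preferred chart. *)
Lemma pullback_covE (f : V -> 'M[R]_n -> V) (s : endT R n M -> V) (w' : V) xi :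
  differentiable (fun z : E => f z.1 z.2) (chart c x, a) ->
  (forall y b, chart_dom c y -> tcoord c y (s (y,
    inv_jacobian c y *m b *m Defs.jacobian c y)) = f (chart c y) b) ->
  s p = w' -> pullback_cov A nabla s p xi
  = 'D_xi (fun z : E => f z.1 z.2) (chart c x, a)
    + christoffel nabla c (chart c x) xi.1 *m w'.
Proof.
move=> df hf sp; rewrite /pullback_cov [p.1]/= dprojE nabla_extend sp; congr (_ + _).
have e0 : tderiv B (fun q : endT R n M => tcoord c q.1 (s q)) p xi
  = 'D_xi ((fun q : endT R n M => tcoord c q.1 (s q)) \o chart_inv (a := B) c) (chart (a := B) c
    p) by [].
apply: etrans e0 _; rewrite (endT_chart_own hM).
apply: (derive_congr xi oB Oz) => -[y b] /set_mem; rewrite (endT_chart_img_dom hM).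
by case=> [y' [_ cy] /= <-]; rewrite (good_inv gA _ _ cy) (invmx_jacobian hM cy) hf.
Qed.

(** On a field with constant components [w] the induced connection gives
    [xi.2 w + Gam (a w) - a (Gam w)], which is [vert] applied to [w]. *)
Lemma pullback_cov_endE xi : pullback_cov_end A nabla (@tautological R n M) p xi
  = vert (christoffel nabla c) (chart c x, a) xi.
Proof.
rewrite -[RHS]endo_mx_mul; apply: eq_endo_mx => w; rewrite /tautological.
have [d2 e2] := derive_snd xi (differentiable_idE (chart c x) a).
have eI : 'D_xi (fun z : E => z) (chart c x, a) = xi := derive_id _ _.
rewrite eI in e2.
have [dm em] := derive_mulmx xi d2 (differentiable_cst w ((chart c x, a) : E)).
have ew : 'D_xi (cst w) ((chart c x, a) : E) = 0 by exact: derive_cst.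
have E1 : pullback_cov A nabla (fun q : endT R n M => q.2 *m extend A x w q.1) p xi
    = xi.2 *m w + christoffel nabla c (chart c x) xi.1 *m (a *m w).
  apply: etrans (@pullback_covE (fun _ b => b *m w) _ (a *m w) xi dm _ _) _.
  - move=> y b cy; apply: etrans (esym (jacobian_mul hM _ cy)) _.
    rewrite [(_, _).2]/= [(_, _).1]/=.
    apply: etrans (congr1 (fun Y => Defs.jacobian c y *m (inv_jacobian c y *m b *m Defs.jacobian
      c y *m Y))
      (esym (inv_jacobian_mul hM w cy))) _.
    have gen (J K : 'M[R]_n) : J *m K = 1%:M -> J *m (K *m b *m J *m (K *m w)) = b *m w.
      move=> JK; rewrite -!mulmxA (mulmxA J K) JK mul1mx; congr (_ *m _).
      by rewrite mulmxA JK mul1mx.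
    by apply: gen; exact: inv_jacobianK.
  - by rewrite [(_, _).2]/= [(_, _).1]/= extend_at.
  congr (_ + _); apply: etrans em _; rewrite e2.
  by apply: etrans (congr1 (fun Y => xi.2 *m w + a *m Y) ew) _; rewrite mulmx0 addr0.
have E2 : pullback_cov A nabla (fun q : endT R n M => extend A x w q.1) p xi
    = christoffel nabla c (chart c x) xi.1 *m w.
  apply: etrans (@pullback_covE (fun _ _ => w) _ w xi (differentiable_cst _ _) _ _) _.
  - by move=> y b cy; exact: (of_tcoordK gA w cy).
  - exact: extend_at.
  by apply: etrans (congr1 (fun Y => Y + christoffel nabla c (chart c x) xi.1 *m w) ew) _;
    rewrite add0r.
apply: etrans (congr2 (fun X Y => X - a *m Y) E1 E2) _.
by rewrite /vert /= !mulmxDl mulNmx !mulmxA addrA.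
Qed.

End Point.
End JnablaTheory.

(** * Conjugation by a Jacobian *)

Section Conjugation.
Variables (R : comNzRingType) (n : nat) (J K : 'M[R]_n).

Lemma conj_mul (X Y : 'M[R]_n) : K *m J = 1%:M ->
  (J *m X *m K) *m (J *m Y *m K) = J *m (X *m Y) *m K.
Proof. by move=> KJ; rewrite -!mulmxA (mulmxA K J) KJ mul1mx. Qed.

Lemma conj_inj (X : 'M[R]_n) : K *m J = 1%:M -> J *m X *m K = 0 -> X = 0.
Proof.
move=> KJ e; rewrite -[X]mul1mx -KJ -[X]mulmx1 -KJ.
have -> : K *m J *m (X *m (K *m J)) = K *m (J *m X *m K) *m J by rewrite !mulmxA.
by rewrite e mulmx0 mul0mx.
Qed.

Lemma conj_act m (X : 'M[R]_n) (Y : 'M[R]_(n, m)) : K *m J = 1%:M ->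
  J *m X *m K *m (J *m Y) = J *m (X *m Y).
Proof. by move=> KJ; rewrite -!mulmxA (mulmxA K J) KJ mul1mx. Qed.

Lemma conj_anticomm (X Y : 'M[R]_n) : K *m J = 1%:M ->
  J *m X *m K *m (J *m Y *m K) + J *m Y *m K *m (J *m X *m K)
  = J *m (X *m Y + Y *m X) *m K.
Proof. by move=> KJ; rewrite !conj_mul // mulmxDr mulmxDl. Qed.

Lemma vert_linear_expand (t : R) (X Y G H a : 'M[R]_n) :
  t *: X + Y + ((t *: G + H) *m a - a *m (t *: G + H))
  = t *: (X + (G *m a - a *m G)) + (Y + (H *m a - a *m H)).
Proof.
rewrite mulmxDl mulmxDr -scalemxAl -scalemxAr.
generalize_products.
by apply/matrixP => r s; rewrite !mxE; ring.
Qed.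

End Conjugation.

Section JnablaChart.
Variables (R : realType) (n : nat) (M : topologicalType) (A : atlas 'cV[R]_n M).
Local Notation V := 'cV[R]_n.
Local Notation E := ('cV[R]_n * 'M[R]_n)%type.
Hypothesis hM : smooth_manifold A.
Let gA := smooth_manifold_good hM.
Let B := endT_atlas A.
Variable nabla : (M -> V) -> M -> V -> V.
Hypothesis hN : is_connection A nabla.
Implicit Types (x : M) (a : 'M[R]_n) (xi eta : E).

Lemma Jnabla_spec x a xi : let c := chart_at A x in let z : E := (chart c x, a) in
  JM (x, a) -> TJM (x, a) xi ->
  [/\ TJM (x, a) (Jnabla A nabla (x, a) xi), (Jnabla A nabla (x, a) xi).1 = a *m xi.1
    & vert (christoffel nabla c) z (Jnabla A nabla (x, a) xi)
      = a *m vert (christoffel nabla c) z xi].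
Proof.
move=> c z aa txi; set P := [set eta | [/\ TJM (x, a) eta,
    dproj A (x, a) eta = tautological (x, a) *m dproj A (x, a) xi
  & pullback_cov_end A nabla (@tautological R n M) (x, a) eta
    = tautological (x, a) *m pullback_cov_end A nabla (@tautological R n M) (x, a) xi]].
suff : P (Jnabla A nabla (x, a) xi).
  by move=> [h1]; rewrite !(dprojE hM) !(pullback_cov_endE hM hN).
apply: xgetPex.
pose G := christoffel nabla c (chart c x) (a *m xi.1).
(* The horizontal component is forced; the fibre component comes from solving
   [vert z eta = a * vert z xi]. *)
pose eta : E := (a *m xi.1, a *m vert (christoffel nabla c) z xi - (G *m a - a *m G)).
have veta : vert (christoffel nabla c) z eta = a *m vert (christoffel nabla c) z xi.
  by rewrite {1}/vert /= subrK.
exists eta; split.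
- apply/(tangent_vert (christoffel nabla c) eta (aa : acs z)); rewrite veta.
  have /(tangent_vert (christoffel nabla c) xi (aa : acs z)) h : tangent_acs z xi by [].
  by rewrite -[_ *m _ *m z.2]mulmxA -mulmxDr h mulmx0.
- by rewrite !(dprojE hM).
- by rewrite !(pullback_cov_endE hM hN).
Qed.

Section Chart.
Variables (i : chart_ix A) (x : M) (a : 'M[R]_n).
Hypothesis ix : chart_dom i x.
Local Notation p := ((x, a) : endT R n M).
Let z : E := chart (a := B) i p.
Let J := Defs.jacobian i x.
Let K := inv_jacobian i x.
Let JK : J *m K = 1%:M := inv_jacobianK hM ix.
Let KJ : K *m J = 1%:M := jacobianK hM ix.
Let z2 : z.2 = J *m a *m K.
Proof. exact: (congr1 snd (@endT_chartE _ _ _ _ hM i p ix)). Qed.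
Let c := chart_at A x.

Let conjM (X Y : 'M[R]_n) : (J *m X *m K) *m (J *m Y *m K) = J *m (X *m Y) *m K.
Proof. exact: conj_mul. Qed.

Lemma acs_chart : JM p -> acs z.
Proof.
move=> aa; have aa' : a *m a = - 1%:M := aa; change (z.2 *m z.2 = - 1%:M).
by rewrite z2 conjM aa' mulmxN mulmx1 mulNmx JK.
Qed.

Lemma chart_acs : acs z -> JM p.
Proof.
move=> aa; have : z.2 *m z.2 = - 1%:M := aa; rewrite z2 conjM => e.
change (a *m a = - 1%:M); apply/eqP; rewrite -subr_eq0 opprK; apply/eqP.
by apply: (conj_inj KJ); rewrite mulmxDr mulmxDl e mulmx1 JK addNr.
Qed.

Lemma tangent_chart xi : JM p -> TJM p xi <-> tangent_acs z (tcoord (A := B) i p xi).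
Proof.
move=> aa; have zz := acs_chart aa.
apply: iff_trans (tangent_vert (christoffel nabla c) xi (aa : acs (chart c x, a))) _.
apply: iff_trans _ (iff_sym (tangent_vert (christoffel nabla i) _ zz)).
have e := etrans (congr2 (fun X Y => X *m Y + Y *m X) (vert_tcoord hM hN ix a xi) z2)
  (conj_anticomm _ a KJ).
split=> h; first by apply: etrans e _; rewrite [X in J *m X]h mulmx0 mul0mx.
exact: (conj_inj KJ (etrans (esym e) h)).
Qed.

(** Passing to chart [i] applies the Jacobian to horizontal components and conjugates both [vert]
    and the fibre coordinate, so the defining equations keep their form. A fixed chart is thus
    usable at all points of its domain. *)
Lemma Jnabla_chart xi : JM p -> TJM p xi ->
  (tcoord (A := B) i p (Jnabla A nabla p xi)).1 = z.2 *m (tcoord (A := B) i p xi).1 /\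
  vert (christoffel nabla i) z (tcoord (A := B) i p (Jnabla A nabla p xi))
  = z.2 *m vert (christoffel nabla i) z (tcoord (A := B) i p xi).
Proof.
move=> aa txi; have [_ e1 e2] := Jnabla_spec aa txi; split.
  have t1 eta : (tcoord (A := B) i p eta).1 = J *m eta.1.
    apply: etrans (congr1 fst (endT_tcoordE hM ix a eta)) _.
    exact: (esym (jacobian_mul hM _ ix)).
  apply: etrans (t1 _) _; apply: etrans (congr1 (mulmx J) e1) _.
  exact: (etrans (esym (conj_act a xi.1 KJ)) (esym (congr2 mulmx z2 (t1 xi)))).
have v1 eta := vert_tcoord hM hN ix a eta.
apply: etrans (v1 _) _; apply: etrans (congr1 (fun Y => J *m Y *m K) e2) _.
exact: (etrans (esym (conjM a _)) (esym (congr2 mulmx z2 (v1 xi)))).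
Qed.

End Chart.

(** By [vert_inj] a vector is determined by its horizontal and vertical components, on both of which
    [Jnabla] is left multiplication by [a]. *)
Lemma Jnabla_pointwise (p : endT R n M) : JM p ->
  [/\ forall xi, TJM p xi -> TJM p (Jnabla A nabla p xi),
      forall (t : R) u v, TJM p u -> TJM p v ->
        Jnabla A nabla p (t *: u + v) = t *: Jnabla A nabla p u + Jnabla A nabla p v
    & forall v, TJM p v -> Jnabla A nabla p (Jnabla A nabla p v) = - v].
Proof.
case: p => x a aa; set c := chart_at A x; set G := christoffel nabla c.
have cx : chart_dom c x := good_at gA x.
have lG : linear (G (chart c x)) := christoffel_linear hM hN cx.
have lv t xi eta : vert G (chart c x, a) (t *: xi + eta)
    = t *: vert G (chart c x, a) xi + vert G (chart c x, a) eta.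
  by rewrite /vert /= lG; exact: vert_linear_expand.
have tl t xi eta : TJM (x, a) xi -> TJM (x, a) eta -> TJM (x, a) (t *: xi + eta).
  rewrite /TJM /= => h1 h2; rewrite mulmxDl mulmxDr -scalemxAl -scalemxAr addrACA h2 addr0.
  by rewrite -scalerDr h1 scaler0.
split.
- by move=> xi txi; have [] := Jnabla_spec aa txi.
- move=> t u v tu tv; have [_ u1 u2] := Jnabla_spec aa tu; have [_ v1 v2] := Jnabla_spec aa tv.
  have [_ w1 w2] := Jnabla_spec aa (tl t _ _ tu tv).
  have gen m (X Y : 'M[R]_(n, m)) : a *m (t *: X + Y) = t *: (a *m X) + a *m Y.
    by rewrite mulmxDr -scalemxAr.
  apply: (vert_inj (Gam := G) (z := (chart c x, a))).
    exact: (etrans w1 (etrans (gen _ u.1 v.1) (esym (congr2 (fun X Y => t *: X + Y) u1 v1)))).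
  apply: etrans w2 _; apply: etrans (congr1 (mulmx a) (lv t u v)) _.
  apply: etrans (gen _ _ _) _.
  apply: etrans (congr2 (fun X Y => t *: X + Y) (esym u2) (esym v2)) _.
  exact: (esym (lv t _ _)).
move=> v tv; have [tJ v1 v2] := Jnabla_spec aa tv; have [_ w1 w2] := Jnabla_spec aa tJ.
have aal m (Y : 'M[R]_(n, m)) : a *m (a *m Y) = - Y by rewrite mulmxA aa mulNmx mul1mx.
have l0 : vert G (chart c x, a) 0 = 0.
  by have := lv (-1) 0 0; rewrite scaleN1r addNr scaleN1r addNr.
have vN : vert G (chart c x, a) (- v) = - vert G (chart c x, a) v.
  by have := lv (-1) v 0; rewrite l0 !addr0 !scaleN1r.
apply: (vert_inj (Gam := G) (z := (chart c x, a))).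
  exact: (etrans w1 (etrans (congr1 (mulmx a) v1) (aal _ v.1))).
exact: (etrans w2 (etrans (congr1 (mulmx a) v2) (etrans (aal _ _) (esym vN)))).
Qed.

End JnablaChart.

(** * Weyl component and integrability *)

Section Weyl.
Variables (R : realType) (n : nat) (M : topologicalType) (A : atlas 'cV[R]_n M).
Local Notation V := 'cV[R]_n.
Variable nabla : (M -> V) -> M -> V -> V.
Hypothesis n1 : (1 < n)%N.
Variable x : M.
Local Notation e_ k := (delta_mx k ord0 : V).

Lemma wedge_idD (Q S : V -> V -> R) (a b : R) (K u v w : V) :
  K + wedge_id (fun u v => a * Q u v + b * S u v) u v w
  = K + a *: wedge_id Q u v w + b *: wedge_id S u v w.
Proof.
rewrite /wedge_id; move: (Q u v) (Q u w) (Q v u) (Q v w) => q1 q2 q3 q4.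
move: (S u v) (S u w) (S v u) (S v w) => s1 s2 s3 s4.
by apply/matrixP => i j; rewrite !mxE; ring.
Qed.

Lemma weyl_eq0_wedge : (forall u v w, weyl A nabla x u v w = 0) ->
  forall u v w, curvature A nabla x u v w
  = - wedge_id (fun u v => (n%:R - 1)^-1 * ricci_sym A nabla x u v
       + (n%:R + 1)^-1 * ricci_skew A nabla x u v) u v w.
Proof.
move=> W0 u v w; apply/subr0_eq; rewrite opprK.
exact: (etrans (wedge_idD _ _ _ _ _ u v w) (W0 u v w)).
Qed.

(** The origin of the constants in the Weyl component: on the symmetric part of [q] the Ricci
    contraction is multiplication by [n - 1], on the skew part by [n + 1]. *)
Lemma ricci_wedge q : (forall u v w, curvature A nabla x u v w = - wedge_id (form_mx q) u v w) ->
  forall u v, ricci A nabla x u v = n%:R * form_mx q u v - form_mx q v u.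
Proof.
move=> h u v; rewrite /ricci /mxtrace.
have e (k : 'I_n) : endo_mx (fun w => curvature A nabla x u w v) k k
    = (v k ord0 * form_mx q u (e_ k) - v k ord0 * form_mx q (e_ k) u)
      + (form_mx q u v - u k ord0 * form_mx q (e_ k) v).
  have ek : (e_ k) k ord0 = 1 by rewrite mxE !eqxx.
  rewrite mxE h /wedge_id; move: (e_ k) ek => w ek.
  by rewrite !mxE ek; ring.
rewrite (eq_bigr _ (fun k _ => e k)) big_split /= !sumrB.
have lr (w z : V) : \sum_k w k ord0 * form_mx q z (e_ k) = form_mx q z w.
  have lf : linear (form_mx q z : V -> R^o) by move=> a b c; exact: form_mxDr.
  exact: (esym (linear_expand w lf)).
have ll (w z : V) : \sum_k w k ord0 * form_mx q (e_ k) z = form_mx q w z.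
  have lf : linear (fun w : V => form_mx q w z : R^o) by move=> a b c; exact: form_mxDl.
  exact: (esym (linear_expand w lf)).
rewrite lr !ll sumr_const card_ord -mulr_natl; ring.
Qed.

Lemma wedge_weyl_eq0 q : (forall u v w, curvature A nabla x u v w
  = - wedge_id (form_mx q) u v w) ->
  forall u v w, weyl A nabla x u v w = 0.
Proof.
move=> h u v w; rewrite /weyl h.
have n1' : n%:R - 1 != 0 :> R by rewrite subr_eq0 pnatr_eq1 gtn_eqF.
have n2' : n%:R + 1 != 0 :> R by rewrite natr1 pnatr_eq0.
have es : ricci_sym A nabla x = fun u v => (n%:R - 1) / 2 * (form_mx q u v + form_mx q v u).
  by apply/funext => a; apply/funext => b; rewrite /ricci_sym !(ricci_wedge h); field.
have ek : ricci_skew A nabla x = fun u v => (n%:R + 1) / 2 * (form_mx q u v - form_mx q v u).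
  by apply/funext => a; apply/funext => b; rewrite /ricci_skew !(ricci_wedge h); field.
rewrite es ek -wedge_idD /wedge_id.
have e a b : (n%:R - 1)^-1 * ((n%:R - 1) / 2 * (form_mx q a b + form_mx q b a))
   + (n%:R + 1)^-1 * ((n%:R + 1) / 2 * (form_mx q a b - form_mx q b a)) = form_mx q a b.
  by field; rewrite n1' n2'.
by rewrite !e addNr.
Qed.

End Weyl.

(** * Smoothness of [Jnabla] and its Nijenhuis tensor *)

Section Integrability.
Variables (R : realType) (n : nat) (M : topologicalType) (A : atlas 'cV[R]_n M).
Local Notation V := 'cV[R]_n.
Local Notation E := ('cV[R]_n * 'M[R]_n)%type.
Hypothesis hM : smooth_manifold A.
Let gA := smooth_manifold_good hM.
Let fV := framed_mx R n 1.
Let fM := framed_mx R n n.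
Let B := endT_atlas A.
Let gB : good_atlas B := endT_good hM.
Variable nabla : (M -> V) -> M -> V -> V.
Hypothesis hN : is_connection A nabla.

Section LocalExtension.
Variables (i : chart_ix A) (U : set (endT R n M)) (X : endT R n M -> E).
Hypotheses (oU : atlas_open B U) (Ui : U `<=` chart_dom (a := B) i).
Let G := christoffel nabla i.
Let O := chart_img (A := B) i U.
Let oO : open O := @oU i.
Let Xi := field_coord (A := B) i X.
Hypothesis sX : smooth_on O Xi.

Let O1 z : O z -> chart_img i (chart_dom i) z.1.
Proof. by apply: (endT_chart_img (k := i)) => p /Ui. Qed.

Let GL z : O z -> linear (G z.1).
Proof. by move=> /O1 [x [_ ix] <-]; exact: (christoffel_linear hM hN ix). Qed.

Let smooth_G (f : E -> V) : smooth_on O f -> smooth_on O (fun z => G z.1 (f z)).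
Proof.
move=> sf.
apply: (@smooth_on_congr _ _ _ oO _ (fun z => \sum_k f z k ord0 *: G z.1 (delta_mx k ord0))).
  by move=> z /set_mem Oz; rewrite [RHS](linear_expand _ (GL Oz)).
apply: (smooth_on_sum oO) => k; apply: (smooth_on_scale oO fM).
  exact: (smooth_on_entry oO).
have s1 : smooth_on O (fun z : E => z.1).
  by apply: (smooth_on_fst oO fV fM); exact: smooth_on_id.
exact: (smooth_on_comp oO fV fM O1 s1 (@smooth_christoffel _ _ _ _ hM _ hN i (delta_mx k ord0))).
Qed.

(** The equations of [Jnabla] solved in chart [i]. The formula makes sense off [z.2^2 = -1] too, so
    it provides a smooth field on an open set extending the one along [JM]. *)
Definition acs_coord (z : E) : E :=
  (z.2 *m (Xi z).1,
   z.2 *m vert G z (Xi z)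
   - (G z.1 (z.2 *m (Xi z).1) *m z.2 - z.2 *m G z.1 (z.2 *m (Xi z).1))).

Lemma smooth_acs_coord : smooth_on O acs_coord.
Proof.
have s2 : smooth_on O (fun z : E => z.2).
  by apply: (smooth_on_snd oO fV fM); exact: smooth_on_id.
have x1 := smooth_on_fst oO fV fM sX; have x2 := smooth_on_snd oO fV fM sX.
have br (f : E -> 'M[R]_n) : smooth_on O f -> smooth_on O (fun z : E => f z *m z.2 - z.2 *m f z).
  move=> sf; apply: (smooth_on_add oO); first exact: (smooth_on_mulmx oO sf s2).
  apply: (smooth_on_opp oO fM); exact: (smooth_on_mulmx oO s2 sf).
have f1 := smooth_on_mulmx oO s2 x1.
apply: (smooth_on_pair oO f1); apply: (smooth_on_add oO).
  apply: (smooth_on_mulmx oO s2); apply: (smooth_on_add oO x2).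
  exact: (br _ (smooth_G x1)).
apply: (smooth_on_opp oO fM); exact: (br _ (smooth_G f1)).
Qed.

Lemma acs_coord_Jnabla p : U p -> JM p -> TJM p (X p) ->
  field_of (A := B) i acs_coord p = Jnabla A nabla p (X p).
Proof.
move=> Up aa tX; have ip : chart_dom (a := B) i p := Ui Up.
rewrite -[RHS](tcoordK gB _ ip); congr (of_tcoord (A := B) i _ p).
case: p Up aa tX ip => x a Up aa tX ip.
have [e1 e2] := Jnabla_chart hM hN (ip : chart_dom i x) aa tX.
have eX : Xi (chart (a := B) i (x, a)) = tcoord (A := B) i (x, a) (X (x, a)).
  exact: (field_coord_chart gB _ ip).
have ev (z : E) : vert G z (acs_coord z) = z.2 *m vert G z (Xi z) by exact: subrK.
set z : E := chart (a := B) i (x, a) in e1 e2 eX.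
apply: (vert_inj (Gam := G) (z := z)).
  exact: (etrans (congr1 (fun Y : E => z.2 *m Y.1) eX) (esym e1)).
exact: (etrans (ev z) (etrans (congr1 (fun Y : E => z.2 *m vert G z Y) eX) (esym e2))).
Qed.

End LocalExtension.

Lemma Jnabla_almost_complex : almost_complex B (@JM R n M) (@TJM R n M) (Jnabla A nabla).
Proof.
split=> [p|U X p oU [sX tX] Up Sp]; first exact: Jnabla_pointwise.
pose i := chart_at A p.1; pose U' := U `&` chart_dom (a := B) i.
have oU' : atlas_open B U' by exact: (atlas_openI gB oU (atlas_open_dom gB i)).
have U'i : U' `<=` chart_dom (a := B) i by move=> q [].
have sX' : smooth_on (chart_img (A := B) i U') (field_coord (A := B) i X).
  by apply: (smooth_onS _ (@sX i)); rewrite /U' (chart_imgI gB); exact: subIsetl.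
have ext q : U' q -> JM q -> field_of (A := B) i (acs_coord i X) q = Jnabla A nabla q (X q).
  by move=> U'q Sq; exact: (acs_coord_Jnabla U'i U'q Sq (tX _ U'q.1 Sq)).
have tang q : U' q -> JM q -> TJM q (field_of (A := B) i (acs_coord i X) q).
  move=> U'q Sq; apply: (eq_ind_r (fun xi => TJM q xi) _ (ext q U'q Sq)).
  by have [h _ _] := Jnabla_pointwise hM hN Sq; exact: (h _ (tX _ U'q.1 Sq)).
exists U', (field_of (A := B) i (acs_coord i X)); split.
- exact: oU'.
- split; [exact: Up|exact: (good_at gA p.1)].
- split; [exact: (smooth_field_of gB oU' U'i (smooth_acs_coord oU' U'i sX'))|exact: tang].
by move=> q _ U'q Sq; exact: (ext q U'q Sq).
Qed.

Section NijenhuisAt.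
Hypothesis htf : torsion_free A nabla.
Variables (U : set (endT R n M)) (X Y JX JY : endT R n M -> E).
Hypotheses (oU : atlas_open B U)
  (tX : tangent_field B (@JM R n M) (@TJM R n M) U X)
  (tY : tangent_field B (@JM R n M) (@TJM R n M) U Y)
  (tJX : tangent_field B (@JM R n M) (@TJM R n M) U JX)
  (tJY : tangent_field B (@JM R n M) (@TJM R n M) U JY).
Hypothesis hJ : forall p, U p -> JM p ->
  JX p = Jnabla A nabla p (X p) /\ JY p = Jnabla A nabla p (Y p).
Variables (x : M) (a : 'M[R]_n).
Hypotheses (Up : U (x, a)) (aa : a *m a = - 1%:M).
Let c := chart_at A x.
Let cx : chart_dom c x := good_at gA x.
Let G := christoffel nabla c.
Let U' := U `&` chart_dom (a := B) c.
Let oU' : atlas_open B U' := atlas_openI gB oU (atlas_open_dom gB c).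
Let O := chart_img (A := B) c U'.
Let oO : open O := @oU' c.
Let Oz : O (chart c x, a).
Proof.
rewrite -(endT_chart_own hM).
apply: (@chart_img_chart _ _ _ B c U' (x, a)); [by split|exact: cx].
Qed.

Let field F := field_coord (A := B) c F.

Let smooth_field_O (F : endT R n M -> E) :
  smooth_field B U F -> differentiable (field F) (chart c x, a).
Proof.
move=> sF; have : smooth_on O (field F).
  by apply: (smooth_onS _ (@sF c)); rewrite /O /U' (chart_imgI gB); exact: subIsetl.
by move=> /smooth_on_differentiable; apply; exact: Oz.
Qed.

Let field_at F : field F (chart c x, a) = F (x, a).
Proof.
rewrite -(endT_chart_own hM); apply: etrans (field_coord_chart gB F (cx : chart_dom (a := B) c
  (x, a))) _.
exact: (@tcoord_at _ _ _ B gB (x, a) (F (x, a))).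
Qed.

Let O_chart z : O z -> exists y b, [/\ U (y, b), chart_dom c y & chart (a := B) c (y, b) = z].
Proof. by move=> [[y b] [[Uq _] cy] <-]; exists y, b. Qed.

Let tangent_O F : tangent_field B (@JM R n M) (@TJM R n M) U F ->
  forall z, O z -> acs z -> tangent_acs z (field F z).
Proof.
move=> [_ tF] _ /O_chart [y [b [Uq cy <-]]] /(chart_acs hM cy) bb.
have := (tangent_chart hM hN cy _ bb).1 (tF _ Uq bb).
by rewrite /field (field_coord_chart gB F (cy : chart_dom (a := B) c (y, b))).
Qed.

Let Jnabla_O F JF : tangent_field B (@JM R n M) (@TJM R n M) U F ->
  (forall p, U p -> JM p -> JF p = Jnabla A nabla p (F p)) ->
  forall z, O z -> acs z ->
  (field JF z).1 = z.2 *m (field F z).1 /\ vert G z (field JF z) = z.2 *m vert G z (field F z).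
Proof.
move=> [_ tF] hF _ /O_chart [y [b [Uq cy <-]]] /(chart_acs hM cy) bb.
have := Jnabla_chart hM hN cy bb (tF _ Uq bb).
rewrite /field !(field_coord_chart gB _ (cy : chart_dom (a := B) c (y, b))).
by rewrite hF.
Qed.

(** Computed in the preferred chart of [x], where tangent vectors at [(x, a)] are their own
    components; the tangency of the mixed brackets gives access to the equations of [Jnabla] on
    them. *)
Lemma nijenhuis_at :
  let N := lie_bracket B JX JY (x, a) - Jnabla A nabla (x, a) (lie_bracket B JX Y (x, a))
    - Jnabla A nabla (x, a) (lie_bracket B X JY (x, a)) - lie_bracket B X Y (x, a) in
  N.1 = 0 /\ N.2 = twistor_obstruction (curvature_mx nabla c (chart c x)) a (X (x, a)).1 (Y (x,
    a)).1.
Proof.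
have GL z : O z -> linear (G z.1).
  by move=> /O_chart [y [b [_ cy <-]]]; exact: (christoffel_linear hM hN cy).
have Gd v : differentiable (G ^~ v) (chart c x).
  apply: (smooth_on_differentiable (@smooth_christoffel _ _ _ _ hM _ hN c v)).
  exact: chart_img_chart.
have Gs u v : G (chart c x) u *m v = G (chart c x) v *m u := christoffel_sym hM hN u v htf cx.
have dX := smooth_field_O tX.1; have dY := smooth_field_O tY.1.
have dJX := smooth_field_O tJX.1; have dJY := smooth_field_O tJY.1.
have lb F H : lie_bracket B F H (x, a) = bracket (chart c x) a (field F) (field H).
  by rewrite /lie_bracket /bracket !field_at (endT_chart_own hM).
have tb F H : differentiable (field F) (chart c x, a) -> differentiable (field H) (chart c x,
  a) ->
    tangent_field B (@JM R n M) (@TJM R n M) U F -> tangent_field B (@JM R n M) (@TJM R n M) U H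
      ->
    TJM (x, a) (lie_bracket B F H (x, a)).
  move=> dF dH tF tH; rewrite lb.
  exact: (bracket_tangent oO Oz aa dF dH (tangent_O tF) (tangent_O tH)).
have [_ a1 a2] := Jnabla_spec hM hN aa (tb _ _ dJX dY tJX tY).
have [_ b1 b2] := Jnabla_spec hM hN aa (tb _ _ dX dJY tX tJY).
have tz F : tangent_field B (@JM R n M) (@TJM R n M) U F -> tangent_acs (chart c x,
  a) (field F (chart c x, a)).
  by move=> tF; apply: (tangent_O tF Oz).
have hX := Jnabla_O tX (fun p Up' Sp => (hJ Up' Sp).1).
have hY := Jnabla_O tY (fun p Up' Sp => (hJ Up' Sp).2).
move: a1 a2 b1 b2; rewrite !lb => a1 a2 b1 b2 N.
have [N1 N2] := nijenhuis_flat oO Oz aa GL Gd Gs dX dY dJX dJY (tz _ tX) (tz _ tY) (tz _ tJX) (tz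
  _ tJY)
  hX hY a1 a2 b1 b2.
rewrite !field_at in N2.
split; first exact: N1.
apply: etrans _ N2.
(* The horizontal part of [N] being zero, the connection term in [vert] vanishes and [vert N] is
   [N.2]. *)
have G0 : G (chart c x) 0 = 0.
  by have := GL _ Oz (-1) 0 0; rewrite /= !scaleN1r !addNr.
have gen (z : E) (W : E) : G z.1 W.1 = 0 -> W.2 = vert G z W.
  by rewrite /vert => ->; rewrite mul0mx mulmx0 subrr addr0.
by apply: gen; rewrite N1.
Qed.

End NijenhuisAt.

End Integrability.

(** * Integrability as a condition on the curvature *)

Section Equivalence.
Variables (R : realType) (n : nat) (M : topologicalType) (A : atlas 'cV[R]_n M).
Local Notation V := 'cV[R]_n.
Local Notation E := ('cV[R]_n * 'M[R]_n)%type.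
Hypothesis hM : smooth_manifold A.
Let gA := smooth_manifold_good hM.
Let B := endT_atlas A.
Let gB : good_atlas B := endT_good hM.
Variable nabla : (M -> V) -> M -> V -> V.
Hypotheses (hN : is_connection A nabla) (htf : torsion_free A nabla).
Local Notation tangent := (tangent_field B (@JM R n M) (@TJM R n M)).

Lemma curvatureE x u v w : let c := chart_at A x in
  curvature A nabla x u v w = curvature_mx nabla c (chart c x) u v *m w.
Proof.
move=> c; apply: etrans (esym (@tcoord_at _ _ _ A gA x _)) _.
exact: (curvature_field_of_tcoord hM hN u v w (good_at gA x)).
Qed.

Lemma tangent_fieldS (U U' : set (endT R n M)) X : U' `<=` U -> tangent U X -> tangent U' X.
Proof.
move=> sU [sX tX]; split=> [i|q /sU]; last exact: tX.
by apply: (smooth_onS _ (@sX i)) => _ [q [U'q iq] <-]; apply: chart_img_chart => //; exact: sU.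
Qed.

(** The equation [b^2 = -1] of [JM] in a chart does not involve the base point, so moving the base
    point alone stays tangent. *)
Lemma tangent_horizontal (c : chart_ix A) v :
  tangent (chart_dom (a := B) c) (field_of (A := B) c (fun=> (v, 0))).
Proof.
split.
  apply: (smooth_field_of gB (atlas_open_dom gB c) (fun _ h => h)).
  exact: smooth_on_cst.
move=> [y b] cy bb; apply/(tangent_chart hM hN (cy : chart_dom c y) _ bb).
have e : tcoord (A := B) c (y, b) (field_of (A := B) c (fun=> (v, 0)) (y, b)) = (v, 0).
  exact: (of_tcoordK gB (v, 0) (cy : chart_dom (a := B) c (y, b))).
apply: (eq_ind_r (fun xi => tangent_acs _ xi) _ e).
by rewrite /tangent_acs mul0mx mulmx0 addr0.
Qed.

(** Fields with constant components [(v, 0)] and [(w, 0)] realise arbitrary horizontal parts at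
    every point [(x, j)] of the fibre, so the Nijenhuis condition kills the obstruction for all [j],
    [v], [w]. *)
Lemma curvature_twistor_flat x : let c := chart_at A x in
  integrable_acs B (@JM R n M) (@TJM R n M) (Jnabla A nabla) ->
  twistor_flat (curvature_mx nabla c (chart c x)).
Proof.
move=> c [[_ ac] N0]; have cx : chart_dom c x := good_at gA x; split.
- by move=> v; exact: (curvature_mx_linear hM hN v cx).
- by move=> u v; exact: curvature_mxC.
- by move=> u v w; exact: (curvature_mx_bianchi hM hN u v w htf cx).
move=> j v w jj; pose p : endT R n M := (x, j).
pose D := chart_dom (a := B) c; have oD : atlas_open B D := atlas_open_dom gB c.
pose X := field_of (A := B) c (fun=> (v, 0)); pose Y := field_of (A := B) c (fun=> (w, 0)).
have tX : tangent D X := tangent_horizontal c v.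
have tY : tangent D Y := tangent_horizontal c w.
(* The smoothness of [Jnabla] supplies local extensions of [J X] and [J Y], to which the Nijenhuis
   condition can be applied. *)
have [U1 [JX [oU1 U1p tJX eJX]]] := ac D X p oD tX cx jj.
have [U2 [JY [oU2 U2p tJY eJY]]] := ac D Y p oD tY cx jj.
pose U := D `&` (U1 `&` U2).
have oU : atlas_open B U by exact: (atlas_openI gB oD (atlas_openI gB oU1 oU2)).
have tX' : tangent U X by apply: tangent_fieldS tX => q [].
have tY' : tangent U Y by apply: tangent_fieldS tY => q [].
have tJX' : tangent U JX by apply: tangent_fieldS tJX => q [_ []].
have tJY' : tangent U JY by apply: tangent_fieldS tJY => q [_ []].
have hJ q : U q -> JM q -> JX q = Jnabla A nabla q (X q) /\ JY q = Jnabla A nabla q (Y q).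
  by move=> [Dq [U1q U2q]] Sq; split; [exact: eJX|exact: eJY].
have Up : U p by split.
have [_ N2] := nijenhuis_at hM hN htf oU tX' tY' tJX' tJY' hJ Up jj.
have N1 := N0 U X Y JX JY oU tX' tY' tJX' tJY' hJ p Up jj.
have at_p u : field_of (A := B) c (fun=> (u, 0)) p = (u, 0).
  apply: etrans (esym (@tcoord_at _ _ _ B gB p _)) _.
  exact: (of_tcoordK gB (u, 0) (cx : chart_dom (a := B) c p)).
rewrite /X /Y !at_p in N2; apply: etrans (esym N2) _.
exact: (congr1 snd N1).
Qed.

End Equivalence.

Theorem theorem4p4 (R : realType) (m n : nat) (hm : (0 < m)%N)
    (hn : n = (2 * m)%N) (M : topologicalType) (A : atlas 'cV[R]_n M)
    (hM : smooth_manifold A)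
    (nabla : (M -> 'cV[R]_n) -> M -> 'cV[R]_n -> 'cV[R]_n)
    (hnabla : is_connection A nabla) (htf : torsion_free A nabla) :
  integrable_acs (endT_atlas A) (@JM R n M) (@TJM R n M) (Jnabla A nabla) <->
  (forall (x : M) (u v w : 'cV[R]_n), weyl A nabla x u v w = 0).
Proof.
have n1 : (1 < n)%N by rewrite hn; lia.
split=> [hI x|hW].
  (* The form [q] is found at each point separately, which is enough since the conclusion is
     pointwise. *)
  have [q hq] := twistor_flat_wedge hn hm (curvature_twistor_flat hM hnabla htf x hI).
  apply: (wedge_weyl_eq0 n1 (q := q)) => u v w.
  exact: (etrans (curvatureE hM hnabla x u v w) (hq u v w)).
split; first exact: Jnabla_almost_complex.
move=> U X Y JX JY oU tX tY tJX tJY hJ [x a] Up aa.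
have [N1 N2] := nijenhuis_at hM hnabla htf oU tX tY tJX tJY hJ Up aa.
(* With zero Weyl component, [Q] is the weighted sum of the symmetric and skew Ricci parts. *)
have hw u v w := etrans (esym (curvatureE hM hnabla x u v w)) (weyl_eq0_wedge (hW x) u v w).
have N0 := wedge_obstruction (X (x, a)).1 (Y (x, a)).1 aa hw.
by rewrite [LHS]surjective_pairing N1 N2 N0.
Qed.
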